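(* Fix a real number $0 < \delta < 1$ and an integer $r \geq 2$. There are a constant $C = C(\delta, r) > 0$ and a deterministic algorithm with the following property. Let $X_1, \ldots, X_n$ be finite probability spaces with at most $q$ elements each (where $q \geq 2$), let $X = X_1 \times \cdots \times X_n$ be the product probability space, and let $\phi_1, \ldots, \phi_m : X \to \mathbb{C}$ be functions such that, for some integer $c \geq 1$: (1) $|\phi_i(x) - \phi_i(y)| \leq 1$ for all $i$ whenever $x, y \in X$ differ in one coordinate; (2) for each $i$ there is a subset $J_i \subset \{1, \ldots, n\}$ with $|J_i| \leq r$ such that $\phi_i(x) = \phi_i(y)$ whenever $x_j = y_j$ for all $j \in J_i$; (3) $|\{i : j \in J_i\}| \leq c$ for all $j = 1, \ldots, n$. Let $f = \sum_{i=1}^m \phi_i$, let $\lambda \in \mathbb{C}$ satisfy $$|\lambda| \leq \frac{1-\delta}{3c\sqrt{r-1}},$$ and let $0 < \epsilon < 1$. Then, given this data, the algorithm computes an approximation of $\mathbf{E}\, e^{\lambda f}$ within relative error $\epsilon$ in time at most $$\bigl(q(m+n)\bigr)^{C(\ln(m+n) - \ln \epsilon)}.$$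
   Context: $\mathbf{E}$ denotes expectation with respect to the product probability measure on $X$. A complex number $z_1 \neq 0$ approximates a complex number $z_2 \neq 0$ within relative error $\epsilon$ if $z_1 = e^{w_1}$ and $z_2 = e^{w_2}$ for some $w_1, w_2 \in \mathbb{C}$ with $|w_1 - w_2| \leq \epsilon$. The algorithm is given the sets $J_i$, the probabilities of the elements of each $X_j$, and access to the values $\phi_i(x)$ for any given $x \in X$; time counts such accesses together with arithmetic operations on complex numbers (and evaluation of the exponential function), each at unit cost. *)

(* Defs.v *)
From HB Require Import structures.
From mathcomp Require Import all_boot all_order all_algebra.
From mathcomp Require Import complex.
From mathcomp Require Import reals sequences exp trigo.

Set Implicit Arguments.
Unset Strict Implicit.
Unset Printing Implicit Defensive.

Import Order.TTheory GRing.Theory Num.Theory.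
Local Open Scope ring_scope.
Local Open Scope complex_scope.

Definition cexp (R : realType) (z : R[i]) : R[i] :=
  (expR (complex.Re z))%:C *
  (cos (complex.Im z) +i* sin (complex.Im z)).

Definition approximates (R : realType) (z1 z2 : R[i]) (eps : R) : Prop :=
  [/\ z1 != 0, z2 != 0 &
      exists w1 w2 : R[i],
        [/\ z1 = cexp w1, z2 = cexp w2 & `|w1 - w2| <= eps%:C]].

Record finProbSpace (R : realType) := FinProbSpace {
  carrier :> finType;
  mass : carrier -> R;
  mass_ge0 : forall a, 0 <= mass a;
  mass_sum1 : \sum_a mass a = 1 }.

Definition prodSpace (R : realType) (n : nat) (X : 'I_n -> finProbSpace R) :=
  {dffun forall j : 'I_n, X j}.

Definition expectation (R : realType) (n : nat) (X : 'I_n -> finProbSpace R)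
    (g : prodSpace X -> R[i]) : R[i] :=
  \sum_(x : prodSpace X) (\prod_(j < n) mass (x j))%:C * g x.

Definition differ_in_one (R : realType) (n : nat) (X : 'I_n -> finProbSpace R)
    (x y : prodSpace X) : bool :=
  #|[set j | x j != y j]| == 1%N.

(* The model of computation is a unit-cost random access machine, with two
   unbounded memories: cells N[0], N[1], ... holding natural numbers (for
   counters, indices and addresses) and cells Z[0], Z[1], ... holding complex
   numbers.  The operands of an instruction are literal addresses.  Only natural
   numbers occur as constants in a program, and the only operations on N-cells
   are addition and truncated subtraction, so that neither real constants nor
   multiplication of long integers can be used to hide computations. *)
Inductive instr : Type :=
| NConst of nat & nat           (* N[d] := k *)
| NAdd of nat & nat & nat       (* N[d] := N[a] + N[b] *)
| NSub of nat & nat & nat       (* N[d] := N[a] - N[b], truncated at 0 *)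
| NLoad of nat & nat            (* N[d] := N[N[a]] *)
| NStore of nat & nat           (* N[N[a]] := N[b] *)
| ZConst of nat & nat           (* Z[d] := k *)
| ZAdd of nat & nat & nat       (* Z[d] := Z[a] + Z[b] *)
| ZSub of nat & nat & nat       (* Z[d] := Z[a] - Z[b] *)
| ZMul of nat & nat & nat       (* Z[d] := Z[a] * Z[b] *)
| ZDiv of nat & nat & nat       (* Z[d] := Z[a] / Z[b], where z / 0 = 0 *)
| ZExp of nat & nat             (* Z[d] := e^Z[a] *)
| ZLoad of nat & nat            (* Z[d] := Z[N[a]] *)
| ZStore of nat & nat           (* Z[N[a]] := Z[b] *)
| GetSize of nat & nat          (* N[d] := the number of elements of X_N[a] *)
| GetDep of nat & nat & nat     (* N[d] := 1 if N[b] is in J_N[a], else 0 *)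
| GetProb of nat & nat & nat    (* Z[d] := probability of element number N[b]
                                   of X_N[a] *)
| GetPhi of nat & nat & nat.    (* Z[d] := phi_N[a](x), where x_j is the
                                   element number N[N[b] + j] of X_j *)

Inductive test : Type :=
| NLt of nat & nat              (* N[a] < N[b] *)
| ZLt of nat & nat.             (* Re Z[a] < Re Z[b] *)

Inductive prog : Type :=
| Skip
| Do of instr
| Seq of prog & prog
| If of test & prog & prog
| While of test & prog.

Record state (R : realType) := State {
  nmem : nat -> nat;
  zmem : nat -> R[i] }.

(* What a program can read of its input, besides the initial memory. *)
Record oracle (R : realType) := Oracle {
  osize : nat -> nat;
  odep : nat -> nat -> bool;
  oprob : nat -> nat -> R[i];
  ophi : nat -> (nat -> nat) -> R[i] }.

Definition nset (R : realType) (s : state R) (d v : nat) : state R :=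
  State [eta nmem s with d |-> v] (zmem s).

Definition zset (R : realType) (s : state R) (d : nat) (v : R[i]) : state R :=
  State (nmem s) [eta zmem s with d |-> v].

Definition do_instr (R : realType) (o : oracle R) (i : instr) (s : state R) :
    state R :=
  let N := nmem s in
  let Z := zmem s in
  match i with
  | NConst d k => nset s d k
  | NAdd d a b => nset s d (N a + N b)%N
  | NSub d a b => nset s d (N a - N b)%N
  | NLoad d a => nset s d (N (N a))
  | NStore a b => nset s (N a) (N b)
  | ZConst d k => zset s d k%:R
  | ZAdd d a b => zset s d (Z a + Z b)
  | ZSub d a b => zset s d (Z a - Z b)
  | ZMul d a b => zset s d (Z a * Z b)
  | ZDiv d a b => zset s d (Z a / Z b)
  | ZExp d a => zset s d (cexp (Z a))
  | ZLoad d a => zset s d (Z (N a))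
  | ZStore a b => zset s (N a) (Z b)
  | GetSize d a => nset s d (osize o (N a))
  | GetDep d a b => nset s d (odep o (N a) (N b))
  | GetProb d a b => zset s d (oprob o (N a) (N b))
  | GetPhi d a b => zset s d (ophi o (N a) (fun j => N (N b + j)%N))
  end.

Definition do_test (R : realType) (t : test) (s : state R) : bool :=
  match t with
  | NLt a b => (nmem s a < nmem s b)%N
  | ZLt a b => complex.Re (zmem s a) < complex.Re (zmem s b)
  end.

(* exec o p s s' t: started in s, p halts in s' after t steps; each instruction
   and each evaluation of a test is one step. *)
Inductive exec (R : realType) (o : oracle R) :
    prog -> state R -> state R -> nat -> Prop :=
| exec_skip s : exec o Skip s s 0
| exec_do i s : exec o (Do i) s (do_instr o i s) 1
| exec_seq p1 p2 s s1 s2 t1 t2 :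
    exec o p1 s s1 t1 -> exec o p2 s1 s2 t2 ->
    exec o (Seq p1 p2) s s2 (t1 + t2)
| exec_if b p1 p2 s s1 t :
    exec o (if do_test b s then p1 else p2) s s1 t ->
    exec o (If b p1 p2) s s1 t.+1
| exec_while_false b p s :
    ~~ do_test b s -> exec o (While b p) s s 1
| exec_while_true b p s s1 s2 t1 t2 :
    do_test b s -> exec o p s s1 t1 -> exec o (While b p) s1 s2 t2 ->
    exec o (While b p) s s2 (t1 + t2).+1.

Lemma exec_deterministic (R : realType) (o : oracle R) p s s1 s2 t1 t2 :
  exec o p s s1 t1 -> exec o p s s2 t2 -> s1 = s2 /\ t1 = t2.
Proof.
move=> e; elim: e s2 t2 => {p s s1 t1}.
- by move=> s s2 t2 e2; inversion e2.
- by move=> i s s2 t2 e2; inversion e2.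
- move=> p1 p2 s s1 s2 t1 t2 _ IH1 _ IH2 s3 t3 e2.
  inversion e2 as [| |? ? ? ? ? ? ? d1 d2| | |]; subst.
  by have [? ?] := IH1 _ _ d1; subst; have [-> ->] := IH2 _ _ d2.
- move=> b p1 p2 s s1 t _ IH s2 t2 e2.
  inversion e2 as [| | |? ? ? ? ? ? d| |]; subst.
  by have [-> ->] := IH _ _ d.
- move=> b p s bF s2 t2 e2.
  inversion e2 as [| | | | |? ? ? ? ? ? ? bT d1 d2]; subst => //.
  by rewrite bT in bF.
- move=> b p s s1 s2 t1 t2 bT _ IH1 _ IH2 s3 t3 e2.
  inversion e2 as [| | | |? ? ? bF|? ? ? ? ? ? ? _ d1 d2]; subst.
    by rewrite bT in bF.
  by have [? ?] := IH1 _ _ d1; subst; have [-> ->] := IH2 _ _ d2.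
Qed.

(* Indices in {1, ..., n} and {1, ..., m} are numbered from 0, and the elements
   of X_j are numbered from 0 in the order of enum (X j).  Queries that are out
   of range return 0. *)
Definition input_oracle (R : realType) (n m : nat) (X : 'I_n -> finProbSpace R)
    (J : 'I_m -> {set 'I_n}) (phi : 'I_m -> prodSpace X -> R[i]) : oracle R :=
  {| osize j := if insub j is Some j' then #|X j'| else 0%N;
     odep i j :=
       match insub i, insub j with
       | Some i', Some j' => j' \in J i'
       | _, _ => false
       end;
     oprob j a :=
       if insub j is Some j' then
         if [pick e : X j' | enum_rank e == a :> nat] is Some e
         then (mass e)%:C else 0
       else 0;
     ophi i v :=
       if insub i is Some i' then
         if [pick x : prodSpace X | [forall j, enum_rank (x j) == v j :> nat]]
           is Some x
         then phi i' x else 0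
       else 0 |}.

(* N[0] = n, N[1] = m, Z[0] = lambda, Z[1] = eps, all other cells are 0. *)
Definition init_state (R : realType) (n m : nat) (lambda : R[i]) (eps : R) :
    state R :=
  State [eta (fun=> 0%N) with 0%N |-> n, 1%N |-> m]
        [eta (fun=> 0) with 0%N |-> lambda, 1%N |-> eps%:C].

Definition computes_in (R : realType) (o : oracle R) (p : prog) (s : state R)
    (z : R[i]) (t : nat) : Prop :=
  exists s' : state R, exec o p s s' t /\ z = zmem s' 0%N.

(* Main.v *)
(** A partition function [E prod_i W_i], in which each weight [W_i] depends on at
    most [r] coordinates, each coordinate enters at most [c] weights, and every
    weight varies little in relative terms, does not vanish: by induction on the
    number of integrated coordinates, fixing one coordinate to two different values
    and passing from one to the other one weight at a time changes the integral by
    a small relative amount, so the values averaged at the next step lie in a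
    narrow cone.  For [W_i = exp (z lambda phi_i)] this gives [E exp (z lambda f) != 0]
    for [|z| <= 1 / (1 - delta)], with a lower bound.  A high-degree Taylor
    polynomial of [z |-> E exp (z lambda f)] is therefore also zero-free in this
    disc, so its inverse roots have modulus at most [1 - delta] and the Taylor series
    of its logarithm at [z = 1] converges geometrically; [O (ln (m + n) - ln eps)]
    terms suffice.  These terms follow from the moments [E f ^ k] by Newton's
    identities, and [E f ^ k] is a sum over [k]-tuples of factors of expectations
    that involve at most [r k] coordinates. *)
Require Import Defs.
From HB Require Import structures.
From mathcomp Require Import boolp topology normedtype derive realfun.
From mathcomp Require Import all_boot all_order all_algebra.
From mathcomp Require Import complex.
From mathcomp Require Import reals sequences exp trigo.
From mathcomp Require Import ring lra zify.

Set Implicit Arguments.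
Unset Strict Implicit.
Unset Printing Implicit Defensive.

Import Order.TTheory GRing.Theory Num.Theory.
Import numFieldNormedType.Exports.
Local Open Scope ring_scope.
Local Open Scope complex_scope.

(** * The complex exponential *)

(** The logarithm is taken of a polynomial because one with constant term 1 splits into factors
    [1 - b z]: each is handled by real calculus along a ray, and the errors add up over fewer than
    [L] roots, [L] being the number of Taylor coefficients. This [L], of size about
    [N + r m + n + 1 / eps], lives only in the analysis; the program uses the first [N]
    coefficients, and [L] matters only through the demand that [L (1 - delta)^N] be small. The
    square root in the bound on [lambda] comes from the cone. If two conditional averages differ by
    a relative [rho], the cosine of their angle is at least [kap^2] as soon as [kap^4 <= 1 - rho^2],
    and one averaging loses at most a factor [kap] of the modulus. A change of one weight at one
    coordinate has to pass through at most [r - 1] further integrations, so it is magnified by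
    [kap^-(r-1)]. With [rho] of order [1 / sqrt (r - 1)] this stays bounded, and each of the at most
    [c] affected weights may vary by about [rho / c]. Programs contain natural constants only:
    [delta] and [r] act through two of them, and the order is found by doubling [eps^2] up to
    [m + n]. *)

Definition cn (R : rcfType) (z : R[i]) : R := complex.Re `|z|.

Section ComplexModulus.
Variable R : rcfType.
Implicit Types z w : R[i].

(** The norm of [R[i]] takes its values in [R[i]]; [cn] is the same number as an element of [R],
    where real arithmetic applies. *)
Lemma cnE z : `|z| = (cn z)%:C.
Proof. by case: z. Qed.

Lemma cn_ge0 z : 0 <= cn z.
Proof. by rewrite -lecR -cnE normr_ge0. Qed.

Lemma cn0 : cn (0 : R[i]) = 0.
Proof. by rewrite /cn normr0. Qed.

Lemma cn1 : cn (1 : R[i]) = 1.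
Proof. by rewrite /cn normr1. Qed.

Lemma cnM z w : cn (z * w) = cn z * cn w.
Proof. by apply: complexI; rewrite -cnE normrM !cnE rmorphM. Qed.

Lemma cnN z : cn (- z) = cn z.
Proof. by rewrite /cn normrN. Qed.

Lemma cn_eq0 z : (cn z == 0) = (z == 0).
Proof. by rewrite -(normr_eq0 z) cnE eq_complex /= eqxx andbT. Qed.

Lemma cn_gt0 z : (0 < cn z) = (z != 0).
Proof. by rewrite lt0r cn_ge0 andbT cn_eq0. Qed.

Lemma cnV z : cn z^-1 = (cn z)^-1.
Proof. by apply: complexI; rewrite -cnE normfV cnE fmorphV. Qed.

Lemma cnX z n : cn (z ^+ n) = cn z ^+ n.
Proof. by elim: n => [|n IH]; rewrite ?expr0 ?cn1 // !exprS cnM IH. Qed.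

Lemma cn_real (a : R) : cn a%:C = `|a|.
Proof. by rewrite /cn normc_def /= expr0n addr0 sqrtr_sqr. Qed.

Lemma cn_nat n : cn (n%:R : R[i]) = n%:R.
Proof. by rewrite /cn normr_nat -(rmorph_nat (real_complex R)). Qed.

Lemma cn_triangle z w : cn (z + w) <= cn z + cn w.
Proof. by rewrite -lecR rmorphD /= -!cnE ler_normD. Qed.

Lemma cnB z w : cn (z - w) = cn (w - z).
Proof. by rewrite -opprB cnN. Qed.

Lemma cn_subr_le z w : cn z - cn w <= cn (z - w).
Proof. by rewrite lerBlDr -{1}(subrK w z) cn_triangle. Qed.

Lemma cn_sum (I : Type) (s : seq I) (P : pred I) (F : I -> R[i]) :
  cn (\sum_(i <- s | P i) F i) <= \sum_(i <- s | P i) cn (F i).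
Proof.
elim/big_rec2: _ => [|i y x _ IH]; first by rewrite cn0.
by apply: le_trans (cn_triangle _ _) _; rewrite lerD2l.
Qed.

Lemma sqr_cn z : cn z ^+ 2 = complex.Re z ^+ 2 + complex.Im z ^+ 2.
Proof. by rewrite /cn normc_def /= sqr_sqrtr ?addr_ge0 ?sqr_ge0. Qed.

Lemma cReM z w : complex.Re (z * w)
  = complex.Re z * complex.Re w - complex.Im z * complex.Im w.
Proof. by case: z => a b; case: w. Qed.

Lemma cImM z w : complex.Im (z * w)
  = complex.Re z * complex.Im w + complex.Im z * complex.Re w.
Proof. by case: z => a b; case: w. Qed.

Lemma cReD z w : complex.Re (z + w) = complex.Re z + complex.Re w.
Proof. by case: z => a b; case: w. Qed.

Lemma cImD z w : complex.Im (z + w) = complex.Im z + complex.Im w.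
Proof. by case: z => a b; case: w. Qed.

Lemma Re_le_cn z : `|complex.Re z| <= cn z.
Proof. by rewrite -lecR -cnE normc_ge_Re. Qed.

Lemma Im_le_cn z : `|complex.Im z| <= cn z.
Proof.
rewrite -(@ler_pXn2r _ 2) ?nnegrE ?cn_ge0 // sqr_cn real_normK ?num_real //.
by rewrite lerDr sqr_ge0.
Qed.

Lemma cn_conj z : cn (conjc z) = cn z.
Proof. by rewrite /cn normcJ. Qed.

Lemma mulc_conj z : z * conjc z = (cn z ^+ 2)%:C.
Proof. by rewrite -sqr_normc cnE rmorphXn. Qed.

Lemma cn_le_ReIm z : cn z <= `|complex.Re z| + `|complex.Im z|.
Proof.
rewrite -(@ler_pXn2r _ 2) ?nnegrE ?cn_ge0 ?addr_ge0 // sqr_cn sqrrD.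
by rewrite !real_normK ?num_real // lerD2r lerDl mulrn_wge0 // mulr_ge0.
Qed.

End ComplexModulus.

(** * Taylor remainders of the exponential, logarithms near 1 *)

Section ComplexExponential.
Variable R : realType.
Implicit Types z w : R[i].

Lemma cexpE z : cexp z = (expR (complex.Re z) * cos (complex.Im z))
                    +i* (expR (complex.Re z) * sin (complex.Im z)).
Proof. by rewrite /cexp; simpc. Qed.

Lemma cexpD z w : cexp (z + w) = cexp z * cexp w.
Proof.
case: z => a b; case: w => c d; rewrite !cexpE; simpc => /=.
rewrite expRD cosD sinD; congr (_ +i* _); ring.
Qed.

Lemma cexp0 : cexp (0 : R[i]) = 1.
Proof. by rewrite cexpE /= expR0 cos0 sin0 mulr0 mulr1. Qed.

Lemma cn_cexp z : cn (cexp z) = expR (complex.Re z).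
Proof.
apply/eqP; rewrite -(@eqrXn2 _ 2) ?cn_ge0 ?expR_ge0 //; apply/eqP.
by rewrite sqr_cn cexpE /= !exprMn -mulrDr cos2Dsin2 mulr1.
Qed.

Lemma cexp_neq0 z : cexp z != 0.
Proof. by rewrite -cn_gt0 cn_cexp expR_gt0. Qed.

Lemma cexpN z : cexp (- z) = (cexp z)^-1.
Proof.
by apply: (mulfI (cexp_neq0 z)); rewrite -cexpD subrr cexp0 divff ?cexp_neq0.
Qed.

Lemma cexp_sum (I : Type) (s : seq I) (P : pred I) (F : I -> R[i]) :
  cexp (\sum_(i <- s | P i) F i) = \prod_(i <- s | P i) cexp (F i).
Proof. by elim/big_rec2: _ => [|i y x _ <-]; rewrite ?cexp0 // cexpD. Qed.

Lemma cn_cexp_le z : cn (cexp z) <= expR (cn z).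
Proof. by rewrite cn_cexp ler_expR (le_trans (ler_norm _)) ?Re_le_cn. Qed.

(** Complex functions are differentiated only along a ray [t w] with [t] real, so a pair of real
    derivatives is the right notion. *)
Definition cder (h : R -> R[i]) (dh : R[i]) (t : R) : Prop :=
  is_derive t 1 (fun u => complex.Re (h u)) (complex.Re dh) /\
  is_derive t 1 (fun u => complex.Im (h u)) (complex.Im dh).

Lemma cder_eq h (d d' : R[i]) t : d = d' -> cder h d t -> cder h d' t.
Proof. by move=> ->. Qed.

Lemma eq_cder h h' (d : R[i]) t : h =1 h' -> cder h d t -> cder h' d t.
Proof. by move=> /funext ->. Qed.

Lemma cder_cst (a : R[i]) t : cder (fun=> a) 0 t.
Proof. by split; exact: is_derive_cst. Qed.

Lemma cder_real (f : R -> R) (df t : R) :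
  is_derive t 1 f df -> cder (fun u => (f u)%:C) df%:C t.
Proof. by move=> H; split => //=; exact: is_derive_cst. Qed.

Lemma cder_id t : cder (fun u => u%:C) 1 t.
Proof. by have := @cder_real id 1 t (is_derive_id _ _). Qed.

Fact eq_is_derive (f g : R -> R) (df dg t : R) :
  is_derive t 1 f df -> f =1 g -> df = dg -> is_derive t 1 g dg.
Proof. by move=> H /funext <- <-. Qed.

Lemma cderD f g (df dg : R[i]) t : cder f df t -> cder g dg t ->
  cder (fun u => f u + g u) (df + dg) t.
Proof.
move=> [f1 f2] [g1 g2]; split.
  by apply: (eq_is_derive (is_deriveD f1 g1)) => [u|]; rewrite cReD.
by apply: (eq_is_derive (is_deriveD f2 g2)) => [u|]; rewrite cImD.
Qed.

Lemma cderM f g (df dg : R[i]) t : cder f df t -> cder g dg t ->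
  cder (fun u => f u * g u) (df * g t + f t * dg) t.
Proof.
move=> [f1 f2] [g1 g2]; split.
  apply: (eq_is_derive (is_deriveB (is_deriveM f1 g1) (is_deriveM f2 g2))).
    by move=> u; rewrite cReM.
  by rewrite cReD !cReM /GRing.scale /=; ring.
apply: (eq_is_derive (is_deriveD (is_deriveM f1 g2) (is_deriveM f2 g1))).
  by move=> u; rewrite cImM.
by rewrite cImD !cImM /GRing.scale /=; ring.
Qed.

Lemma cder_cexp f (df : R[i]) t : cder f df t ->
  cder (fun u => cexp (f u)) (df * cexp (f t)) t.
Proof.
move=> [f1 f2].
have E : is_derive t 1 (fun u => expR (complex.Re (f u)))
    (complex.Re df * expR (complex.Re (f t))).
  apply: (eq_is_derive (is_derive1_comp (is_derive_expR _) f1)) => //.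
  exact: mulrC.
have CE : is_derive t 1 (fun u => cos (complex.Im (f u)))
    (complex.Im df * - sin (complex.Im (f t))).
  apply: (eq_is_derive (is_derive1_comp (is_derive_cos _) f2)) => //.
  exact: mulrC.
have SE : is_derive t 1 (fun u => sin (complex.Im (f u)))
    (complex.Im df * cos (complex.Im (f t))).
  apply: (eq_is_derive (is_derive1_comp (is_derive_sin _) f2)) => //.
  exact: mulrC.
have C1 : cder (fun u => (expR (complex.Re (f u)))%:C) _ t := cder_real E.
have C2 : cder (fun u => cos (complex.Im (f u)) +i* sin (complex.Im (f u)))
  ((complex.Im df * - sin (complex.Im (f t))) +i*
   (complex.Im df * cos (complex.Im (f t)))) t by split.
apply: cder_eq (cderM C1 C2); rewrite /cexp.
case: df {f1 f2 E CE SE C1 C2} => a b /=; simpc; congr (_ +i* _); ring.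
Qed.

(** For each fixed [u] the real function [Re (u h) - |u| g] has nonpositive derivative on the
    segment, so the scalar mean value theorem applies in every direction; the direction of the
    increment itself then gives its modulus. *)
Lemma cder_mvt (h dh : R -> R[i]) (g dg : R -> R) (a b : R) : a <= b ->
  (forall t, cder h (dh t) t) -> (forall t : R, is_derive t 1 g (dg t)) ->
  (forall t, a <= t <= b -> cn (dh t) <= dg t) ->
  cn (h b - h a) <= g b - g a.
Proof.
move=> leab Hh Hg Hle.
have key (u : R[i]) : complex.Re (u * (h b - h a)) <= cn u * (g b - g a).
  pose F t := complex.Re (u * h t) - cn u * g t.
  pose dF t := complex.Re (u * dh t) - cn u * dg t.
  have dFE (t : R) : is_derive t 1 F (dF t).
    have [H1 _] := cderM (cder_cst u t) (Hh t).
    rewrite mul0r add0r in H1; rewrite /F /dF.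
    have H2 := is_deriveM (is_derive_cst (cn u) t 1) (Hg t).
    apply: (eq_is_derive (is_deriveB H1 H2)) => //.
    by rewrite /dF /GRing.scale /= mulr0 addr0.
  have [c cab E] : exists2 c, a <= c <= b & F b - F a = dF c * (b - a).
    case: (MVT_segment leab (fun x _ => dFE x)).
      apply: derivable_within_continuous => x _.
      by have [] := dFE x.
    by move=> c; rewrite in_itv /= => ? ?; exists c.
  have dle0 : dF c <= 0.
    rewrite /dF subr_le0.
    apply: le_trans (ler_norm _) _; apply: le_trans (Re_le_cn _) _.
    by rewrite cnM ler_wpM2l ?cn_ge0 ?Hle.
  have : F b - F a <= 0 by rewrite E mulr_le0_ge0 // subr_ge0.
  rewrite /F mulrBr cReD.
  have -> : complex.Re (- (u * h a)) = - complex.Re (u * h a).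
    by case: (u * h a).
  lra.
have [d0|dn0] := eqVneq (h b - h a) 0.
  by have := key 1; rewrite mul1r d0 cn0 cn1 mul1r.
(* For [u] the conjugate of the increment the left side is the squared modulus, and one factor
   cancels. *)
have := key (conjc (h b - h a)); rewrite mulrC mulc_conj /= expr2 cn_conj.
by rewrite ler_pM2l ?cn_gt0.
Qed.

Fact is_derive_expRM (a t : R) :
  is_derive t 1 (fun u : R => expR (u * a)) (a * expR (t * a)).
Proof.
have H : is_derive t 1 (fun u : R => u * a) a.
  apply: (eq_is_derive (is_deriveM (is_derive_id t 1) (is_derive_cst a t 1))).
    by [].
  by rewrite /GRing.scale /= mulr0 add0r mulr1.
apply: (eq_is_derive (is_derive1_comp (is_derive_expR _) H)) => //.
exact: mulrC.
Qed.

Lemma cderX f (df : R[i]) t n : cder f df t ->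
  cder (fun u => f u ^+ n.+1) (n.+1%:R * df * f t ^+ n) t.
Proof.
move=> fd; elim: n => [|n IH].
  by rewrite expr0 mulr1 mul1r; apply: (eq_cder _ fd) => u; rewrite expr1.
apply: (@eq_cder (fun u => f u * f u ^+ n.+1)).
  by move=> u; rewrite -exprS.
by apply: cder_eq (cderM fd IH); rewrite exprS -[n.+2%:R]natr1; ring.
Qed.

(** Over any field, because the complex remainder at [w] is compared with the real remainder at
    [cn w]. There are [L] terms, of degree below [L]. *)
Definition exp_taylor (K : fieldType) (L : nat) (w : K) : K :=
  \sum_(k < L) w ^+ k / k`!%:R.

Lemma cder_lin w t : cder (fun u => u%:C * w) w t.
Proof.
by apply: cder_eq (cderM (cder_id t) (cder_cst w t)); rewrite mul1r mulr0 addr0.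
Qed.

Lemma cder_exp_taylor L w t :
  cder (fun u => exp_taylor L.+1 (u%:C * w)) (w * exp_taylor L (t%:C * w)) t.
Proof.
elim: L => [|L IH].
  apply: (@eq_cder (fun=> 1)) => [u|].
    by rewrite /exp_taylor big_ord1 expr0 fact0 divr1.
  by rewrite /exp_taylor big_ord0 mulr0; exact: cder_cst.
pose T L u := exp_taylor L (u%:C * w) : R[i].
apply: (@eq_cder (fun u => T L.+1 u + (u%:C * w) ^+ L.+1 * (L.+1`!%:R)^-1)).
  by move=> u; rewrite /T /exp_taylor [RHS]big_ord_recr.
have := cderD IH (cderM (cderX L (cder_lin w t)) (cder_cst (L.+1`!%:R^-1) t)).
apply: cder_eq; rewrite [in RHS]/exp_taylor big_ord_recr mulrDr; congr (_ + _).
rewrite mulr0 addr0 factS natrM invfM.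
have : (L.+1%:R : R[i]) != 0 by rewrite pnatr_eq0.
have : (L`!%:R : R[i]) != 0 by rewrite pnatr_eq0 -lt0n fact_gt0.
move: (_%:R) (_%:R) => x y x0 y0.
rewrite -[LHS]mulrA; field.
by rewrite x0 y0.
Qed.

Lemma exp_taylor_real L (a : R) : exp_taylor L a%:C = (exp_taylor L a)%:C.
Proof.
rewrite /exp_taylor rmorph_sum; apply: eq_bigr => k _ /=.
by rewrite rmorphM fmorphV rmorphXn rmorph_nat.
Qed.

Lemma exp_taylorS0 (K : fieldType) L : exp_taylor L.+1 (0 : K) = 1.
Proof.
rewrite /exp_taylor big_ord_recl big1 ?addr0 => [|i _].
  by rewrite expr0 fact0 divr1.
by rewrite expr0n mul0r.
Qed.

(** Along the ray [t w] the remainder of order [L.+1] has derivative [w] times the remainder of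
    order [L]; the real bound obeys the same recursion, and both vanish at 0. The base case is
    [cn_cexp_le]. *)
Lemma cn_cexp_taylor L w :
  cn (cexp w - exp_taylor L w) <= expR (cn w) - exp_taylor L (cn w).
Proof.
suff H t : 0 <= t -> cn (cexp (t%:C * w) - exp_taylor L (t%:C * w))
    <= expR (t * cn w) - exp_taylor L (t * cn w).
  by have := H 1 ler01; rewrite !mul1r.
elim: L t => [|L IH] t t0.
  rewrite /exp_taylor !big_ord0 !subr0; apply: le_trans (cn_cexp_le _) _.
  by rewrite cnM cn_real ger0_norm.
pose h u := cexp (u%:C * w) - exp_taylor L.+1 (u%:C * w).
pose dh u := w * (cexp (u%:C * w) - exp_taylor L (u%:C * w)).
pose g u : R := expR (u * cn w) - exp_taylor L.+1 (u * cn w).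
pose dg u : R := cn w * (expR (u * cn w) - exp_taylor L (u * cn w)).
have hE u : cder h (dh u) u.
  have := cderD (cder_cexp (cder_lin w u))
    (cderM (cder_cst (-1) u) (cder_exp_taylor L w u)).
  rewrite mul0r add0r mulN1r /dh mulrBr; apply: eq_cder => v.
  by rewrite mulN1r.
have gE (u : R) : is_derive u 1 g (dg u).
  have [H _] := cder_exp_taylor L (cn w)%:C u.
  apply: (eq_is_derive (is_deriveB (is_derive_expRM (cn w) u) H)).
    move=> v; rewrite -[LHS]/(expR (v * cn w) -
      complex.Re (exp_taylor L.+1 (v%:C * (cn w)%:C))).
    by rewrite -rmorphM /= exp_taylor_real.
  by rewrite -rmorphM /= exp_taylor_real cReM /= mul0r subr0 /dg mulrBr.
have := cder_mvt t0 hE gE.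
rewrite /h /g !mul0r cexp0 expR0 !exp_taylorS0 !subrr !subr0; apply.
by move=> u /andP[u0 _]; rewrite /dh /dg cnM ler_wpM2l ?cn_ge0 ?IH.
Qed.

(** The real remainder is nonnegative because it dominates a modulus. *)
Lemma expR_taylor_ge L (x : R) : 0 <= x -> exp_taylor L x <= expR x.
Proof.
move=> x0; rewrite -subr_ge0.
have := cn_cexp_taylor L x%:C; rewrite cn_real ger0_norm //.
exact: le_trans (cn_ge0 _).
Qed.

(** The factor [expR x] is frozen at the right end of the interval, so that passing from one order
    to the next only raises the power of [t]. *)
Lemma expR_taylor_lagrange L (x t : R) : 0 <= t <= x ->
  expR t - exp_taylor L t <= t ^+ L / L`!%:R * expR x.
Proof.
elim: L t => [|L IH] t /andP[t0 tx].
  by rewrite /exp_taylor big_ord0 subr0 expr0 fact0 divr1 mul1r ler_expR.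
pose h (u : R) : R[i] := (expR u - exp_taylor L.+1 u)%:C.
pose dh (u : R) : R[i] := (expR u - exp_taylor L u)%:C.
pose g (u : R) : R := u ^+ L.+1 / L.+1`!%:R * expR x.
pose dg (u : R) : R := u ^+ L / L`!%:R * expR x.
have hE u : cder h (dh u) u.
  have H := cder_exp_taylor L 1 u.
  apply: (@eq_cder (fun u => (expR u)%:C + (-1) * exp_taylor L.+1 (u%:C * 1))).
    by move=> v; rewrite mulr1 exp_taylor_real /h rmorphB mulN1r.
  apply: cder_eq (cderD (cder_real (is_derive_expR u)) (cderM (cder_cst (-1) u) H)).
  by rewrite mulr1 mul0r add0r mul1r mulN1r exp_taylor_real /dh rmorphB.
have gE (u : R) : is_derive u 1 g (dg u).
  have [H _] := cderM (cderX L (cder_id u)) (cder_cst (expR x / L.+1`!%:R)%:C u).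
  apply: (eq_is_derive H).
    move=> v; rewrite -rmorphXn cReM /= mul0r subr0 /g; ring.
  rewrite mulr0 addr0 mulr1 -rmorphXn -(rmorph_nat (real_complex R)).
  rewrite -!rmorphM /= /dg factS natrM invfM mulrACA mulrA.
  have : (L.+1%:R : R) != 0 by rewrite pnatr_eq0.
  have : (L`!%:R : R) != 0 by rewrite pnatr_eq0 -lt0n fact_gt0.
  by move: (_%:R) (_%:R) => a b a0 b0; field; rewrite a0 b0.
have := cder_mvt t0 hE gE.
rewrite /h /g !exp_taylorS0 expR0 subrr subr0 expr0n !mul0r subr0 cn_real => H.
apply: le_trans (ler_norm _) (H _) => u /andP[u0 ut].
rewrite /dh /dg cn_real ger0_norm ?subr_ge0 ?expR_taylor_ge // IH //.
by rewrite u0 (le_trans ut).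
Qed.

(** As [y ^ L / L!] is one term of the series of [expR y], the factorial is traded for a free
    parameter [y]: the tail becomes geometric of ratio [x / y], at the price of a factor
    [expR y]. *)
Lemma exp_taylor_tail L (x y : R) : 0 <= x -> 0 < y ->
  expR x - exp_taylor L x <= (x / y) ^+ L * expR (x + y).
Proof.
move=> x0 y0; have xx : 0 <= x <= x by rewrite x0 lexx.
apply: le_trans (expR_taylor_lagrange L xx) _.
rewrite expRD [_ * expR y]mulrC mulrA ler_wpM2r ?expR_ge0 //.
have -> : x ^+ L = (x / y) ^+ L * y ^+ L by rewrite -exprMn divfK ?gt_eqF.
rewrite -mulrA ler_wpM2l ?exprn_ge0 ?(divr_ge0 x0 (ltW y0)) //.
apply: le_trans _ (expR_taylor_ge L.+1 (ltW y0)).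
rewrite /exp_taylor big_ord_recr /= lerDr; apply: sumr_ge0 => i _.
by rewrite divr_ge0 ?exprn_ge0 // ltW.
Qed.

Lemma expR_le_quadratic (x : R) : 0 <= x <= 2^-1 ->
  expR x <= 1 + x + (7%:R / 10%:R) * x ^+ 2.
Proof.
move=> /andP[x0 xh].
have e2 : expR x <= 2.
  have e1 : 2^-1 <= expR (- x) by apply: le_trans (expR_ge1Dx _); lra.
  by rewrite -[x]opprK expRN -[leRHS]invrK lef_pV2 ?posrE ?expR_gt0 ?invr_gt0.
have := expR_taylor_lagrange 3 (x := x) (t := x).
rewrite x0 lexx => /(_ isT).
rewrite /exp_taylor !big_ord_recr big_ord0 /= !factS fact0.
have -> : (3 * (2 * (1 * 1)) = 6)%N by [].
have -> : (2 * (1 * 1) = 2)%N by [].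
rewrite expr0 expr1 !muln1 !divr1.
(* The cubic remainder [x ^ 3 / 6] times [expR x <= 2], with [x <= 1 / 2], is at most [x ^ 2 / 6],
   and [1 / 2 + 1 / 6 < 7 / 10]. *)
have x3 : x ^+ 3 <= x ^+ 2 * 2^-1 by rewrite exprSr ler_wpM2l ?sqr_ge0.
have : x ^+ 3 / 6%:R * expR x <= (x ^+ 2 * 2^-1) / 6%:R * 2.
  by rewrite ler_pM ?mulr_ge0 ?exprn_ge0 ?expR_ge0 ?invr_ge0 ?ler0n //
             ler_wpM2r ?invr_ge0 ?ler0n.
have := sqr_ge0 x; move: (x ^+ 2) (x ^+ 3 / _ * _) => s u; lra.
Qed.

Lemma norm_atan_le (x : R) : `|atan x| <= `|x|.
Proof.
wlog x0 : x / 0 <= x => [H|].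
  have [/H//|/ltW x0] := leP 0 x.
  by rewrite -normrN -atanN -[leRHS]normrN H // oppr_ge0.
have := @cder_mvt (fun u => (atan u)%:C) (fun u => ((1 + u ^+ 2)^-1)%:C) id
  (fun=> 1) 0 x x0 (fun u => cder_real (is_derive1_atan u))
  (fun u => is_derive_id u 1).
rewrite atan0 !subr0 cn_real [`|x|]ger0_norm //; apply => t _.
by rewrite cn_real ger0_norm ?invr_ge0 ?addr_ge0 ?sqr_ge0 // invf_le1 ?lerDl ?sqr_ge0 //
   ltr_wpDr ?sqr_ge0.
Qed.

(** The witness is the principal logarithm [ln s + i atan (b / a)]. Within distance 1/2 of 1, both
    the real part [a] and the modulus [s] are at least 1/2, so each component of the logarithm is at
    most [2 d]. *)
Lemma complex_log_near1 (u : R[i]) : cn (u - 1) <= 2^-1 ->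
  exists2 w, cexp w = u & cn w <= 4 * cn (u - 1).
Proof.
set d := cn (u - 1) => d2.
have d0 : 0 <= d := cn_ge0 _.
case: u @d d2 d0 => a b d d2 d0.
have ad : `|a - 1| <= d by have := Re_le_cn ((a +i* b) - 1).
have bd : `|b| <= d by have := Im_le_cn ((a +i* b) - 1); rewrite /= subr0.
have a2 : 2^-1 <= a by move: ad; rewrite ler_norml => /andP[]; lra.
have a0 : 0 < a by lra.
set s := cn (a +i* b).
have s2 : s ^+ 2 = a ^+ 2 + b ^+ 2 by rewrite sqr_cn.
have s1 : `|s - 1| <= d.
  rewrite ler_norml /s /d; have := cn_subr_le (a +i* b) 1.
  have := cn_subr_le 1 (a +i* b); rewrite [cn (1 - _)]cnB cn1; lra.
have sh : 2^-1 <= s by move: s1; rewrite ler_norml => /andP[]; lra.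
have s0 : 0 < s by lra.
exists (ln s +i* atan (b / a)).
  rewrite cexpE /= lnK ?posrE //.
  have cE : cos (atan (b / a)) = a / s.
    rewrite cos_atan (_ : 1 + _ = (s / a) ^+ 2).
      by rewrite sqrtr_sqr ger0_norm ?divr_ge0 ?ltW // invf_div.
    by rewrite !exprMn s2; field; rewrite gt_eqF.
  have -> : sin (atan (b / a)) = (b / a) * cos (atan (b / a)).
    rewrite -{2}[b / a]atanK /tan divfK //.
    by rewrite cE mulf_neq0 ?invr_eq0 ?gt_eqF.
  by rewrite cE; congr (_ +i* _); field; rewrite ?gt_eqF.
apply: le_trans (cn_le_ReIm _) _ => /=.
have -> : 4 * d = 2 * d + 2 * d by ring.
apply: lerD.
  move: s1; rewrite !ler_norml => /andP[l1 l2].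
  (* The two signs of [ln s] come from [ln (1 + x) <= x], applied to [s] and to its inverse. *)
  have := le_ln1Dx (x := s - 1); rewrite [1 + _]addrC subrK => L1.
  have := le_ln1Dx (x := s^-1 - 1); rewrite [1 + _]addrC subrK lnV ?posrE // => L2.
  have sV : s^-1 - 1 <= 2 * d.
    have -> : s^-1 - 1 = (1 - s) / s by field; rewrite gt_eqF.
    by rewrite ler_pdivrMr //; nra.
  have sV1 : -1 < s^-1 - 1 by have := s0; rewrite -invr_gt0; lra.
  have := L1 ltac:(lra); have := L2 sV1; lra.
apply: le_trans (norm_atan_le _) _.
rewrite normrM normfV (ger0_norm (ltW a0)) ler_pdivrMr //; nra.
Qed.

(* Multiplying [1 - b] by the exponential of the truncated series of
   [- ln (1 - t b)] gives a function of [t] with derivative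
   [- b ^+ N.+1 * t ^+ N] times the exponential. *)
Lemma cexp_truncated_log N (rho : R) (b : R[i]) : 0 <= rho < 1 -> cn b <= rho ->
  cn ((1 - b) * cexp (\sum_(k < N) b ^+ k.+1 / k.+1%:R) - 1)
  <= rho ^+ N.+1 * expR (1 - rho)^-1.
Proof.
move=> /andP[r0 r1] br.
pose S n (u : R) := \sum_(k < n) (u%:C * b) ^+ k.+1 / k.+1%:R : R[i].
pose D n (u : R) := b * \sum_(k < n) (u%:C * b) ^+ k : R[i].
have SE n u : cder (S n) (D n u) u.
  elim: n => [|n IH].
    apply: (@eq_cder (fun=> 0)) => [v|]; first by rewrite /S big_ord0.
    by rewrite /D big_ord0 mulr0; exact: cder_cst.
  apply: (@eq_cder (fun v => S n v + (v%:C * b) ^+ n.+1 * n.+1%:R^-1)).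
    by move=> v; rewrite /S big_ord_recr.
  have := cderD IH (cderM (cderX n (cder_lin b u)) (cder_cst (n.+1%:R^-1) u)).
  apply: cder_eq; rewrite /D big_ord_recr mulrDr mulr0 addr0; congr (_ + _).
  by rewrite /=; field; rewrite nat1r pnatr_eq0.
pose h (u : R) := (1 + (-1) * (u%:C * b)) * cexp (S N u).
pose dh (u : R) := - b * (u%:C * b) ^+ N * cexp (S N u).
have geo k0 (x : R[i]) : (1 - x) * \sum_(k < k0) x ^+ k = 1 - x ^+ k0.
  by rewrite -opprB mulNr -subrX1 opprB.
have geoR k0 : (1 - rho) * \sum_(k < k0) rho ^+ k = 1 - rho ^+ k0.
  by rewrite -opprB mulNr -subrX1 opprB.
have hE u : cder h (dh u) u.
  have := cderM (cderD (cder_cst 1 u) (cderM (cder_cst (-1) u) (cder_lin b u)))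
     (cder_cexp (SE N u)).
  apply: cder_eq; rewrite mul0r !add0r !mulN1r /dh /D.
  rewrite mulrA [(1 - _) * (_ * _)]mulrCA geo; ring.
pose M := rho ^+ N.+1 * expR (1 - rho)^-1.
have gE (u : R) : is_derive u 1 (fun v : R => v * M) M.
  apply: (eq_is_derive (is_deriveM (is_derive_id u 1) (is_derive_cst M u 1))).
    by [].
  by rewrite /GRing.scale /= mulr0 add0r mulr1.
have := cder_mvt ler01 hE gE.
rewrite /h mul0r mulr0 addr0 mul1r mul0r subr0 mul1r.
have -> : S N 0 = 0.
  by rewrite /S big1 // => k _; rewrite mul0r expr0n mul0r.
rewrite cexp0 mul1r mulN1r /S !mul1r; apply => u /andP[u0 u1].
rewrite /dh cnM cnM cnX cnM cnN cn_real ger0_norm //.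
have ub : u * cn b <= rho.
  by apply: le_trans br; rewrite ler_piMl ?cn_ge0.
have ub0 : 0 <= u * cn b by rewrite mulr_ge0 ?cn_ge0.
rewrite /M exprS; apply: ler_pM;
  rewrite ?cn_ge0 ?mulr_ge0 ?exprn_ge0 ?cn_ge0 ?ub0 //.
  rewrite ler_pM ?exprn_ge0 ?mulr_ge0 ?cn_ge0 //.
  by rewrite lerXn2r ?nnegrE ?mulr_ge0 ?cn_ge0.
apply: le_trans (cn_cexp_le _) _; rewrite ler_expR.
(* Each term is at most [rho ^ k.+1], hence at most [rho ^ k], and the geometric series stays below
   [(1 - rho)^-1]. *)
apply: le_trans (cn_sum _ _ _) _.
apply: (@le_trans _ _ (\sum_(k < N) rho ^+ k)).
  apply: ler_sum => k _; rewrite cnM cnX cnV cn_nat cnM cn_real ger0_norm //.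
  apply: le_trans (_ : (u * cn b) ^+ k.+1 <= _).
    by rewrite ler_piMr ?exprn_ge0 ?mulr_ge0 ?cn_ge0 // invf_le1 ?ltr0n // ler1n.
  apply: le_trans (_ : rho ^+ k.+1 <= _).
    by rewrite lerXn2r ?nnegrE ?mulr_ge0 ?cn_ge0.
  by rewrite exprS ler_piMl ?exprn_ge0 // ltW.
have r1' : 0 < 1 - rho by lra.
rewrite -[leRHS]mul1r ler_pdivlMr // mulrC geoR.
by rewrite lerBlDr lerDl exprn_ge0.
Qed.

End ComplexExponential.

(** * Absence of zeros *)

Section Averages.
Variables (R : realType) (n : nat) (X : 'I_n -> finProbSpace R).
Local Notation P := (prodSpace X).
Implicit Types (x y : P) (S U : {set 'I_n}) (G h : P -> R[i]).

Definition upd x j (a : X j) : P :=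
  [ffun i => @eqtype.dfwith _ (fun j => X j : Type) x j a i].

Lemma upd_same x j (a : X j) : upd x a j = a.
Proof. by rewrite ffunE (@eqtype.dfwith_in _ (fun j => X j : Type)). Qed.

Lemma upd_other x j (a : X j) i : j != i -> upd x a i = x i.
Proof. by move=> ji; rewrite ffunE (@eqtype.dfwith_out _ (fun j => X j : Type)). Qed.

Lemma upd_upd x j (a b : X j) : upd (upd x a) b = upd x b.
Proof.
apply/ffunP => i; have [<-|ji] := eqVneq j i; first by rewrite !upd_same.
by rewrite !upd_other.
Qed.

Lemma updC x j l (a : X j) (b : X l) : j != l ->
  upd (upd x a) b = upd (upd x b) a.
Proof.
move=> jl; apply/ffunP => i; have [<-|ji] := eqVneq j i.
  by rewrite upd_same upd_other ?upd_same // eq_sym.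
have [<-|li] := eqVneq l i; first by rewrite upd_same upd_other ?upd_same.
by rewrite !upd_other.
Qed.

Lemma upd_agree (A : {pred 'I_n}) x y j (a : X j) :
  (forall i, i \in A -> x i = y i) ->
  forall i, i \in A -> upd x a i = upd y a i.
Proof.
move=> xy i iA; have [<-|ji] := eqVneq j i; first by rewrite !upd_same.
by rewrite !upd_other // xy.
Qed.

Definition agree_off S x y := [forall i, (i \notin S) ==> (y i == x i)].

Lemma agree_offP S x y :
  reflect (forall i, i \notin S -> y i = x i) (agree_off S x y).
Proof.
apply: (iffP forallP) => H i; first by move/(implyP (H i))/eqP.
by apply/implyP => /H ->.
Qed.

(* Conditional expectation, integrating out the coordinates in [S]. *)
Definition avg S G x : R[i] :=
  \sum_(y | agree_off S x y) (\prod_(j in S) mass (y j))%:C * G y.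

Lemma avg_ext S G G' x : G =1 G' -> avg S G x = avg S G' x.
Proof. by move=> E; apply: eq_bigr => y _; rewrite E. Qed.

Lemma avg0 G x : avg set0 G x = G x.
Proof.
rewrite /avg (big_pred1 x) ?big_set0 ?mul1r // => y.
apply/agree_offP/eqP => [H|-> //]; apply/ffunP => i.
by apply: H; rewrite inE.
Qed.

(** Fubini for one coordinate: the points averaged over are grouped by their value at [t]. *)
Lemma avgU1 S t G x : t \notin S ->
  avg (t |: S) G x = \sum_(a : X t) (mass a)%:C * avg S G (upd x a).
Proof.
move=> tS; rewrite /avg (partition_big (fun y : P => y t) predT) //=.
apply: eq_bigr => a _; rewrite big_distrr /=; apply: eq_big => [y|y /andP[_ /eqP ya]].
  apply/andP/agree_offP => [[/agree_offP H /eqP E] i iS|H].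
    have [ti|ti] := eqVneq t i; first by case: _ / ti; rewrite upd_same.
    by rewrite upd_other // H // !inE negb_or eq_sym ti.
  split; last by rewrite H // upd_same.
  apply/agree_offP => i; rewrite !inE negb_or => /andP[it iS].
  by rewrite H // upd_other // eq_sym.
by rewrite big_setU1 //= ya rmorphM mulrA.
Qed.

Lemma avgT G x : avg setT G x = expectation G.
Proof.
rewrite /avg /expectation; apply: eq_big => [y|y _].
  by apply/agree_offP => i; rewrite inE.
by congr (_%:C * _); apply: eq_bigl => j; rewrite inE.
Qed.

Lemma avgB S G G' x : avg S (fun y => G y - G' y) x = avg S G x - avg S G' x.
Proof. by rewrite /avg -sumrB; apply: eq_bigr => y _; rewrite mulrBr. Qed.

Lemma avgZ S (c : R[i]) G x : avg S (fun y => c * G y) x = c * avg S G x.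
Proof. by rewrite /avg big_distrr; apply: eq_bigr => y _; rewrite mulrCA. Qed.

Lemma avg_sum S (I : Type) (s : seq I) (G : I -> P -> R[i]) x :
  avg S (fun y => \sum_(i <- s) G i y) x = \sum_(i <- s) avg S (G i) x.
Proof.
rewrite /avg exchange_big /=; apply: eq_bigr => y _.
by rewrite big_distrr.
Qed.

Lemma avg_pull S h G x : (forall y, agree_off S x y -> h y = h x) ->
  avg S (fun y => h y * G y) x = h x * avg S G x.
Proof.
move=> hx; rewrite /avg big_distrr /=; apply: eq_bigr => y /hx ->.
by rewrite mulrCA.
Qed.

Lemma setS_ind (Q : {set 'I_n} -> Prop) : Q set0 ->
  (forall t S, t \notin S -> Q S -> Q (t |: S)) -> forall S, Q S.
Proof.
move=> Q0 QU S; have [s] := ubnP #|S|; elim: s S => // s IH S.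
have [->|/set0Pn[t tS]] := eqVneq S set0; first by [].
rewrite ltnS => Ss; rewrite -(setD1K tS); apply: QU; first by rewrite !inE eqxx.
by apply: IH; move: Ss; rewrite (cardsD1 t) tS.
Qed.

(** This turns two values of a coordinate outside [S] into two integrands at one base point, which
    can then be compared weight by weight. *)
Lemma avg_upd S G x j (a : X j) : j \notin S ->
  avg S (fun y => G (upd y a)) x = avg S G (upd x a).
Proof.
move: S x; apply: setS_ind => [|t S tS IH] x; first by rewrite !avg0.
rewrite !inE negb_or => /andP[jt jS]; rewrite !avgU1 //.
by apply: eq_bigr => b _; rewrite IH // updC // eq_sym.
Qed.

Lemma mass_sumC j : \sum_(a : X j) (mass a)%:C = 1 :> R[i].
Proof. by rewrite -rmorph_sum mass_sum1. Qed.

Lemma avg_cst S (c : R[i]) x : avg S (fun=> c) x = c.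
Proof.
move: S x; apply: setS_ind => [|t S tS IH] x; first by rewrite avg0.
rewrite avgU1 //; under eq_bigr do rewrite IH.
by rewrite -big_distrl /= mass_sumC mul1r.
Qed.

Lemma avg_le S G B x : (forall y, cn (G y) <= B) -> cn (avg S G x) <= B.
Proof.
move=> GB; move: S x; apply: setS_ind => [|t S tS IH] x; first by rewrite avg0.
rewrite avgU1 //; apply: le_trans (cn_sum _ _ _) _.
apply: (@le_trans _ _ (\sum_(a : X t) mass a * B)).
  apply: ler_sum => a _; rewrite cnM cn_real ger0_norm ?mass_ge0 //.
  by rewrite ler_wpM2l ?mass_ge0 ?IH.
by rewrite -big_distrl /= mass_sum1 mul1r.
Qed.

End Averages.

(** * Averages of complex numbers lying in a narrow cone *)

Section Cone.
Variable R : realType.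
Implicit Types z w : R[i].

(** The cosine of the angle between [z] and [w] is at least [kap ^ 2]. Expanding
    [|z - w|^2 <= rho^2 |w|^2] gives [2 Re >= |z|^2 + kap^4 |w|^2], and the square of
    [|z| - kap^2 |w|] is nonnegative. *)
Lemma Re_conj_ge (rho kap : R) z w : kap ^+ 4 <= 1 - rho ^+ 2 ->
  0 <= rho -> cn (z - w) <= rho * cn w ->
  kap ^+ 2 * (cn z * cn w) <= complex.Re (z * conjc w).
Proof.
move=> kr r0 zw.
have E : cn (z - w) ^+ 2 = cn z ^+ 2 - 2 * complex.Re (z * conjc w) + cn w ^+ 2.
  by rewrite !sqr_cn; case: z w {zw} => a b [c d] /=; ring.
have H : cn (z - w) ^+ 2 <= rho ^+ 2 * cn w ^+ 2.
  by rewrite -exprMn lerXn2r ?nnegrE ?mulr_ge0 ?cn_ge0.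
have H2 : kap ^+ 4 * cn w ^+ 2 <= (1 - rho ^+ 2) * cn w ^+ 2.
  by rewrite ler_wpM2r ?sqr_ge0.
have H3 : 0 <= (cn z - kap ^+ 2 * cn w) ^+ 2 by rewrite sqr_ge0.
have E3 : (cn z - kap ^+ 2 * cn w) ^+ 2 =
  cn z ^+ 2 - 2 * (kap ^+ 2 * (cn z * cn w)) + kap ^+ 4 * cn w ^+ 2 by ring.
move: H; rewrite E => H; rewrite E3 in H3; lra.
Qed.

(** The squared modulus of the sum is a double sum of [Re (F a conj (F b))] with nonnegative
    weights, so it inherits the pairwise factor [kap ^ 2]; the square root leaves a single [kap]. *)
Lemma cn_convex_ge (kap : R) (I : finType) (p : I -> R) (F : I -> R[i]) :
  0 <= kap -> (forall a, 0 <= p a) ->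
  (forall a b, kap ^+ 2 * (cn (F a) * cn (F b)) <= complex.Re (F a * conjc (F b))) ->
  kap * (\sum_a p a * cn (F a)) <= cn (\sum_a (p a)%:C * F a).
Proof.
move=> k0 p0 FF; set S := \sum_a (p a)%:C * F a; set T := \sum_a _.
have T0 : 0 <= T by apply: sumr_ge0 => a _; rewrite mulr_ge0 ?cn_ge0.
have ReS (I' : finType) (G : I' -> R[i]) :
    complex.Re (\sum_a G a) = \sum_a complex.Re (G a).
  by elim/big_rec2: _ => // a y z _ <-; rewrite cReD.
have H b : kap ^+ 2 * cn (F b) * T <= complex.Re (S * conjc (F b)).
  rewrite /S big_distrl /= ReS /T big_distrr /=; apply: ler_sum => a _.
  have -> : complex.Re ((p a)%:C * F a * conjc (F b))
      = p a * complex.Re (F a * conjc (F b)).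
    by rewrite -mulrA [LHS]cReM /= mul0r subr0.
  have := ler_wpM2l (p0 a) (FF a b).
  by congr (_ <= _); ring.
rewrite -(@ler_pXn2r _ 2) ?nnegrE ?mulr_ge0 ?cn_ge0 //.
have -> : cn S ^+ 2 = \sum_b p b * complex.Re (S * conjc (F b)).
  have -> : cn S ^+ 2 = complex.Re (S * conjc S) by rewrite (mulc_conj S).
  rewrite {2}/S rmorph_sum big_distrr /= ReS; apply: eq_bigr => b _.
  have -> : conjc ((p b)%:C * F b) = (p b)%:C * conjc (F b).
    by case: (F b) => x y; simpc.
  by rewrite mulrCA [LHS]cReM /= mul0r subr0.
have -> : (kap * T) ^+ 2 = \sum_b p b * (kap ^+ 2 * cn (F b) * T).
  transitivity (kap ^+ 2 * T * T); first by ring.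
  by rewrite {2}/T big_distrr; apply: eq_bigr => b _ /=; ring.
by apply: ler_sum => b _; rewrite ler_wpM2l.
Qed.

(** Each error is relative to the current value, which may itself have grown; hence a product of
    [1 + e t] instead of a sum. *)
Lemma cn_telescope (G : nat -> R[i]) (e : nat -> R) m :
  (forall t, (t < m)%N -> cn (G t.+1 - G t) <= e t * cn (G t)) ->
  (forall t, 0 <= e t) ->
  cn (G m - G 0%N) <= (\prod_(t < m) (1 + e t) - 1) * cn (G 0%N).
Proof.
move=> H e0; elim: m H => [|m IH] H.
  by rewrite big_ord0 !subrr cn0 mul0r.
have {}IH := IH (fun t tm => H t (ltnW tm)); have {}H := H m (ltnSn m).
rewrite big_ord_recr /=; set p := \prod_(t < m) _ in IH *.
have -> : G m.+1 - G 0%N = (G m.+1 - G m) + (G m - G 0%N) by ring.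
apply: le_trans (cn_triangle _ _) _.
have Gm : cn (G m) <= p * cn (G 0%N).
  rewrite -[G m](subrK (G 0%N)); apply: le_trans (cn_triangle _ _) _; lra.
have := ler_wpM2l (e0 m) Gm; lra.
Qed.

End Cone.

(** * Zero-freeness by induction on the integrated coordinates *)

Section ZeroFree.
Variables (R : realType) (n m : nat) (X : 'I_n -> finProbSpace R).
Variables (J : 'I_m -> {set 'I_n}) (k c : nat) (eta0 rho kap : R).
Local Notation P := (prodSpace X).
Implicit Types (x y : P) (S U : {set 'I_n}) (W : 'I_m -> P -> R[i]).
Hypothesis cardJ : forall i, (#|J i| <= k.+1)%N.
Hypothesis degJ : forall j, (#|[set i | j \in J i]| <= c)%N.
Hypotheses (eta0_ge0 : 0 <= eta0) (rho_ge0 : 0 <= rho).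
Hypotheses (kap_gt0 : 0 < kap) (kap_le1 : kap <= 1).
Hypothesis kap_rho : kap ^+ 4 <= 1 - rho ^+ 2.
Hypothesis rho_c : (1 + eta0 / kap ^+ k) ^+ c - 1 <= rho.

(** An abstract class of weights instead of the exponentials themselves, because the induction
    passes to hybrid families whose members see different frozen values of the same coordinate. *)
Definition tame (W : 'I_m -> P -> R[i]) : Prop :=
  [/\ forall i x, W i x != 0,
      forall i (x y : P), (forall j, j \in J i -> x j = y j) -> W i x = W i y &
      forall i x j (a : X j), cn (W i (upd x a) - W i x) <= eta0 * cn (W i x)].

Definition weight (W : 'I_m -> P -> R[i]) (x : P) : R[i] := \prod_i W i x.

Definition ratio_close (F : P -> R[i]) j := forall x (a b : X j),
  cn (F (upd x a) - F (upd x b)) <= rho * cn (F (upd x b)).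

Lemma avgU1_cn_ge (G : P -> R[i]) S t x : t \notin S -> ratio_close (avg S G) t ->
  kap * (\sum_(a : X t) mass a * cn (avg S G (upd x a))) <= cn (avg (t |: S) G x).
Proof.
move=> tS H; rewrite avgU1 //; apply: cn_convex_ge; first exact: ltW.
  exact: mass_ge0.
by move=> a b; apply: Re_conj_ge kap_rho rho_ge0 _; apply: H.
Qed.

(** Over the coordinates of [S] outside [U] the function [h] is constant and factors out. Those of
    [U] are then integrated one by one; each return from a sum of moduli to the modulus of a sum
    costs [kap^-1], by [avgU1_cn_ge]. *)
Lemma avg_perturb (W h : P -> R[i]) S U B x : U \subset S ->
  (forall S' j, S' \proper S -> j \notin S' -> ratio_close (avg S' W) j) ->
  (forall y z : P, (forall i, i \notin S :\: U -> y i = z i) -> h y = h z) ->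
  (forall y, cn (h y) <= B) ->
  cn (avg S (fun y => h y * W y) x) <= B / kap ^+ #|U| * cn (avg S W x).
Proof.
move=> US HS hU hB.
have B0 : 0 <= B := le_trans (cn_ge0 _) (hB x).
move: U S US HS hU x; apply: setS_ind => [|t U tU IH] S US HS hU x.
  rewrite avg_pull => [|y /agree_offP H].
    by rewrite cnM cards0 expr0 divr1 ler_wpM2r ?cn_ge0.
  by apply: hU => i; rewrite setD0 => /H.
have tS : t \in S by apply: (subsetP US); rewrite setU11.
have US' : U \subset S :\ t.
  apply/subsetP => i iU; rewrite !inE (subsetP US) ?inE ?iU ?orbT // andbT.
  by apply: contraNneq tU => <-.
have pS : S :\ t \proper S by rewrite properD1.
have tS' : t \notin S :\ t by rewrite setD11.
have {}IH y := IH (S :\ t) US' (fun S' j p => HS S' j (proper_trans p pS)) _ y.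
have hU' y (z : P) : (forall i, i \notin (S :\ t) :\: U -> y i = z i) -> h y = h z.
  move=> H; apply: hU => i Hi; apply: H; apply: contra Hi.
  by rewrite !inE negb_or => /and3P[-> -> ->].
rewrite -{1}(setD1K tS) avgU1 //.
apply: le_trans (cn_sum _ _ _) _.
have := avgU1_cn_ge x tS' (HS _ t pS tS'); rewrite setD1K // => kS.
apply: (@le_trans _ _ (B / kap ^+ #|U| *
    \sum_(a : X t) mass a * cn (avg (S :\ t) W (upd x a)))).
  rewrite big_distrr; apply: ler_sum => a _ /=.
  rewrite cnM cn_real ger0_norm ?mass_ge0 // mulrCA.
  by rewrite ler_wpM2l ?mass_ge0 ?IH.
rewrite cardsU1 tU /= add1n exprS invfM [kap^-1 * _]mulrC mulrA -[leRHS]mulrA.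
have k0 := ltW kap_gt0.
rewrite ler_wpM2l ?(mulr_ge0 B0) ?invr_ge0 ?exprn_ge0 //.
by rewrite ler_pdivlMl.
Qed.

(** Coordinate [j] no longer affects a hybrid, and a change at any other coordinate commutes with
    freezing [j]. *)
Lemma tame_hybrid W (j : 'I_n) (a b : X j) (t : nat) : tame W ->
  tame (fun i y => if (i < t)%N then W i (upd y a) else W i (upd y b)).
Proof.
move=> [W0 Wl Wv]; split=> [i x|i x y xy|i x l d].
- by case: ifP.
- by case: ifP => _; apply: Wl; apply: upd_agree.
- have H (e : X j) : cn (W i (upd (upd x d) e) - W i (upd x e)) <= eta0 * cn (W i (upd x e)).
    move: e; have [<-|lj] := eqVneq l j => e.
      by rewrite upd_upd subrr cn0 mulr_ge0 ?cn_ge0.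
    by rewrite updC.
  by case: ifP.
Qed.

(** The hybrid products [G t] lead from the value [b] to the value [a] at [j], one weight at a time.
    Replacing weight [t] perturbs the average by a relative [eta], and only if [j] belongs to its
    set of coordinates. *)
Lemma avg_ratio W S j : tame W -> j \notin S ->
  (forall W' S' j', tame W' -> S' \proper S -> j' \notin S' ->
     ratio_close (avg S' (weight W')) j') ->
  ratio_close (avg S (weight W)) j.
Proof.
move=> tW jS HS x a b.
pose Wt t (i : 'I_m) y := if (i < t)%N then W i (upd y a) else W i (upd y b).
pose G t := avg S (weight (Wt t)) x.
have G0 : G 0%N = avg S (weight W) (upd x b).
  by rewrite -avg_upd //; apply: avg_ext => y; apply: eq_bigr.
have Gm : G m = avg S (weight W) (upd x a).
  rewrite -avg_upd //; apply: avg_ext => y; apply: eq_bigr => i _.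
  by rewrite /Wt ltn_ord.
pose eta := eta0 / kap ^+ k.
have eta_ge0 : 0 <= eta by rewrite divr_ge0 ?exprn_ge0 // ltW.
(* Weights that ignore [j] contribute no error, so at most [c] factors [1 + eta] survive in the
   product. *)
pose e (t : nat) : R :=
  if insub t is Some i then (if j \in J i then eta else 0) else 0.
have e0 t : 0 <= e t by rewrite /e; case: insub => // i; case: ifP.
rewrite -Gm -G0; apply: le_trans (cn_telescope (e := e) _ e0) _.
  move=> t tm; have [W0 Wl Wv] := tW; pose i0 := Ordinal tm.
  pose h y := W i0 (upd y a) / W i0 (upd y b) - 1.
  have -> : G t.+1 - G t = avg S (fun y => h y * weight (Wt t) y) x.
    rewrite /G -avgB; apply: avg_ext => y; rewrite /h mulrBl mul1r; congr (_ - _).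
    rewrite /weight (bigD1 i0) // [in RHS](bigD1 i0) //= mulrA /Wt /=.
    rewrite ltnSn ltnn divfK //.
    congr (_ * _); apply: eq_bigr => i ii0; rewrite ltnS leq_eqVlt.
    by rewrite -[t]/(val i0) (inj_eq val_inj) (negbTE ii0).
  have eE : e t = if j \in J i0 then eta else 0.
    by rewrite /e insubT.
  rewrite eE; case: ifP => jJ; last first.
    rewrite mul0r (@avg_ext _ _ _ _ _ (fun=> 0)) ?avg_cst ?cn0 // => y.
    rewrite /h (Wl i0 (upd y a) (upd y b)) ?divff ?subrr ?mul0r // => i iJ.
    by rewrite !upd_other //; apply: contraTneq iJ => <-; rewrite jJ.
  (* As [j] lies in [J i0] but not in [S], at most [k] of the at most [k.+1] coordinates of this
     weight remain to be integrated. *)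
  pose U := J i0 :&: S.
  have Uk : (#|U| <= k)%N.
    have : (#|U| < #|J i0|)%N.
      apply: proper_card; rewrite properE subsetIl /=.
      by apply/subsetPn; exists j => //; rewrite inE jJ.
    by move=> /leq_trans/(_ (cardJ i0)).
  have hB y : cn (h y) <= eta0.
    have -> : h y = (W i0 (upd (upd y b) a) - W i0 (upd y b)) / W i0 (upd y b).
      by rewrite upd_upd /h mulrBl divff.
    by rewrite cnM cnV ler_pdivrMr ?cn_gt0.
  have H := @avg_perturb (weight (Wt t)) h S U eta0 x (subsetIr _ _) _ _ hB.
  apply: le_trans (H _ _) _ => {H} [S' j' pS jS'|y z yz|].
  - apply: HS => //; exact: tame_hybrid.
  - have E i : i \in J i0 -> y i = z i.
      by move=> iJ; apply: yz; rewrite !inE iJ /= andNb.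
    rewrite /h (Wl _ (upd y a) (upd z a)) ?(Wl _ (upd y b) (upd z b)) //.
      exact: upd_agree.
    exact: upd_agree.
  - apply: ler_wpM2r; first exact: cn_ge0.
    rewrite ler_wpM2l // lef_pV2 ?posrE ?exprn_gt0 //.
    by apply: ler_wiXn2l => //; exact: ltW.
apply: ler_wpM2r; first exact: cn_ge0.
apply: le_trans rho_c; rewrite lerD2r.
have -> : \prod_(t < m) (1 + e t) = \prod_(t in [set i | j \in J i]) (1 + eta).
  rewrite big_mkcond /= [RHS]big_mkcond /=; apply: eq_bigr => t _.
  by rewrite /e valK inE; case: ifP; rewrite ?addr0.
rewrite prodr_const; apply: ler_weXn2l; last exact: degJ.
by rewrite lerDl.
Qed.

(** Strong induction on the size of [S], over all tame families at once since the step calls the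
    hypothesis on hybrids. *)
Lemma tame_ratio W S j : tame W -> j \notin S -> ratio_close (avg S (weight W)) j.
Proof.
have [s] := ubnP #|S|; elim: s W S j => // s IH W S j Ss tW jS.
apply: avg_ratio => // W' S' j' tW' pS jS'; apply: IH => //.
by rewrite -ltnS; apply: leq_trans Ss; rewrite ltnS; exact: proper_card.
Qed.

(** Take [h] to be the inverse of the weight and [U = S] in [avg_perturb]: the average on the left
    is that of the constant 1, and the average sought appears on the right. *)
Lemma tame_avg_ge W S B x : tame W -> 0 < B -> (forall y, B <= cn (weight W y)) ->
  kap ^+ #|S| * B <= cn (avg S (weight W) x).
Proof.
move=> tW B0 WB.
have W0 y : weight W y != 0 by rewrite -cn_gt0 (lt_le_trans B0).
have := @avg_perturb (weight W) (fun y => (weight W y)^-1) S S B^-1 x (subxx _).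
rewrite (@avg_ext _ _ _ _ _ (fun=> 1)) => [|y]; last by rewrite mulVf.
rewrite avg_cst cn1 => H.
have {H} : 1 <= B^-1 / kap ^+ #|S| * cn (avg S (weight W) x).
  apply: H => [S' j pS jS'|y z yz|y]; first exact: tame_ratio.
    by congr (weight W _)^-1; apply/ffunP => i; apply: yz; rewrite setDv inE.
  by rewrite cnV lef_pV2 ?posrE // (lt_le_trans B0).
rewrite -invfM ler_pdivlMl ?mulr1 ?mulr_gt0 ?exprn_gt0 //.
by rewrite mulrC.
Qed.

End ZeroFree.

(** * Newton's identities and Taylor polynomials of the logarithm *)

Section NewtonIdentities.
Variable K : fieldType.
Implicit Types (c b : nat -> K) (bs : seq K).

(* [b] lists the coefficients of [z * P' / P], where [P] has coefficients [c]. *)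
Definition newton_seq N c b : Prop := b 0%N = 0 /\
  forall k, (0 < k <= N)%N -> b k = k%:R * c k - \sum_(i < k) b i * c (k - i)%N.

Lemma newton_seqP N c b : c 0%N = 1 -> b 0%N = 0 ->
  (forall k, (0 < k <= N)%N -> k%:R * c k = \sum_(i < k.+1) b i * c (k - i)%N) ->
  newton_seq N c b.
Proof.
move=> c0 b0 H; split=> // k kN; rewrite H // big_ord_recr /= subnn c0 mulr1.
by rewrite [_ + b k]addrC addrK.
Qed.

Lemma newton_seq_unique N c c' b b' : (forall k, (k <= N)%N -> c k = c' k) ->
  newton_seq N c b -> newton_seq N c' b' -> forall k, (k <= N)%N -> b k = b' k.
Proof.
move=> cc [b0 H] [b0' H'] k; elim/ltn_ind: k => -[|k] IH kN.
  by rewrite b0 b0'.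
rewrite H // H' // cc //; congr (_ - _); apply: eq_bigr => i _.
by rewrite IH ?cc // ?(leq_trans (leq_subr _ _)) // (leq_trans (ltnW (ltn_ord i))).
Qed.

Lemma newton_seq_ext N c c' b b' : (forall k, (k <= N)%N -> c k = c' k) ->
  (forall k, (k <= N)%N -> b k = b' k) -> newton_seq N c b -> newton_seq N c' b'.
Proof.
move=> cc bb [b0 H]; split; first by rewrite -bb.
move=> k /andP[k0 kN]; rewrite -bb // -cc // H ?k0 //; congr (_ - _).
apply: eq_bigr => i _; rewrite bb ?cc // ?(leq_trans (leq_subr _ _)) //.
by rewrite (leq_trans (ltnW (ltn_ord i))).
Qed.

Lemma eq_poly_modXn N (p q : {poly K}) : (forall k, (k <= N)%N -> p`_k = q`_k) ->
  exists u : {poly K}, p = q + 'X^(N.+1) * u.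
Proof.
move=> H; exists (drop_poly N.+1 (p - q)).
have T : take_poly N.+1 (p - q) = 0.
  apply/polyP => k; rewrite coef0 coef_take_poly coefB; case: ifP => // kN.
  by rewrite H ?subrr.
by rewrite mulrC -[X in _ + X]add0r -T poly_take_drop addrC subrK.
Qed.

(** Working modulo [X ^ N.+1] keeps the power series identity [z P' = P B] among polynomials. *)
Lemma newton_seq_poly N (p B : {poly K}) : p`_0 = 1 -> B`_0 = 0 ->
  (exists u : {poly K}, 'X * p^`() = p * B + 'X^(N.+1) * u) <->
  newton_seq N (nth 0 p) (nth 0 B).
Proof.
move=> p0 B0; split=> [[u Hu]|[_ H]].
  apply: newton_seqP => // k /andP[k0 kN].
  have /(congr1 (fun P : {poly K} => P`_k)) := Hu.
  rewrite coefXM coefD coefXnM ltnS kN addr0 coef_deriv.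
  case: k k0 kN => // k _ kN; rewrite /= mulr_natl => ->.
  by rewrite coefMr; apply: eq_bigr => i _; rewrite mulrC.
apply: eq_poly_modXn => k kN; rewrite coefXM coef_deriv coefMr.
case: k kN => [|k] kN; first by rewrite big_ord1 B0 mulr0.
have := H k.+1 kN => /eqP; rewrite eq_sym subr_eq => /eqP.
rewrite mulr_natl /= => ->; rewrite [RHS]big_ord_recr /= subnn p0 mul1r addrC.
by congr (_ + _); apply: eq_bigr => i _; rewrite mulrC.
Qed.

Lemma coef0_prod_roots bs : (\prod_(b <- bs) (1 - b *: 'X))`_0 = 1 :> K.
Proof.
elim/big_rec: _ => [|b q _ IH]; first by rewrite coef1.
by rewrite mulrBl mul1r -scalerAl coefB coefZ coefXM mulr0 subr0.
Qed.

(** The logarithmic derivative turns the product into a sum: [z P' / P] is the sum of the series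
    [- b z / (1 - b z)], whose coefficients are negated powers of [b]. The induction adds one factor
    at a time. *)
Lemma newton_seq_roots N bs :
  newton_seq N (nth 0 (\prod_(b <- bs) (1 - b *: 'X)))
    (fun k => if k is 0%N then 0 else - \sum_(b <- bs) b ^+ k).
Proof.
set p := fun s : seq K => \prod_(b <- s) (1 - b *: 'X).
pose S (s : seq K) : {poly K} := \poly_(k < N.+1)
  (if k is 0%N then 0 else - \sum_(b <- s) b ^+ k).
have H (s : seq K) : exists q : {poly K}, 'X * (p s)^`() = p s * S s + 'X^(N.+1) * q.
  elim: s => [|b s [q Hq]].
    exists 0; rewrite /p big_nil -[1]/(1%:P) derivC mulr0 mulr0 addr0 mul1r.
    apply/polyP => k; rewrite coef0 coef_poly; case: ifP => // _.
    by case: k => // k; rewrite big_nil oppr0.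
  (* [T] is the truncation of the series [- b z / (1 - b z)]. *)
  pose T : {poly K} := \poly_(k < N.+1) (if k is 0%N then 0 else - b ^+ k).
  have ST : S (b :: s) = S s + T.
    apply/polyP => k; rewrite coefD !coef_poly; case: ifP; rewrite ?addr0 // => _.
    by case: k => [|k]; rewrite ?addr0 // big_cons opprD addrC.
  have [v TE] : exists v : {poly K}, (1 - b *: 'X) * T = - b *: 'X + 'X^(N.+1) * v.
    apply: eq_poly_modXn => k kN; rewrite mulrBl mul1r -scalerAl coefB !coefZ.
    rewrite coefXM coefX !coef_poly ltnS kN.
    case: k kN => [|k] kN /=; first by rewrite !mulr0 subr0.
    rewrite ltnS (ltnW kN) eqSS; case: k kN => [|k] kN /=.
      by rewrite mulr0 mulr1 subr0 expr1.
    by rewrite mulr0 mulrN opprK -exprS addNr.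
  exists ((1 - b *: 'X) * q - p s * v).
  have -> : p (b :: s) = (1 - b *: 'X) * p s by rewrite /p big_cons.
  have d1 : (1 : {poly K})^`() = 0 by rewrite -[1]/(1%:P) derivC.
  rewrite derivM derivB derivZ derivX d1 sub0r ST.
  transitivity (- b *: 'X * p s + (1 - b *: 'X) * ('X * (p s)^`())).
    by rewrite scaleNr -!mul_polyC; ring.
  rewrite Hq.
  apply/eqP; rewrite -subr_eq0; apply/eqP.
  transitivity (p s * (- b *: 'X + 'X^(N.+1) * v) - p s * ((1 - b *: 'X) * T)).
    by rewrite !scaleNr -!mul_polyC; ring.
  by rewrite TE subrr.
have p0 := coef0_prod_roots bs.
have S0 : (S bs)`_0 = 0 by rewrite coef_poly.
have /(newton_seq_poly N p0 S0) := H bs; apply: newton_seq_ext => // k kN.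
by rewrite coef_poly ltnS kN.
Qed.

(** Multiplying a series by [exp (x z)] adds [x z] to [z P' / P]. This is what translating the
    exponent by a constant does to the logarithm. *)
Lemma newton_seq_shift N c b x : (forall j, j.+1%:R != 0 :> K) -> c 0%N = 1 ->
  newton_seq N c b ->
  newton_seq N (fun k => \sum_(j < k.+1) c (k - j)%N * (x ^+ j / j`!%:R))
    (fun k => b k + (if k == 1%N then x else 0)).
Proof.
move=> nat_neq0 c0 nb; have b0 := nb.1.
have fact_neq0 j : (j`!%:R : K) != 0.
  by rewrite -(prednK (fact_gt0 j)).
pose e j : K := x ^+ j / j`!%:R.
have eS j : j.+1%:R * e j.+1 = x * e j.
  rewrite /e factS natrM exprS invfM.
  by have := nat_neq0 j; have := fact_neq0 j;
     move: (_%:R) (_%:R) => u v u0 v0; field; rewrite u0 v0.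
pose p := \poly_(k < N.+1) c k.
pose B := \poly_(k < N.+1) b k.
pose E := \poly_(k < N.+1) e k.
have p0 : p`_0 = 1 by rewrite coef_poly.
have B0 : B`_0 = 0 by rewrite coef_poly.
have E0 : E`_0 = 1 by rewrite coef_poly /e expr0 fact0 divr1.
have [u Hu] : exists u : {poly K}, 'X * p^`() = p * B + 'X^(N.+1) * u.
  by apply/(newton_seq_poly N p0 B0); apply: newton_seq_ext nb => k kN;
     rewrite coef_poly ltnS kN.
have [v Hv] : exists v : {poly K}, 'X * E^`() = x *: 'X * E + 'X^(N.+1) * v.
  apply: eq_poly_modXn => -[|k] kN; rewrite -scalerAl coefZ !coefXM ?mulr0 //=.
  by rewrite coef_deriv !coef_poly !ltnS kN ltnW // -mulr_natl eS.
have pE0 : (p * E)`_0 = 1 by rewrite coefM big_ord1 p0 E0 mul1r.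
have BX0 : (B + x *: 'X)`_0 = 0 by rewrite coefD coefZ coefX B0 mulr0 addr0.
have := (newton_seq_poly N pE0 BX0).1; case.
  exists (u * E + p * v); rewrite derivM mulrDr.
  transitivity ('X * p^`() * E + p * ('X * E^`())); first by ring.
  by rewrite Hu Hv; ring.
move=> _ H; apply: (@newton_seq_ext N (nth 0 (p * E)) _ (nth 0 (B + x *: 'X))).
- move=> k kN; rewrite coefMr; apply: eq_bigr => j _; rewrite !coef_poly !ltnS.
  by rewrite (leq_trans (leq_subr _ _)) // (leq_trans _ kN) // -ltnS.
- move=> k kN; rewrite coefD coefZ coefX coef_poly ltnS kN; congr (_ + _).
  by case: eqP; rewrite ?mulr1 ?mulr0.
- by split.
Qed.

End NewtonIdentities.

(** * Inverse roots and truncated logarithms of a polynomial *)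

Section LogOfPolynomial.
Variable R : realType.
Implicit Types (p : {poly R[i]}) (bs : seq R[i]).

(** Comparing constant coefficients forces the scalar in the factorization to be 1; roots outside
    the disc of radius [rho^-1] have inverses in the disc of radius [rho]. *)
Lemma poly_inv_roots p (rho : R) : 0 < rho -> p`_0 = 1 ->
  (forall z, cn z <= rho^-1 -> p.[z] != 0) ->
  exists bs, [/\ p = \prod_(b <- bs) (1 - b *: 'X), (size bs < size p)%N &
    forall b, b \in bs -> cn b <= rho].
Proof.
move=> rho0 p0 nz.
have pn0 : p != 0 by apply: contra_eq_neq p0 => ->; rewrite coef0 eq_sym oner_eq0.
have [rs Ers] := closed_field_poly_normal p.
have rs_big z : z \in rs -> rho^-1 < cn z.
  move=> zrs; rewrite ltNge; apply/negP => /nz; rewrite Ers hornerZ mulf_eq0 negb_or.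
  move=> /andP[_]; rewrite horner_prod (big_rem z) //= !hornerE subrr mul0r.
  by rewrite eqxx.
have rs_n0 z : z \in rs -> z != 0.
  by move=> /rs_big H; rewrite -cn_gt0 (lt_trans _ H) // invr_gt0.
pose bs := [seq z^-1 | z <- rs]; exists bs; split.
- have E1 : \prod_(z <- rs) ('X - z%:P) =
      (\prod_(z <- rs) - z) *: \prod_(b <- bs) (1 - b *: 'X).
    rewrite /bs big_map; elim: rs rs_n0 {Ers rs_big bs} => [|z s IH] H.
      by rewrite !big_nil scale1r.
    rewrite !big_cons IH => [|w ws]; last by rewrite H // inE ws orbT.
    have z0 : z != 0 by rewrite H ?inE ?eqxx.
    have -> : 'X - z%:P = (- z)%:P * (1 - z^-1 *: 'X) :> {poly R[i]}.
      rewrite mulrBr mulr1 mul_polyC scalerA mulNr divff // scaleN1r opprK.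
      by rewrite polyCN addrC.
    by rewrite -!mul_polyC polyCM; ring.
  have E2 : p = (lead_coef p * \prod_(z <- rs) - z) *: \prod_(b <- bs) (1 - b *: 'X).
    by rewrite -scalerA -E1.
  have E3 : lead_coef p * \prod_(z <- rs) - z = 1.
    by have := p0; rewrite {1}E2 coefZ coef0_prod_roots mulr1.
  by rewrite E2 E3 scale1r.
- rewrite size_map [in X in (_ < X)%N]Ers size_scale ?lead_coef_eq0 //.
  by rewrite size_prod_XsubC.
- move=> b /mapP[z /rs_big zb ->].
  have z0 : 0 < cn z by apply: lt_trans zb; rewrite invr_gt0.
  by rewrite cnV -[rho]invrK lef_pV2 ?posrE ?invr_gt0 // ltW.
Qed.

(** Each [1 - b] is the exponential of its truncated logarithm times a number within [tau] of 1,
    which has a logarithm of modulus at most [4 tau]. Only exponentials are equated, so the branches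
    chosen for different roots need not fit together. *)
Lemma prod_log_roots N (rho tau : R) bs : 0 <= rho < 1 ->
  (forall b, b \in bs -> cn b <= rho) ->
  rho ^+ N.+1 * expR (1 - rho)^-1 <= tau -> tau <= 2^-1 ->
  exists2 w, \prod_(b <- bs) (1 - b) =
      cexp (w - \sum_(k < N) (\sum_(b <- bs) b ^+ k.+1) / k.+1%:R)
    & cn w <= 4 * (size bs)%:R * tau.
Proof.
move=> rho1 bsr t1 t2.
pose sg b := \sum_(k < N) b ^+ k.+1 / k.+1%:R : R[i].
suff [w E H] : exists2 w, \prod_(b <- bs) (1 - b) = cexp (w - \sum_(b <- bs) sg b)
    & cn w <= 4 * (size bs)%:R * tau.
  exists w => //; rewrite E; congr (cexp (_ - _)); rewrite /sg exchange_big /=.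
  by apply: eq_bigr => k _; rewrite big_distrl.
elim: bs bsr => [|b bs IH] bsr.
  by exists 0; rewrite ?big_nil ?subrr ?cexp0 // cn0 mulr0 mul0r.
have [w E Hw] := IH (fun b' H => bsr b' (mem_behead (s := b :: bs) H)).
have br : cn b <= rho by rewrite bsr ?inE ?eqxx.
have tb := le_trans (cexp_truncated_log N rho1 br) t1.
have [v Ev Hv] := complex_log_near1 (le_trans tb t2).
exists (v + w).
  have E' : cexp (v - sg b) = 1 - b by rewrite cexpD Ev cexpN mulfK ?cexp_neq0.
  rewrite !big_cons E; set S := \sum_(b0 <- bs) _.
  have -> : v + w - (sg b + S) = v - sg b + (w - S) by ring.
  by rewrite cexpD E'.
apply: le_trans (cn_triangle _ _) _; rewrite /= -natr1.
have := ler_wpM2l (ler0n _ 4) tb.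
by move: Hv Hw; lra.
Qed.

End LogOfPolynomial.

(** * Numerical constants behind the bound on [lambda] *)

Section Constants.
Variable R : realType.

Lemma bernoulli_ge (x : R) k : 0 <= x <= 1 -> 1 - k%:R * x <= (1 - x) ^+ k.
Proof.
move=> /andP[x0 x1]; elim: k => [|k IH]; first by rewrite mul0r subr0 expr0.
rewrite exprS -natr1; have := ler_wpM2l (_ : 0 <= 1 - x) IH.
have : 0 <= (k%:R : R) := ler0n _ _.
move: (_%:R) ((1 - x) ^+ k) => y z y0 H.
have := H ltac:(lra); nra.
Qed.

(** Here [y] stands for [|z lambda|] and [k] for [r - 1]. With [v = 1 / sqrt k] the choice is
    [rho = 0.7 v] and [kap ^ 2 = 1 - 0.3 v ^ 2]. Then [kap ^ 4 <= 1 - 0.49 v ^ 2], while [kap ^ k]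
    stays above 0.83 for every [k]. The factor 3 in the bound on [y] gives [c eta <= v / 2], which
    suffices for [(1 + eta) ^ c - 1 <= 0.7 v]. *)
Lemma zero_free_constants (k c : nat) (y : R) : (0 < k)%N -> (0 < c)%N -> 0 <= y ->
  y <= (3 * c%:R * Num.sqrt k%:R)^-1 ->
  exists rho kap : R, [/\ 0 <= rho, 4 / 5 <= kap, kap <= 1, kap ^+ 4 <= 1 - rho ^+ 2 &
    (1 + (expR y - 1) / kap ^+ k) ^+ c - 1 <= rho].
Proof.
move=> k0 c0 y0 yle.
have kR : (1 : R) <= k%:R by rewrite ler1n.
have cR : (1 : R) <= c%:R by rewrite ler1n.
set s := Num.sqrt (k%:R : R) in yle.
have s2 : s ^+ 2 = k%:R by rewrite sqr_sqrtr ?ler0n.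
have s1 : 1 <= s by rewrite -sqrtr1 ler_sqrt ?ler0n.
have s0 : 0 < s by lra.
pose v := s^-1.
have v0 : 0 < v by rewrite invr_gt0.
have v1 : v <= 1 by rewrite invf_le1.
have v2 : v ^+ 2 = k%:R^-1 by rewrite exprVn s2.
have yc : c%:R * y <= v / 3.
  have -> : v / 3 = c%:R * (3 * c%:R * s)^-1 by rewrite /v; field; rewrite !gt_eqF //; lra.
  by rewrite ler_wpM2l ?ler0n.
have y3 : y <= 3^-1.
  have : 1 * y <= c%:R * y by rewrite ler_wpM2r.
  lra.
pose q := 1 - 3 / 10 * v ^+ 2.
have v2p : 0 < v ^+ 2 by rewrite exprn_gt0.
have v2le : v ^+ 2 <= 1 by rewrite exprn_ile1 // ltW.
have q0 : 7 / 10 <= q by rewrite /q; lra.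
have q1 : q <= 1 by rewrite /q; lra.
pose kap := Num.sqrt q.
have kap2 : kap ^+ 2 = q by rewrite sqr_sqrtr //; lra.
have kap_ge : 4 / 5 <= kap.
  rewrite -(@ler_pXn2r _ 2) ?nnegrE ?sqrtr_ge0 ?divr_ge0 ?ler0n // kap2.
  by apply: le_trans q0; lra.
exists (7 / 10 * v), kap; split => //.
- by apply: mulr_ge0; [lra | exact: ltW].
- by rewrite -sqrtr1 ler_sqrt.
- have -> : kap ^+ 4 = q ^+ 2 by rewrite -kap2 -exprM.
  by rewrite /q exprMn; set t := v ^+ 2 in v2p v2le *; nra.
(* By Bernoulli's inequality [kap ^ (2 k) = (1 - 0.3 / k) ^ k >= 0.7], and [0.83 ^ 2 < 0.7]. *)
have kapk : 83 / 100 <= kap ^+ k.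
  have kapk0 : 0 <= kap ^+ k by rewrite exprn_ge0 ?sqrtr_ge0.
  rewrite -(@ler_pXn2r _ 2) ?nnegrE ?divr_ge0 ?ler0n // -exprM mulnC exprM kap2.
  have := @bernoulli_ge (3 / 10 * v ^+ 2) k.
  have -> : k%:R * (3 / 10 * v ^+ 2) = 3 / 10.
    by rewrite v2 mulrCA divff ?mulr1 // gt_eqF //; lra.
  move=> H; apply: le_trans (H _); first by lra.
  by apply/andP; split; lra.
pose eta := (expR y - 1) / kap ^+ k.
(* [37 / 30 = 1 + 0.7 / 3], by [expR_le_quadratic] and [y <= 1 / 3]. *)
have ey : expR y - 1 <= y * (37 / 30).
  have := @expR_le_quadratic R y.
  have : y ^+ 2 <= y / 3 by rewrite expr2; nra.
  move=> ? /(_ ltac:(apply/andP; split; lra)); lra.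
have ey0 : 0 <= expR y - 1 by have := expR_ge1Dx y; lra.
have kk0 : 0 < kap ^+ k by apply: lt_le_trans kapk; lra.
have eta0 : 0 <= eta by rewrite divr_ge0 // ltW.
(* [149 / 100] exceeds [37 / 30] divided by [83 / 100], and a third of it is below one half. *)
have etay : eta <= y * (149 / 100).
  rewrite /eta ler_pdivrMr //.
  have : y * (149 / 100) * (83 / 100) <= y * (149 / 100) * kap ^+ k.
    by rewrite ler_wpM2l //; lra.
  lra.
have ceta : c%:R * eta <= v / 2.
  have : c%:R * eta <= c%:R * (y * (149 / 100)) by rewrite ler_wpM2l ?ler0n.
  lra.
rewrite -/eta.
have H1 : (1 + eta) ^+ c <= expR (c%:R * eta).
  by rewrite expRM_natl lerXn2r ?nnegrE ?expR_ge0 ?expR_ge1Dx //; lra.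
have ce0 : 0 <= c%:R * eta by rewrite mulr_ge0 ?ler0n.
(* With [u = c eta <= v / 2] and [v <= 1], [u + 0.7 u ^ 2 <= 0.5 v + 0.175 v < 0.7 v]. *)
have := @expR_le_quadratic R (c%:R * eta).
have : (c%:R * eta) ^+ 2 <= v / 4 by rewrite expr2; nra.
by move=> ? /(_ ltac:(apply/andP; split; lra)); lra.
Qed.

End Constants.

Lemma cn_leE (R : rcfType) (z : R[i]) (a : R) : (`|z| <= a%:C) = (cn z <= a).
Proof. by rewrite cnE lecR. Qed.

(** * From zero-freeness to finitely many coefficients of the logarithm *)

Section Interpolation.
Variables (R : realType) (n m : nat) (X : 'I_n -> finProbSpace R).
Local Notation P := (prodSpace X).
Variables (phi : 'I_m -> P -> R[i]) (J : 'I_m -> {set 'I_n}) (r c : nat).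
Variables (lambda : R[i]) (delta eps : R) (x0 : P).
Implicit Types (x y : P) (z : R[i]).
Hypotheses (m_gt0 : (0 < m)%N) (r_ge2 : (2 <= r)%N) (c_gt0 : (0 < c)%N).
Hypothesis phi_lip : forall i x y, differ_in_one x y -> `|phi i x - phi i y| <= 1.
Hypothesis cardJ : forall i, (#|J i| <= r)%N.
Hypothesis phi_loc : forall i (x y : P),
  (forall j, j \in J i -> x j = y j) -> phi i x = phi i y.
Hypothesis degJ : forall j, (#|[set i | j \in J i]| <= c)%N.
Hypothesis delta01 : 0 < delta < 1.
Hypothesis lambda_le :
  `|lambda| <= ((1 - delta) / (3 * c%:R * Num.sqrt (r%:R - 1)))%:C.
Hypothesis eps01 : 0 < eps < 1.

Let f x := \sum_(i < m) phi i x.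
(** Centred at [x0], the exponent is at most [D = r m] in modulus for all relevant [z]; the
    hypotheses control differences of values of [phi i], not the values. *)
Let g x := lambda * \sum_(i < m) (phi i x - phi i x0).
Let D : R := (r * m)%:R.
Let rho := 1 - delta.

Lemma phi_upd i x j (a : X j) : cn (phi i (upd x a) - phi i x) <= 1.
Proof.
have [E|ne] := eqVneq a (x j).
  suff -> : upd x a = x by rewrite subrr cn0.
  apply/ffunP => l; have [<-|jl] := eqVneq j l; first by rewrite upd_same.
  by rewrite upd_other.
rewrite -cn_leE; apply: phi_lip; rewrite /differ_in_one.
suff -> : [set l | upd x a l != x l] = [set j] by rewrite cards1.
apply/setP => l; rewrite !inE; have [<-|jl] := eqVneq j l.
  by rewrite upd_same ne.
by rewrite upd_other // eqxx.
Qed.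

Lemma phi_osc i x y : cn (phi i x - phi i y) <= r%:R.
Proof.
have H S x' y' : agree_off S x' y' -> cn (phi i x' - phi i y') <= #|S|%:R.
  move: S x' y'; apply: setS_ind => [|t S tS IH] x' y' /agree_offP A.
    suff -> : x' = y' by rewrite subrr cn0 cards0.
    by apply/ffunP => j; rewrite A ?inE.
  pose x1 := upd x' (y' t).
  have A1 : agree_off S x1 y'.
    apply/agree_offP => j jS; rewrite /x1; have [<-|tj] := eqVneq t j.
      by rewrite upd_same.
    by rewrite upd_other // A // !inE negb_or eq_sym tj.
  have -> : phi i x' - phi i y' = (phi i x' - phi i x1) + (phi i x1 - phi i y').
    by ring.
  rewrite cardsU1 tS natrD; apply: le_trans (cn_triangle _ _) _.
  by apply: lerD (IH _ _ A1); rewrite cnB phi_upd.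
pose y' : P := [ffun j => if j \in J i then y j else x j].
have -> : phi i y = phi i y' by apply: phi_loc => j jJ; rewrite ffunE jJ.
apply: (@le_trans _ _ #|J i|%:R); last by rewrite ler_nat cardJ.
by apply: H; apply/agree_offP => j /negbTE jJ; rewrite ffunE jJ.
Qed.

Fact sqrt_r1 : Num.sqrt (r%:R - 1) = Num.sqrt (r.-1)%:R :> R.
Proof. by congr Num.sqrt; case: r r_ge2 => // k _; rewrite -natr1 addrK. Qed.

Fact sqrt_ge1 : 1 <= Num.sqrt (r.-1)%:R :> R.
Proof.
have r1 : (0 < r.-1)%N by case: r r_ge2 => [|[]].
by rewrite -[leLHS]sqrtr1 ler_sqrt ?ler0n // ler1n.
Qed.

Lemma cn_lambda_le : cn lambda <= rho / (3 * c%:R * Num.sqrt (r.-1)%:R).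
Proof. by rewrite -cn_leE -sqrt_r1. Qed.

Lemma cn_zlambda_le z : cn z <= rho^-1 ->
  cn (z * lambda) <= (3 * c%:R * Num.sqrt (r.-1)%:R)^-1.
Proof.
move=> zr; have dd := delta01.
have rho0 : 0 < rho by rewrite /rho; lra.
rewrite cnM; apply: le_trans (ler_pM (cn_ge0 _) (cn_ge0 _) zr cn_lambda_le) _.
by rewrite mulrA mulVf ?mul1r // gt_eqF.
Qed.

Lemma cn_zg_le z x : cn z <= rho^-1 -> cn (z * g x) <= D.
Proof.
move=> /cn_zlambda_le zr.
rewrite /g mulrA cnM; apply: le_trans (_ : 1 * D <= _); last by rewrite mul1r.
apply: ler_pM; rewrite ?cn_ge0 //.
  apply: le_trans zr _; rewrite invf_le1.
    have cR : (1 : R) <= c%:R by rewrite ler1n.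
    have := sqrt_ge1; nra.
  by rewrite !mulr_gt0 ?ltr0n // (lt_le_trans ltr01 sqrt_ge1).
apply: le_trans (cn_sum _ _ _) _.
apply: le_trans (ler_sum _ (fun i _ => phi_osc i x x0)) _.
by rewrite sumr_const card_ord /D natrM mulr_natr.
Qed.

(** The weights are [exp (z lambda (phi_i x - phi_i x0))], of relative variation at most
    [exp |z lambda| - 1]. The bound is crude, [4 / 5] for each coordinate and [exp (- D)] for the
    smallest weight, but it affects the Taylor degree only through its logarithm. *)
Lemma mgf_ge z : cn z <= rho^-1 ->
  (4 / 5) ^+ n * expR (- D) <= cn (avg setT (fun x => cexp (z * g x)) x0).
Proof.
move=> zr; have dd := delta01.
pose y := cn (z * lambda).
have yle : y <= (3 * c%:R * Num.sqrt (r.-1)%:R)^-1 by exact: cn_zlambda_le.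
have r1 : (0 < r.-1)%N by case: r r_ge2 => [|[]].
have [rh [kap [rh0 kap45 kap1 kap4 Hc]]] :=
  zero_free_constants r1 c_gt0 (cn_ge0 _) yle.
have kap0 : 0 < kap by lra.
have eta0 : 0 <= expR y - 1.
  by have := expR_ge1Dx y; have := cn_ge0 (z * lambda); rewrite -/y; lra.
pose W i x := cexp (z * lambda * (phi i x - phi i x0)).
have cardJ' i : (#|J i| <= r.-1.+1)%N by rewrite prednK //; exact: leq_trans r_ge2.
have tW : tame J (expR y - 1) W.
  split=> [i x|i x x' xx|i x j a]; first exact: cexp_neq0.
    by rewrite /W (phi_loc xx).
  have -> : W i (upd x a) = W i x * cexp (z * lambda * (phi i (upd x a) - phi i x)).
    by rewrite /W -cexpD; congr cexp; ring.
  rewrite -{2}[W i x]mulr1 -mulrBr cnM mulrC ler_wpM2r ?cn_ge0 //.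
  have := cn_cexp_taylor 1 (z * lambda * (phi i (upd x a) - phi i x)).
  rewrite /exp_taylor !big_ord1 !expr0 fact0 !divr1 => H; apply: le_trans H _.
  rewrite lerD2r ler_expR cnM -[leRHS]mulr1.
  by rewrite ler_wpM2l ?cn_ge0 ?phi_upd.
have WE x : weight W x = cexp (z * g x).
  by rewrite /weight -cexp_sum -big_distrr /= /g mulrA.
have WB x : expR (- D) <= cn (weight W x).
  rewrite WE cn_cexp ler_expR.
  apply: le_trans (_ : - cn (z * g x) <= _); first by rewrite lerN2 cn_zg_le.
  by have := Re_le_cn (z * g x); rewrite ler_norml => /andP[].
have := tame_avg_ge cardJ' degJ eta0 rh0 kap0 kap1 kap4 Hc setT x0 tW (expR_gt0 _) WB.
rewrite (avg_ext _ _ WE) cardsT card_ord; apply: le_trans.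
rewrite ler_wpM2r ?expR_ge0 // lerXn2r ?nnegrE //; lra.
Qed.

Let ct k : R[i] := avg setT (fun x => g x ^+ k / k`!%:R) x0.
Let pL L : {poly R[i]} := \poly_(k < L) ct k.

Lemma horner_pL L z : (pL L).[z] = avg setT (fun x => exp_taylor L (z * g x)) x0.
Proof.
rewrite horner_poly /exp_taylor avg_sum; apply: eq_bigr => k _.
rewrite /ct mulrC -avgZ; apply: avg_ext => x.
by rewrite mulrA -exprMn.
Qed.

(** [exp_taylor_tail] with [y = 4 D] gives at most [4 ^ (- L) exp (5 D) <= exp (- L + 5 D)]. The
    size of [L] leaves [exp (- D - n - 16 / eps)], which pays for the factors [exp (- D)] and
    [(4 / 5) ^ n] of [mgf_ge] and for the accuracy [eps / 16]. *)
Lemma pL_close L z : cn z <= rho^-1 ->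
  6 * D + n%:R + 16 / eps <= L%:R ->
  cn ((pL L).[z] - avg setT (fun x => cexp (z * g x)) x0)
  <= eps / 16 * cn (avg setT (fun x => cexp (z * g x)) x0).
Proof.
move=> zr HL; apply: le_trans _ (ler_wpM2l _ (mgf_ge zr)); last first.
  by have := eps01; lra.
rewrite horner_pL -avgB; apply: avg_le => x.
have D1 : 1 <= D by rewrite /D ler1n muln_gt0 m_gt0 andbT; case: r r_ge2.
have [e0 e1] := andP eps01.
apply: le_trans (_ : expR (- L%:R + 5 * D) <= _); last first.
  apply: le_trans (_ : expR (- (16 / eps) + n%:R * - 1 + - D) <= _).
    by rewrite ler_expR; lra.
  rewrite !expRD mulrA ler_wpM2r ?expR_ge0 // ler_pM ?expR_ge0 //.
    rewrite expRN -[eps / 16]invf_div lef_pV2 ?posrE ?expR_gt0 ?divr_gt0 //.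
    by have := expR_ge1Dx (16 / eps); lra.
  rewrite expRM_natl lerXn2r ?nnegrE ?expR_ge0 //; first by lra.
  rewrite expRN -[4 / 5]invf_div lef_pV2 ?posrE ?expR_gt0 //; last by lra.
  by have := expR_ge1Dx (1 : R); lra.
have zg := cn_zg_le x zr; set w := z * g x in zg *.
have D0 : 0 < 4 * D by lra.
rewrite cnB; apply: le_trans (cn_cexp_taylor L w) _.
apply: le_trans (exp_taylor_tail L (cn_ge0 w) D0) _.
rewrite [leRHS]expRD ler_pM ?exprn_ge0 ?expR_ge0 ?divr_ge0 ?cn_ge0 //; first by lra.
  rewrite -[- L%:R]mulrN1 expRM_natl lerXn2r ?nnegrE ?expR_ge0 ?divr_ge0 ?cn_ge0 //.
    by lra.
  (* It remains that [e <= 4], obtained from [expR (1 / 2) <= 1.675]. *)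
  apply: le_trans (_ : 4^-1 <= _); first by rewrite ler_pdivrMr //; lra.
  rewrite expRN lef_pV2 ?posrE ?expR_gt0 //.
  have -> : expR 1 = expR 2^-1 * expR 2^-1 :> R.
    by rewrite -expRD; congr expR; lra.
  have := @expR_le_quadratic R 2^-1; have := expR_ge0 (2^-1 : R).
  move=> h0 /(_ ltac:(apply/andP; split; lra)); nra.
by rewrite ler_expR; lra.
Qed.

(** Error budget: passing from [pL L] to the true value at [z = 1] costs [4 eps / 16], and
    truncating the logarithms of fewer than [L] factors costs [4 L tau <= eps / 2]. Since [N < L],
    the first coefficients of [pL L] are those of the full Taylor series, so they do not depend on
    [L]. *)
Lemma pL_log N L : (N < L)%N -> 6 * D + n%:R + 16 / eps <= L%:R ->
  L%:R * rho ^+ N.+1 * (8 * expR delta^-1) <= eps ->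
  exists b w, [/\ newton_seq N ct b,
    avg setT (fun x => cexp (g x)) x0 = cexp (w + \sum_(k < N) b k.+1 / k.+1%:R)
    & cn w <= eps].
Proof.
move=> NL HL Hrho; have dd := delta01; have [e0 e1] := andP eps01.
have rho0 : 0 < rho by rewrite /rho; lra.
have L0 : (0 < L)%N by apply: leq_ltn_trans NL.
have p0 : (pL L)`_0 = 1.
  rewrite coef_poly L0 /ct (@avg_ext _ _ _ _ _ (fun=> 1)) ?avg_cst // => x.
  by rewrite expr0 fact0 divr1.
have mgf_gt0 z : cn z <= rho^-1 -> 0 < cn (avg setT (fun x => cexp (z * g x)) x0).
  move=> zr; apply: lt_le_trans (mgf_ge zr).
  by rewrite mulr_gt0 ?expR_gt0 ?exprn_gt0 //; lra.
have nz z : cn z <= rho^-1 -> (pL L).[z] != 0.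
  move=> zr; rewrite -cn_gt0; have H := pL_close zr HL.
  have := mgf_gt0 z zr.
  have := cn_subr_le (avg setT (fun x => cexp (z * g x)) x0) (pL L).[z].
  rewrite cnB; nra.
have [bs [Ebs sbs bsr]] := poly_inv_roots rho0 p0 nz.
have sL : (size bs)%:R <= L%:R :> R.
  by rewrite ler_nat ltnW // (leq_trans sbs) // size_poly.
pose tau := rho ^+ N.+1 * expR delta^-1.
have tau0 : 0 <= tau by rewrite mulr_ge0 ?exprn_ge0 ?expR_ge0 // ltW.
have Ltau : 8 * (L%:R * tau) <= eps by move: Hrho; rewrite /tau; lra.
have L1 : 1 <= L%:R :> R by rewrite ler1n.
have tau2 : tau <= 2^-1.
  have : 1 * tau <= L%:R * tau by rewrite ler_wpM2r.
  lra.
have rho1 : 0 <= rho < 1 by apply/andP; split; [exact: ltW | rewrite /rho; lra].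
have tauE : rho ^+ N.+1 * expR (1 - rho)^-1 <= tau by rewrite /tau /rho subKr.
have [w1 E1 Hw1] := prod_log_roots rho1 bsr tauE tau2.
have r1 : cn (1 : R[i]) <= rho^-1 by rewrite cn1 invf_ge1 // /rho; lra.
pose M := avg setT (fun x => cexp (g x)) x0.
have EM : avg setT (fun x => cexp (1 * g x)) x0 = M.
  by apply: avg_ext => x; rewrite mul1r.
have M0 : M != 0 by rewrite -cn_gt0 -EM mgf_gt0.
have Hc := pL_close r1 HL; rewrite EM in Hc.
have Hq : cn ((pL L).[1] / M - 1) <= eps / 16.
  have -> : (pL L).[1] / M - 1 = ((pL L).[1] - M) / M by rewrite mulrBl divff.
  by rewrite cnM cnV ler_pdivrMr ?cn_gt0.
have e16 : eps / 16 <= 2^-1 by lra.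
have [w0 E0 Hw0] := complex_log_near1 (le_trans Hq e16).
pose b k : R[i] := if k is 0%N then 0 else - \sum_(z <- bs) z ^+ k.
exists b, (w1 - w0); split.
- have := newton_seq_roots N bs; rewrite -Ebs; apply: newton_seq_ext => // k kN.
  by rewrite coef_poly (leq_ltn_trans kN).
- rewrite -/M; have -> : M = (pL L).[1] * cexp (- w0).
    by rewrite cexpN E0 invf_div mulrCA divff ?mulr1 // nz.
  have -> : (pL L).[1] = \prod_(z <- bs) (1 - z).
    by rewrite Ebs horner_prod; apply: eq_bigr => z _; rewrite !hornerE.
  rewrite E1 -cexpD; congr cexp.
  have -> : \sum_(k < N) b k.+1 / k.+1%:R =
      - \sum_(k < N) (\sum_(z <- bs) z ^+ k.+1) / k.+1%:R.
    by rewrite -sumrN; apply: eq_bigr => k _; rewrite mulNr.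
  by ring.
- apply: le_trans (cn_triangle _ _) _; rewrite cnN.
  have : (size bs)%:R * tau <= L%:R * tau by rewrite ler_wpM2r.
  by move: Hw0 Hw1 Hq; lra.
Qed.

(* Translating [f] by the constant [f x0] changes only the first coefficient
   of the logarithm, so the Newton sequence can be computed from the moments
   of [f] itself. *)
Theorem interpolation N b : (0 < N)%N ->
  (N%:R + 6 * D + n%:R + 16 / eps + 2) * rho ^+ N.+1 * (8 * expR delta^-1) <= eps ->
  newton_seq N (fun k => lambda ^+ k / k`!%:R * expectation (fun x => f x ^+ k)) b ->
  approximates (cexp (\sum_(k < N) b k.+1 / k.+1%:R))
    (expectation (fun x => cexp (lambda * f x))) eps.
Proof.
move=> N0 HN Hb; have [e0 e1] := andP eps01; have dd := delta01.
have D0 : 0 <= D by rewrite /D ler0n.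
(* [L] exceeds both [N] and the number of terms that [pL_close] asks for. *)
pose L := (N + (Num.truncn (6 * D + n%:R + 16 / eps)).+1)%N.
have y0 : 0 <= 6 * D + n%:R + 16 / eps.
  by rewrite !addr_ge0 ?mulr_ge0 ?ler0n // invr_ge0 ltW.
have [T1 T2] := andP (truncn_itv y0).
have L1 : 6 * D + n%:R + 16 / eps <= L%:R.
  by rewrite /L natrD; have := ler0n R N; lra.
have L2 : L%:R <= N%:R + 6 * D + n%:R + 16 / eps + 2.
  by rewrite /L natrD -natr1; lra.
have rhoN : 0 <= rho ^+ N.+1 by rewrite exprn_ge0 // /rho; lra.
have L3 : L%:R * rho ^+ N.+1 * (8 * expR delta^-1) <= eps.
  apply: le_trans HN; rewrite ler_wpM2r ?mulr_ge0 ?expR_ge0 //.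
  by rewrite ler_wpM2r.
have NL : (N < L)%N by rewrite /L addnS ltnS leq_addr.
have [b' [w [Hb' E Hw]]] := pL_log NL L1 L3.
pose s := lambda * f x0.
have gE x : lambda * f x = s + g x by rewrite /s /g sumrB /f; ring.
have ct0 : ct 0 = 1.
  rewrite /ct (@avg_ext _ _ _ _ _ (fun=> 1)) ?avg_cst // => x.
  by rewrite expr0 fact0 divr1.
have nat0 j : (j.+1%:R : R[i]) != 0 by rewrite pnatr_eq0.
have Hs := newton_seq_shift s nat0 ct0 Hb'.
(* Binomial theorem for [(s + g x) ^ k], divided by [k!]: multiplication by [exp (s z)] read on
   coefficients. *)
have mom k : \sum_(j < k.+1) ct (k - j) * (s ^+ j / j`!%:R) =
    lambda ^+ k / k`!%:R * expectation (fun x => f x ^+ k).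
  rewrite -(avgT _ x0) -avgZ.
  transitivity (\sum_(j < k.+1) avg setT (fun x => s ^+ j / j`!%:R *
      (g x ^+ (k - j) / (k - j)`!%:R)) x0).
    by apply: eq_bigr => j _; rewrite mulrC -avgZ.
  rewrite -avg_sum; apply: avg_ext => x.
  transitivity ((lambda * f x) ^+ k / k`!%:R); last by rewrite exprMn; ring.
  rewrite gE addrC exprDn big_distrl /=; apply: eq_bigr => j _.
  have jk : (j <= k)%N by rewrite -ltnS.
  have nf i : (i`!%:R : R[i]) != 0 by rewrite pnatr_eq0 -lt0n fact_gt0.
  have /(congr1 (fun u => u%:R : R[i])) := bin_fact jk.
  rewrite !natrM => Ek; rewrite -Ek -mulr_natr.
  have := nf k; rewrite -Ek !mulf_eq0 !negb_or => /and3P[h1 h2 h3].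
  by field; rewrite h1 h2 h3.
have bE := newton_seq_unique (fun k _ => esym (mom k)) Hb Hs.
have bsum : \sum_(k < N) b k.+1 / k.+1%:R =
    s + \sum_(k < N) b' k.+1 / k.+1%:R.
  rewrite (eq_bigr (fun k : 'I_N => b' k.+1 / k.+1%:R + (if k == 0 :> nat then s else 0))).
    rewrite big_split /= addrC; congr (_ + _).
    case: N N0 {HN Hb L T1 T2 L1 L2 rhoN L3 NL Hb' E Hs bE} => // N _.
    by rewrite big_ord_recl /= big1 ?addr0.
  move=> k _; rewrite bE // mulrDl eqSS; congr (_ + _).
  by case: eqP => [->|_]; rewrite ?divr1 ?mul0r.
have EE : expectation (fun x => cexp (lambda * f x)) =
    cexp (s + (w + \sum_(k < N) b' k.+1 / k.+1%:R)).
  rewrite -(avgT _ x0) cexpD -E -avgZ; apply: avg_ext => x.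
  by rewrite gE cexpD.
split; first exact: cexp_neq0.
  by rewrite EE cexp_neq0.
exists (\sum_(k < N) b k.+1 / k.+1%:R), (s + (w + \sum_(k < N) b' k.+1 / k.+1%:R)).
split=> //; rewrite bsum cn_leE.
suff -> : s + \sum_(k < N) b' k.+1 / k.+1%:R -
  (s + (w + \sum_(k < N) b' k.+1 / k.+1%:R)) = - w by rewrite cnN.
by ring.
Qed.

End Interpolation.

(** * Programs *)

Section Runs.
Variables (R : realType) (o : oracle R).
Implicit Types (s : state R) (p : prog) (Q : state R -> Prop).

(** [T] bounds the number of steps from above, so branches of unequal length can share one
    estimate. *)
Definition run p s Q (T : nat) : Prop :=
  exists s' t, [/\ exec o p s s' t, Q s' & (t <= T)%N].

Lemma run_weak p s Q Q' T T' : run p s Q T -> (forall s', Q s' -> Q' s') ->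
  (T <= T')%N -> run p s Q' T'.
Proof.
by move=> [s' [t [e q tT]]] QQ TT; exists s', t; split; auto; exact: leq_trans TT.
Qed.

Lemma run_skip s Q T : Q s -> run Skip s Q T.
Proof. by exists s, 0%N; split=> //; exact: exec_skip. Qed.

Lemma run_do i s Q : Q (do_instr o i s) -> run (Do i) s Q 1.
Proof. by exists (do_instr o i s), 1%N; split=> //; exact: exec_do. Qed.

Lemma run_seq p1 p2 s Q T1 T2 :
  run p1 s (fun s1 => run p2 s1 Q T2) T1 -> run (Seq p1 p2) s Q (T1 + T2).
Proof.
move=> [s1 [t1 [e1 [s2 [t2 [e2 q le2]]] le1]]].
exists s2, (t1 + t2)%N; split=> //; [exact: exec_seq e1 e2 | exact: leq_add].
Qed.

Lemma run_step i p s Q T : run p (do_instr o i s) Q T ->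
  run (Seq (Do i) p) s Q T.+1.
Proof. by move=> H; rewrite -add1n; apply: run_seq; exact: run_do. Qed.

Lemma run_if b p1 p2 s Q T :
  (do_test b s -> run p1 s Q T) -> (~~ do_test b s -> run p2 s Q T) ->
  run (If b p1 p2) s Q T.+1.
Proof.
move=> H1 H2.
have [s' [t [e q le]]] : run (if do_test b s then p1 else p2) s Q T.
  by case: ifPn.
by exists s', t.+1; split=> //; exact: exec_if.
Qed.

(** The invariant is indexed by the number of completed passes, [K] in all; the extra units count
    the [K.+1] evaluations of the test. *)
Lemma run_while b p (I : nat -> state R -> Prop) K T s :
  (forall i s, (i < K)%N -> I i s -> do_test b s /\ run p s (I i.+1) T) ->
  (forall s, I K s -> ~~ do_test b s) -> I 0%N s ->
  run (While b p) s (I K) (K * T.+1).+1.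
Proof.
move=> H HK I0.
suff G d i s1 : (i + d = K)%N -> I i s1 -> run (While b p) s1 (I K) (d * T.+1).+1.
  exact: (G K 0%N).
elim: d i s1 => [|d IH] i s1.
  rewrite addn0 => -> Is; exists s1, 1%N; split=> //.
  exact: exec_while_false (HK _ Is).
move=> iK Is; have [|bT [s2 [t2 [e2 I2 le2]]]] := H i s1 _ Is.
  by rewrite -iK addnS ltnS leq_addr.
have [|s3 [t3 [e3 I3 le3]]] := IH i.+1 s2 _ I2; first by rewrite addSnnS.
exists s3, (t2 + t3).+1; split=> //; first exact: exec_while_true bT e2 e3.
by rewrite ltnS mulSn; move: le2 le3; lia.
Qed.

(** Frame condition: [A] and [B] are the footprints of a piece of program in the two memories, and
    facts about other cells carry over unchanged. *)
Definition fr (A B : pred nat) s s' : Prop :=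
  (forall a, ~~ A a -> nmem s' a = nmem s a) /\
  (forall a, ~~ B a -> zmem s' a = zmem s a).

Lemma fr_refl A B s : fr A B s s.
Proof. by []. Qed.

Lemma fr_trans A B s1 s2 s3 : fr A B s1 s2 -> fr A B s2 s3 -> fr A B s1 s3.
Proof. by move=> [a b] [c d]; split=> x H; [rewrite c ?a | rewrite d ?b]. Qed.

Lemma fr_sub (A B A' B' : pred nat) s s' : (forall a, A a -> A' a) ->
  (forall a, B a -> B' a) -> fr A B s s' -> fr A' B' s s'.
Proof.
by move=> AA BB [a b]; split=> x H; [apply: a | apply: b]; apply: contra H; auto.
Qed.

Lemma fr_nset (A B : pred nat) s s' d v : A d -> fr A B s s' ->
  fr A B s (nset s' d v).
Proof.
move=> Ad [a b]; split=> x H; last exact: b.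
by rewrite /= -a //; case: eqP => // xd; rewrite xd Ad in H.
Qed.

Lemma fr_zset (A B : pred nat) s s' d v : B d -> fr A B s s' ->
  fr A B s (zset s' d v).
Proof.
move=> Bd [a b]; split=> x H; first exact: a.
by rewrite /= -b //; case: eqP => // xd; rewrite xd Bd in H.
Qed.

Definition For (j len : nat) (body : prog) : prog :=
  Seq (Do (NConst j 0)) (While (NLt j len) (Seq body (Do (NAdd j j 2)))).

(** The increment adds [N[2]], hence the demand that this cell hold 1. Of the constants, 2 per pass
    are the increment and the test, the outer 2 the reset and the last test. *)
Lemma run_for j len body (I : nat -> state R -> Prop) K T s :
  I 0%N (nset s j 0%N) ->
  (forall i s, I i s -> [/\ nmem s j = i, nmem s len = K & nmem s 2 = 1%N]) ->
  (forall i s, (i < K)%N -> I i s -> run body s (fun s' =>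
     [/\ nmem s' j = i, nmem s' 2 = 1%N & I i.+1 (nset s' j i.+1)]) T) ->
  run (For j len body) s (I K) (K * T.+2).+2.
Proof.
move=> I0 Ij Ib; apply: run_step.
apply: run_while => [i s' iK Is | s' Is | //].
  have [Ei EK E1] := Ij _ _ Is; split; first by rewrite /= Ei EK.
  rewrite -[T.+1]addn1; apply: run_seq; apply: run_weak (Ib _ _ iK Is) _ (leqnn _).
  move=> s2 [E2 E3 I2]; apply: run_do.
  by rewrite /= E2 E3 addn1.
by have [Ei EK E1] := Ij _ _ Is; rewrite /= Ei EK ltnn.
Qed.

End Runs.

Local Notation "p ;; q" := (Seq p q) (at level 61, right associativity).

(* Registers of the algorithm.
   N[0] = n, N[1] = m, N[2] = 1, N[3] = 40, N[4] = 40 + n, N[5] = 40,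
   N[6] = N + 41, N[7] = N, N[8] = k, N[19] = 0.  The coordinates of the current
   point x are in N[40 + j], j < n, and the current tuple of indices of factors is
   in N[40 + n + l], l < k; Z[40 + k] and Z[N + 41 + k] receive the moments (times
   lambda ^ k / k!) and the Newton sequence. *)
Definition get_size : prog :=
  Do (NConst 13 1) ;;
  For 10 8 (Do (NAdd 12 4 10) ;; Do (NLoad 12 12) ;; Do (GetDep 11 12 9) ;;
            If (NLt 19 11) (Do (GetSize 13 9)) Skip).

(** Adds 1 to a mixed-radix number, [size] putting the radix of digit [N[9]] into [N[13]]. The carry
    in [N[15]] starts at 1 and every digit is visited; a carry left at the end means that the
    counter has wrapped around to zeros. *)
Definition odometer (base len : nat) (size : prog) : prog :=
  Do (NConst 15 1) ;;
  For 9 len (size ;; Do (NAdd 12 base 9) ;; Do (NLoad 14 12) ;; Do (NAdd 14 14 15) ;;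
             If (NLt 14 13) (Do (NStore 12 14) ;; Do (NConst 15 0))
                            (Do (NStore 12 19) ;; Do (NConst 15 1))).

Definition get_weight : prog :=
  Do (ZConst 5 1) ;;
  For 9 0 (get_size ;;
           If (NLt 2 13) (Do (NAdd 12 3 9) ;; Do (NLoad 12 12) ;;
                          Do (GetProb 6 9 12) ;; Do (ZMul 5 5 6)) Skip) ;;
  For 10 8 (Do (NAdd 12 4 10) ;; Do (NLoad 12 12) ;; Do (GetPhi 6 12 3) ;;
            Do (ZMul 5 5 6)).

(** The flag [N[16]] receives the final carry, so each point is visited once, beginning with the
    zero counter, and the coordinate cells are 0 again at the end. *)
Definition point_loop : prog :=
  Do (NConst 16 0) ;;
  While (NLt 16 2) (get_weight ;; Do (ZAdd 4 4 5) ;; odometer 3 0 get_size ;;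
                    Do (NAdd 16 15 19)).

Definition tuple_loop : prog :=
  Do (NConst 17 0) ;;
  While (NLt 17 2) (point_loop ;; odometer 4 8 (Do (NAdd 13 1 19)) ;;
                    Do (NAdd 17 15 19)).

(** Doubling [eps ^ 2] until it reaches [m + n] counts a binary logarithm, and each doubling adds
    [D1] to the order. The complex number [m + n] is built by repeated addition of 1, as no
    instruction converts an N-cell. *)
Definition find_order (N0 D1 : nat) : prog :=
  Do (ZMul 6 1 1) ;; Do (NConst 7 N0) ;; Do (NConst 20 D1) ;; Do (NAdd 18 0 1) ;;
  Do (ZConst 9 0) ;; For 10 18 (Do (ZAdd 9 9 8)) ;;
  While (ZLt 6 9) (Do (ZAdd 6 6 6) ;; Do (NAdd 7 7 20)).

Definition newton_step : prog :=
  Do (ZMul 5 3 4) ;;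
  For 10 8 (Do (NAdd 12 6 10) ;; Do (ZLoad 6 12) ;; Do (NSub 14 8 10) ;;
            Do (NAdd 14 5 14) ;; Do (ZLoad 9 14) ;; Do (ZMul 6 6 9) ;;
            Do (ZSub 5 5 6)) ;;
  Do (NAdd 12 6 8) ;; Do (ZStore 12 5).

Definition main_body : prog :=
  Do (NAdd 8 8 2) ;; Do (ZAdd 3 3 8) ;; Do (ZMul 2 2 0) ;; Do (ZDiv 2 2 3) ;;
  Do (ZConst 4 0) ;; tuple_loop ;; Do (ZMul 4 4 2) ;;
  Do (NAdd 12 5 8) ;; Do (ZStore 12 4) ;; newton_step ;;
  Do (ZDiv 5 5 3) ;; Do (ZAdd 7 7 5).

Definition main_loop : prog := While (NLt 8 7) main_body.

Definition taylor_algorithm (N0 D1 : nat) : prog :=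
  Do (NConst 2 1) ;; Do (NConst 3 40) ;; Do (NAdd 4 3 0) ;; Do (ZConst 8 1) ;;
  find_order N0 D1 ;;
  Do (NConst 5 40) ;; Do (NAdd 6 5 7) ;; Do (NAdd 6 6 2) ;;
  Do (ZConst 2 1) ;; Do (ZConst 3 0) ;; Do (ZConst 7 0) ;; Do (ZStore 5 8) ;;
  Do (NConst 8 0) ;; main_loop ;; Do (ZExp 0 7).

(** * Mixed-radix counters *)

Section Digits.
Implicit Types (S : nat -> nat) (u : nat).

Definition radix S i : nat := \prod_(j < i) S j.
Definition digit S u i : nat := (u %/ radix S i) %% S i.

Lemma radixS S i : radix S i.+1 = (radix S i * S i)%N.
Proof. by rewrite /radix big_ord_recr. Qed.

Lemma radix_gt0 S i : (forall j, (j < i)%N -> (0 < S j)%N) -> (0 < radix S i)%N.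
Proof. by move=> H; rewrite prodn_gt0 // => j; rewrite H. Qed.

Lemma radix_dvd S n i : (i < n)%N ->
  exists d, radix S n = (d * S i * radix S i)%N.
Proof.
move=> iN; rewrite -(subnKC iN); elim: (n - i.+1)%N => [|d [e IH]].
  by exists 1%N; rewrite addn0 radixS mul1n mulnC.
by exists (e * S (i.+1 + d))%N; rewrite addnS radixS IH; lia.
Qed.

Lemma digit0 S i : digit S 0 i = 0%N.
Proof. by rewrite /digit div0n mod0n. Qed.

(** One step past the largest number all digits are 0: the counter restores its initial state for
    the next round. *)
Lemma digit_radix S n i : (i < n)%N -> (forall j, (j < n)%N -> (0 < S j)%N) ->
  digit S (radix S n) i = 0%N.
Proof.
move=> iN S0; have [d ->] := radix_dvd S iN.
rewrite /digit mulnK; first by rewrite modnMl.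
by apply: radix_gt0 => j ji; apply: S0; exact: ltn_trans iN.
Qed.

Lemma digit_lt S u i : (0 < S i)%N -> (digit S u i < S i)%N.
Proof. by move=> H; rewrite ltn_mod. Qed.

Lemma digit_succ S u i : (0 < radix S i)%N -> (0 < S i)%N ->
  let c := (radix S i %| u.+1)%N in
  (digit S u i + c < S i -> digit S u.+1 i = digit S u i + c /\
     (radix S i.+1 %| u.+1) = false)%N /\
  (S i <= digit S u i + c -> digit S u.+1 i = 0 /\
     (radix S i.+1 %| u.+1))%N.
Proof.
move=> P0 S0 c.
have E : (u.+1 %/ radix S i = c + u %/ radix S i)%N by rewrite divnS.
set e := (u %/ radix S i)%N in E.
have D : (radix S i.+1 %| u.+1)%N = c && (S i %| u.+1 %/ radix S i)%N.
  rewrite radixS /c; case: (boolP (radix S i %| u.+1)%N) => [Pu|Pu] /=.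
    by rewrite -{1}(divnK Pu) mulnC dvdn_pmul2r.
  by apply/negbTE; apply: contra Pu; apply: dvdn_trans; exact: dvdn_mulr.
rewrite D /digit E -/e; have dl : (e %% S i < S i)%N by rewrite ltn_mod.
case: c E {D} => E /=; last by rewrite add0n addn0; split=> //; lia.
rewrite add1n addn1; split=> H.
  rewrite -addn1 -modnDml modn_small ?addn1 //; split=> //.
  by rewrite /dvdn -addn1 -modnDml modn_small addn1.
have E2 : ((e %% S i).+1 = S i)%N by lia.
have E3 : (e.+1 %% S i = 0)%N by rewrite -addn1 -modnDml addn1 E2 modnn.
by rewrite /dvdn E3.
Qed.

(** The most significant digit is split off by writing the index as [a * radix S n + u], which makes
    sums over counters accessible to induction on their length. *)
Lemma sum_digits (V : nmodType) S n (F : (nat -> nat) -> V) :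
  (forall v v', (forall i, (i < n.+1)%N -> v i = v' i) -> F v = F v') ->
  (forall i, (i < n.+1)%N -> (0 < S i)%N) ->
  \sum_(u < radix S n.+1) F (digit S u) =
  \sum_(a < S n) \sum_(u < radix S n) F (fun i => if i == n then val a else digit S u i).
Proof.
move=> Fext S0; have P0 : (0 < radix S n)%N by apply: radix_gt0 => j jn; rewrite S0 // ltnW.
rewrite radixS mulnC.
rewrite -(big_mkord predT (fun u => F (digit S u))).
have -> : \sum_(0 <= u < S n * radix S n) F (digit S u) =
  \sum_(a < S n) \sum_(u < radix S n) F (digit S (a * radix S n + u)).
  elim: (S n) => [|d IH]; first by rewrite mul0n big_nil big_ord0.
  rewrite big_ord_recr /= -IH (big_cat_nat (n := d * radix S n)) //=; last first.
    by rewrite leq_mul.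
  congr (_ + _); rewrite -{1}[(d * radix S n)%N]add0n mulSn big_addn addnK big_mkord.
  by apply: eq_bigr => u _; rewrite addnC.
apply: eq_bigr => a _; apply: eq_bigr => u _; apply: Fext => i.
rewrite ltnS leq_eqVlt => /orP[/eqP ->|iN].
  by rewrite eqxx /digit divnMDl // divn_small // addn0 modn_small.
rewrite ltn_eqF // /digit; move: (nat_of_ord u) => v.
have [d ->] := radix_dvd S iN.
have Pi : (0 < radix S i)%N.
  by apply: radix_gt0 => j ji; rewrite S0 // ltnS ltnW // (ltn_trans ji).
by rewrite mulnA divnMDl // mulnA modnMDl.
Qed.

End Digits.

Definition among (l : seq nat) : pred nat := fun a => a \in l.

Lemma among_small (l : seq nat) a : all (gtn 40) l -> (40 <= a)%N -> ~~ among l a.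
Proof.
by move=> /allP H a40; apply/negP => /H; rewrite /= ltnNge a40.
Qed.

Ltac frs := repeat first [ assumption | exact: fr_refl
  | progress rewrite /do_instr
  | apply: fr_nset; [by [] | ] | apply: fr_zset; [by [] | ] ].

(** * Correctness and step counts of the programs *)

Section Verification.
Variables (R : realType) (o : oracle R) (n m : nat).
Hypothesis m_gt0 : (0 < m)%N.
Hypothesis size_gt0 : forall j, (j < n)%N -> (0 < osize o j)%N.
Hypothesis ophi_ext : forall i v v',
  (forall j, (j < n)%N -> v j = v' j) -> ophi o i v = ophi o i v'.
Implicit Types (s : state R) (I : nat -> nat).

Definition cst s : Prop :=
  nmem s 0 = n /\ nmem s 1 = m /\ nmem s 2 = 1%N /\ nmem s 3 = 40%N /\
  nmem s 4 = (40 + n)%N /\ nmem s 19 = 0%N.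

Lemma cst_fr (A B : pred nat) s s' : fr A B s s' -> cst s ->
  ~~ has A [:: 0; 1; 2; 3; 4; 19]%N -> cst s'.
Proof.
move=> [f _] C; rewrite /= orbF !negb_or => /and5P[a0 a1 a2 a3 /andP[a4 a5]].
by rewrite /cst !f.
Qed.

(** Coordinates on which no factor of the tuple depends get radix 1, so the counter leaves them at
    0. This is what reduces the enumeration from [q ^ n] points to [q ^ (r k)]. *)
Definition siz k I j : nat :=
  if has (fun l => odep o (I l) j) (iota 0 k) then osize o j else 1%N.

Lemma sizS k I j : siz k.+1 I j = if odep o (I k) j then osize o j else siz k I j.
Proof.
rewrite /siz -addn1 iotaD has_cat /= orbF add0n orbC.
by case: (odep _ _ _).
Qed.

Definition regs_size : pred nat := among [:: 10; 11; 12; 13]%N.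

Lemma get_size_run s k I : cst s -> nmem s 8 = k ->
  (forall l, (l < k)%N -> nmem s (40 + n + l) = I l) ->
  run o get_size s (fun s' => fr regs_size pred0 s s' /\
    nmem s' 13 = siz k I (nmem s 9)) (7 * k + 3).
Proof.
move=> C Ek EI; rewrite addn3 mulnC; apply: run_step.
pose Inv i s1 := [/\ fr regs_size pred0 s s1, nmem s1 10 = i &
  nmem s1 13 = siz i I (nmem s 9)].
apply: (@run_weak _ _ _ _ (Inv k) _ (k * 7).+2) => //; last by move=> s' [].
apply: run_for => [|i s1 [f E10 E13]|i s1 ik [f E10 E13]].
- by split=> //; frs.
- have [_ [_ [E2 _]]] := cst_fr f C isT.
  by rewrite (f.1 8%N) // Ek.
have [E0 [_ [E2 [E3 [E4 E19]]]]] := cst_fr f C isT.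
do 3!apply: run_step.
have [_ [_ [_ [_ [_ E19']]]]] := C.
set s2 := do_instr _ _ _.
have f2 : fr regs_size pred0 s1 s2 by rewrite /s2; frs.
have E11 : nmem s2 11 = odep o (I i) (nmem s 9) :> nat.
  rewrite /s2 /= E4 E10 f.1 ?EI ?(f.1 9%N) //.
have E13' : nmem s2 13 = siz i I (nmem s 9) by rewrite /s2 /= E13.
have E10' : nmem s2 10 = i by rewrite /s2 /= E10.
have f3 := fr_trans f f2; have C2 := cst_fr f3 C isT.
have [_ [_ [E2' [_ [_ E19'']]]]] := C2.
clearbody s2.
apply: run_if => /=; rewrite E19'' E11 => t1.
  apply: run_do; split=> //; split=> //=; first by frs.
  by rewrite sizS (f3.1 9%N) //; move: t1; rewrite lt0b => ->.
apply: run_skip.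
split=> //; split=> //=; first by frs.
by rewrite E13' sizS; case: (odep _ _ _) t1.
Qed.

Definition regs_odo B L : pred nat :=
  fun a => among [:: 9; 10; 11; 12; 13; 14; 15]%N a || (B <= a < B + L)%N.

Lemma regs_odo_small B L a : (40 <= B)%N -> (a < 40)%N ->
  ~~ among [:: 9; 10; 11; 12; 13; 14; 15]%N a -> ~~ regs_odo B L a.
Proof. by move=> B40 a40 H; rewrite /regs_odo (negbTE H) /=; lia. Qed.

Lemma cst_odo B L s s' : (40 <= B)%N -> fr (regs_odo B L) pred0 s s' -> cst s -> cst s'.
Proof.
move=> B40 f C; apply: cst_fr f C _; apply/hasPn => a; rewrite !inE => H.
by apply: regs_odo_small => //; [|rewrite /among !inE]; move: H; lia.
Qed.

Lemma regs_size_odo B L s s' :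
  fr regs_size pred0 s s' -> fr (regs_odo B L) pred0 s s'.
Proof.
apply: fr_sub => // a; rewrite /regs_size /regs_odo /among !inE => H.
by rewrite orbC; case: andb => //=; move: H; lia.
Qed.

(** After [i] passes the digits below [i] are those of [u.+1], the others still those of [u], and
    the carry is the divisibility bit of [digit_succ]. Correctness of [size] is required from every
    state within the footprint because it runs while the digits are changing. *)
Lemma odometer_run base len size S u L B s (Tg : nat) :
  cst s -> nmem s len = L -> nmem s base = B -> (40 <= B)%N ->
  (base < 9)%N -> (len < 9)%N ->
  (forall i, (i < L)%N -> nmem s (B + i) = digit S u i) ->
  (forall i, (i < L)%N -> (0 < S i)%N) ->
  (forall s1, fr (regs_odo B L) pred0 s s1 -> (nmem s1 9 < L)%N ->
     run o size s1 (fun s2 => fr regs_size pred0 s1 s2 /\ nmem s2 13 = S (nmem s1 9)) Tg) ->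
  run o (odometer base len size) s (fun s' =>
    [/\ fr (regs_odo B L) pred0 s s',
        forall i, (i < L)%N -> nmem s' (B + i) = digit S u.+1 i &
        nmem s' 15 = (radix S L %| u.+1)%N]) (L * (Tg + 8) + 3).
Proof.
move=> C EL EB B40 b9 l9 Hd S0 Hs; rewrite addn3; apply: run_step.
have small a : (a < 40)%N -> ~~ among [:: 9; 10; 11; 12; 13; 14; 15]%N a ->
  ~~ regs_odo B L a by exact: regs_odo_small.
have low a : (a < 9)%N -> ~~ regs_odo B L a.
  move=> a9; apply: small; first by lia.
  by rewrite /among !inE; lia.
pose Inv i s1 := [/\ fr (regs_odo B L) pred0 s s1, nmem s1 9 = i,
  forall l, (l < L)%N -> nmem s1 (B + l) =
    if (l < i)%N then digit S u.+1 l else digit S u l &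
  nmem s1 15 = (radix S i %| u.+1)%N].
apply: (@run_weak _ _ _ _ (Inv L) _ (L * (Tg + 6).+2).+2).
- apply: run_for => [|i s1 [f E9 Ed E15]|i s1 iL [f E9 Ed E15]].
  + split=> //=; first by frs.
      by move=> l lL; rewrite !ifN ?Hd //; lia.
    by rewrite /radix big_ord0 dvd1n.
  + have [_ [_ [E2 _]]] := cst_odo B40 f C.
    by rewrite (f.1 len) ?low.
  + have -> : (Tg + 6 = Tg + (1 + (1 + (1 + 3))))%N by lia.
    apply: run_seq; apply: run_weak (Hs s1 f _) _ (leqnn _); first by rewrite E9.
    move=> s2 [f12 E13]; rewrite E9 in E13.
    have f2 := fr_trans f (regs_size_odo B L f12).
    have C2 := cst_odo B40 f2 C; have [_ [_ [E2 [_ [_ E19]]]]] := C2.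
    have Ed2 l : (l < L)%N -> nmem s2 (B + l) =
        if (l < i)%N then digit S u.+1 l else digit S u l.
      move=> lL; rewrite f12.1 ?Ed //; apply: among_small => //; lia.
    have E92 : nmem s2 9 = i by rewrite f12.1 // E9.
    have E152 : nmem s2 15 = (radix S i %| u.+1)%N by rewrite f12.1 // E15.
    have EB2 : nmem s2 base = B by rewrite f2.1 ?low.
    clear s1 f E9 Ed E15 f12.
    do 3!apply: run_step.
    set s3 := do_instr _ _ _.
    have f3 : fr (regs_odo B L) pred0 s s3 by rewrite /s3; frs.
    have G12 : nmem s3 12 = (B + i)%N by rewrite /s3 /= EB2 E92.
    have out l : (B + l)%N == 12%N = false by apply/negbTE; lia.
    have out' l : (B + l)%N == 14%N = false by apply/negbTE; lia.
    have G14 : nmem s3 14 = (digit S u i + (radix S i %| u.+1))%N.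
      by rewrite /s3 /= EB2 E92 out Ed2 // ltnn E152.
    have G13 : nmem s3 13 = S i by rewrite /s3 /= E13.
    have G9 : nmem s3 9 = i by rewrite /s3 /= E92.
    have Gd l : (l < L)%N -> nmem s3 (B + l) =
        if (l < i)%N then digit S u.+1 l else digit S u l.
      by move=> lL; rewrite /s3 /= !out !out' Ed2.
    have C3 := cst_odo B40 f3 C; have [_ [_ [H2 [_ [_ H19]]]]] := C3.
    clearbody s3; clear s2 E13 f2 C2 E2 E19 Ed2 E92 E152 EB2 out out'.
    have Pi : (0 < radix S i)%N.
      by apply: radix_gt0 => j ji; apply: S0; exact: ltn_trans iL.
    have [K1 K2] := digit_succ u Pi (S0 i iL).
    have outs d l : (d < 40)%N -> ((B + l)%N == d) = false.
      by move=> d40; apply/negbTE; lia.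
    have outs' d l : (d < 40)%N -> (d == (B + l)%N) = false.
      by move=> d40; apply/negbTE; lia.
    have cell v c : v = digit S u.+1 i -> c = (radix S i.+1 %| u.+1)%N :> nat ->
      Inv i.+1 (nset (nset (nset s3 (B + i)%N v) 15 c) 9 i.+1).
      move=> vE cE; split=> //=.
        have Bi : regs_odo B L (B + i)%N by rewrite /regs_odo; lia.
        by frs.
      move=> l lL; rewrite (outs 9%N) // (outs 15%N) // eqn_add2l.
      case: (eqVneq l i) => [->|li].
        by rewrite ltnS leqnn vE.
      have -> : (l < i.+1)%N = (l < i)%N by move/eqP: li; lia.
      by rewrite Gd.
    apply: run_if => /=; rewrite G14 G13; [move=> lt|rewrite -leqNgt => le].
      have [D1 D2] := K1 lt; apply: run_step; apply: run_do => /=.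
      rewrite G12 G14 !outs' // G9 H2.
      split=> //; apply: cell => //; by rewrite D2.
    have [D1 D2] := K2 le; apply: run_step; apply: run_do => /=.
    rewrite G12 !outs' // G9 H2 H19.
    split=> //; apply: cell => //; by rewrite D2.
- by move=> s' [f _ Ed E15]; split=> // i iL; rewrite Ed // iL.
- by rewrite addnS addnS; lia.
Qed.

(** Radix 1 means either a coordinate that no factor of the tuple sees, to be left out, or a space
    with one element, of mass 1; in both cases the factor 1 is right. *)
Definition weight_of k I (v : nat -> nat) : R[i] :=
  (\prod_(j < n) if (1 < siz k I j)%N then oprob o j (v j) else 1) *
  \prod_(l < k) ophi o (I l) v.

Definition regs_weight : pred nat := among [:: 9; 10; 11; 12; 13]%N.
Definition zregs_weight : pred nat := among [:: 5; 6]%N.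

Lemma get_weight_run s k I v : cst s -> nmem s 8 = k ->
  (forall l, (l < k)%N -> nmem s (40 + n + l) = I l) ->
  (forall j, (j < n)%N -> nmem s (40 + j) = v j) ->
  run o get_weight s (fun s' => fr regs_weight zregs_weight s s' /\
    zmem s' 5 = weight_of k I v) (n * (7 * k + 10) + 6 * k + 5).
Proof.
move=> C Ek EI Ev.
have -> : (n * (7 * k + 10) + 6 * k + 5 =
  ((n * (7 * k + 8).+2).+2 + (k * 4.+2).+2).+1)%N by lia.
apply: run_step; apply: run_seq.
pose Inv1 i s1 := [/\ fr regs_weight zregs_weight s s1, nmem s1 9 = i &
  zmem s1 5 = \prod_(j < i) if (1 < siz k I j)%N then oprob o j (v j) else 1].
apply: (@run_weak _ _ _ _ (Inv1 n)) (leqnn _).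
  apply: run_for => [|i s1 [f E9 E5]|i s1 iN [f E9 E5]].
  - split=> //=; first by frs.
    by rewrite big_ord0.
  - by have [E0 [_ [E2 _]]] := cst_fr f C isT.
  have C1 := cst_fr f C isT.
  have -> : (7 * k + 8 = 7 * k + 3 + 5)%N by lia.
  apply: run_seq.
  apply: run_weak (get_size_run C1 (_ : nmem s1 8 = k) (I := I) _) _ (leqnn _).
  - by rewrite f.1.
  - by move=> l lk; rewrite f.1 ?EI.
  move=> s2 [f12 E13]; rewrite E9 in E13.
  have f2 : fr regs_weight zregs_weight s s2.
    apply: fr_trans f _; apply: fr_sub f12 => // a.
    by rewrite /regs_size /regs_weight /among !inE; lia.
  have E92 : nmem s2 9 = i by rewrite f12.1.
  have E52 : zmem s2 5 = zmem s1 5 by rewrite f12.2.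
  have [_ [_ [E2 [E3 _]]]] := cst_fr f2 C isT.
  rewrite -E52 in E5; clear s1 f E9 C1 f12 E52.
  apply: run_if => /=; rewrite E2 E13 => t1.
    do 3!apply: run_step; apply: run_do; split=> //=.
    split=> //=; first by frs.
    rewrite big_ord_recr /= t1 E5 E3 E92; congr (_ * oprob o _ _).
    by rewrite f2.1 ?Ev.
  apply: run_skip; split=> //; split=> //=; first by frs.
  by rewrite big_ord_recr /= (negbTE t1) mulr1.
move=> s1 [f _ E5]; have C1 := cst_fr f C isT.
pose Inv2 i s2 := [/\ fr regs_weight zregs_weight s s2, nmem s2 10 = i &
  zmem s2 5 = zmem s1 5 * \prod_(l < i) ophi o (I l) v].
apply: (@run_weak _ _ _ _ (Inv2 k)) (leqnn _).
  apply: run_for => [|i s2 [f2 E10 E52]|i s2 ik [f2 E10 E52]].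
  - split=> //=; first by frs.
    by rewrite big_ord0 mulr1.
  - have [_ [_ [E2 _]]] := cst_fr f2 C isT.
    by rewrite (f2.1 8%N).
  have [_ [_ [E2 [E3 [E4 _]]]]] := cst_fr f2 C isT.
  do 3!apply: run_step; apply: run_do; split=> //=; split=> //=; first by frs.
  rewrite big_ord_recr /= mulrA -E52 E4 E10; congr (_ * _).
  rewrite [nmem s2 (40 + n + i)]f2.1 // EI //; apply: ophi_ext => j jn.
  by rewrite E3 /= f2.1 ?Ev.
by move=> s' [f' _ ->]; split=> //; rewrite E5.
Qed.

Definition regs_point : pred nat :=
  fun a => among [:: 9; 10; 11; 12; 13; 14; 15; 16]%N a || (40 <= a < 40 + n)%N.
Definition zregs_point : pred nat := among [:: 4; 5; 6]%N.

Definition point_sum k I : R[i] :=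
  \sum_(u < radix (siz k I) n) weight_of k I (digit (siz k I) u).

Lemma siz_gt0 k I j : (j < n)%N -> (0 < siz k I j)%N.
Proof. by move=> jn; rewrite /siz; case: ifP => // _; exact: size_gt0. Qed.

Lemma cst_point s s' : fr regs_point zregs_point s s' -> cst s -> cst s'.
Proof. by move=> f C; apply: cst_fr f C _. Qed.

Lemma point_loop_run s k I : cst s -> nmem s 8 = k ->
  (forall l, (l < k)%N -> nmem s (40 + n + l) = I l) ->
  (forall j, (j < n)%N -> nmem s (40 + j) = 0) ->
  run o point_loop s (fun s' => [/\ fr regs_point zregs_point s s',
    forall j, (j < n)%N -> nmem s' (40 + j) = 0 &
    zmem s' 4 = zmem s 4 + point_sum k I])
  (radix (siz k I) n * (n * (14 * k + 21) + 6 * k + 11) + 2)%N.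
Proof.
move=> C Ek EI Ex; set S := siz k I; set P := radix S n.
have S0 j : (j < n)%N -> (0 < S j)%N by exact: siz_gt0.
have P0 : (0 < P)%N by exact: radix_gt0.
rewrite addn2; apply: run_step.
(* After [u] passes the counter shows [u]; for [u = P] it shows the digits of [P], all of them 0. *)
pose Inv u s1 := [/\ fr regs_point zregs_point s s1, (u <= P)%N,
  nmem s1 16 = (u == P), forall j, (j < n)%N -> nmem s1 (40 + j) = digit S u j &
  zmem s1 4 = zmem s 4 + \sum_(u' < u) weight_of k I (digit S u')].
apply: (@run_weak _ _ _ _ (Inv P) _ (P * ((n * (14 * k + 21) + 6 * k + 10).+1)).+1).
- apply: run_while => [u s1 uP [f _ E16 Ed E4]|s1 [f _ E16 _ _]|].
  + have C1 := cst_point f C; have [E0 [_ [E2 [E3 [_ E19]]]]] := C1.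
    split; first by rewrite /= E16 E2 ltn_eqF.
    have Ek1 : nmem s1 8 = k by rewrite f.1.
    have EI1 l : (l < k)%N -> nmem s1 (40 + n + l) = I l.
      move=> lk; rewrite f.1 ?EI //; rewrite /regs_point negb_or; apply/andP; split=> //.
      by lia.
    have -> : (n * (14 * k + 21) + 6 * k + 10 = (n * (7 * k + 10) + 6 * k + 5) +
       (1 + ((n * (7 * k + 3 + 8) + 3) + 1)))%N by lia.
    apply: run_seq; apply: run_weak (get_weight_run C1 Ek1 EI1 Ed) _ (leqnn _).
    move=> s2 [f12 E5]; apply: run_step; set s3 := do_instr _ _ _.
    have f13 : fr regs_weight zregs_point s1 s3.
      rewrite /s3; apply: fr_zset => //; apply: fr_sub f12 => // a.
      by rewrite /zregs_weight /zregs_point /among !inE; lia.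
    have E43 : zmem s3 4 = zmem s1 4 + weight_of k I (digit S u).
      by rewrite /s3 /= E5 f12.2.
    clearbody s3; clear s2 f12 E5.
    have C3 := cst_fr f13 C1 isT; have [E03 [_ [E23 [E33 [_ E193]]]]] := C3.
    have Ek3 : nmem s3 8 = k by rewrite f13.1.
    have EI3 l : (l < k)%N -> nmem s3 (40 + n + l) = I l.
      by move=> lk; rewrite f13.1 ?EI1.
    have Ed3 j : (j < n)%N -> nmem s3 (40 + j) = digit S u j.
      by move=> jn; rewrite f13.1 ?Ed.
    apply: run_seq; apply: run_weak (@odometer_run 3 0 get_size S u n 40 s3
      (7 * k + 3) C3 E03 E33 isT isT isT Ed3 S0 _) _ (leqnn _).
      move=> s4 f34 lt; have C4 := @cst_odo 40 n _ _ isT f34 C3.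
      apply: get_size_run => //; first by rewrite f34.1.
      move=> l lk; rewrite f34.1 ?EI3 //; rewrite /regs_odo negb_or; apply/andP; split=> //.
      by lia.
    move=> s4 [f34 Ed4 E15]; have C4 := @cst_odo 40 n _ _ isT f34 C3.
    have [_ [_ [_ [_ [_ E194]]]]] := C4.
    apply: run_do; rewrite /Inv.
    have f14 : fr regs_point zregs_point s s4.
      apply: fr_trans f _; apply: fr_trans (_ : fr _ _ s1 s3) _.
        by apply: fr_sub f13 => // a; rewrite /regs_weight /regs_point /among !inE; lia.
      apply: fr_sub f34 => // a; rewrite /regs_odo /regs_point /among !inE.
      by case: (40 <= a < 40 + n)%N; rewrite ?orbT // !orbF; lia.
    split=> //=; first by frs.
    (* As [u.+1 <= P], divisibility by [P] is equality with [P]: the final carry is the end-of-loop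
       flag. *)
    * rewrite E15 E194 addn0; congr nat_of_bool; apply/idP/eqP => [|->].
        by move/dvdn_leq => /(_ isT); lia.
      exact: dvdnn.
    * by rewrite (f34.2 4%N) // E43 E4 big_ord_recr addrA.
  + have [_ [_ [E2 _]]] := cst_point f C.
    by rewrite /= E16 E2 eqxx.
  + split=> //=; first by frs.
    * by rewrite ltn_eqF.
    * by move=> j jn; rewrite Ex // digit0.
    * by rewrite big_ord0 addr0.
- move=> s' [f _ _ Ed E4]; split=> // j jn.
  by rewrite Ed // digit_radix.
- by lia.
Qed.

Definition regs_tuple k : pred nat := fun a =>
  among [:: 9; 10; 11; 12; 13; 14; 15; 16; 17]%N a || (40 <= a < 40 + n + k)%N.

Definition moment k : R[i] :=
  \sum_(t < radix (fun=> m) k) point_sum k (digit (fun=> m) t).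

Lemma cst_tuple k s s' : fr (regs_tuple k) (zregs_point) s s' -> cst s -> cst s'.
Proof. by move=> f C; apply: cst_fr f C _. Qed.

Definition point_time (Pb k : nat) : nat := Pb * (n * (14 * k + 21) + 6 * k + 11) + 2.
Definition tuple_time (Pb k : nat) : nat := m ^ k * (point_time Pb k + 9 * k + 5) + 2.

(** [Pb] bounds the number of points uniformly, since the radices vary with the tuple. Both counters
    return to 0, which the next value of [k] relies on. *)
Lemma tuple_loop_run s k Pb : cst s -> nmem s 8 = k ->
  (forall I, (forall l, (l < k)%N -> (I l < m)%N) -> (radix (siz k I) n <= Pb)%N) ->
  (forall a, nmem s (40 + a) = 0) ->
  run o tuple_loop s (fun s' => [/\ fr (regs_tuple k) zregs_point s s',
    forall a, nmem s' (40 + a) = 0 &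
    zmem s' 4 = zmem s 4 + moment k]) (tuple_time Pb k).
Proof.
move=> C Ek HP Ez; set S := fun _ : nat => m; set M := radix S k.
have S0 j : (j < k)%N -> (0 < S j)%N by [].
have M0 : (0 < M)%N by exact: radix_gt0.
have ME : M = (m ^ k)%N by rewrite /M /radix prod_nat_const card_ord.
rewrite /tuple_time -ME addn2; apply: run_step.
have outI a : (k <= a)%N -> ~~ regs_tuple k (40 + n + a).
  by move=> ka; rewrite /regs_tuple negb_or; apply/andP; split=> //; lia.
pose Inv t s1 := [/\ fr (regs_tuple k) zregs_point s s1, (t <= M)%N,
  nmem s1 17 = (t == M), (forall j, (j < n)%N -> nmem s1 (40 + j) = 0) /\
   (forall l, (l < k)%N -> nmem s1 (40 + n + l) = digit S t l) &
  zmem s1 4 = zmem s 4 + \sum_(t' < t) point_sum k (digit S t')].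
apply: (@run_weak _ _ _ _ (Inv M) _ (M * ((point_time Pb k + 9 * k + 4).+1)).+1).
- apply: run_while => [t s1 tM [f _ E17 [Ex EI] E4]|s1 [f _ E17 _ _]|].
  + have C1 := cst_tuple f C; have [E0 [E1 [E2 [E3 [E40 E19]]]]] := C1.
    split; first by rewrite /= E17 E2 ltn_eqF.
    have Ek1 : nmem s1 8 = k by rewrite f.1.
    have -> : (point_time Pb k + 9 * k + 4 =
       point_time Pb k + ((k * (1 + 8) + 3) + 1))%N by lia.
    apply: run_seq.
    apply: run_weak (point_loop_run C1 Ek1 EI Ex) _ _; last first.
      rewrite /point_time leq_add2r leq_mul2r HP ?orbT // => l lk.
      by apply: digit_lt; exact: S0.
    move=> s2 [f12 Ex2 E42].
    have f2 : fr (regs_tuple k) zregs_point s s2.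
      apply: fr_trans f _; apply: fr_sub f12 => // a.
      rewrite /regs_point /regs_tuple /among !inE => /orP[H|H]; first by lia.
      by apply/orP; right; lia.
    have C2 := cst_tuple f2 C; have [_ [E12 [_ [_ [E44 E192]]]]] := C2.
    have Ek2 : nmem s2 8 = k by rewrite f2.1.
    have EI2 l : (l < k)%N -> nmem s2 (40 + n + l) = digit S t l.
      move=> lk; rewrite f12.1 ?EI // /regs_point negb_or; apply/andP; split=> //.
      by lia.
    have B40 : (40 <= 40 + n)%N by lia.
    apply: run_seq; apply: run_weak (@odometer_run 4 8 (Do (NAdd 13 1 19)) S t
      k (40 + n) s2 1 C2 Ek2 E44 B40 isT isT EI2 S0 _) _ (leqnn _).
      move=> s3 f23 lt; have [_ [E13 [_ [_ [_ E193]]]]] := cst_odo B40 f23 C2.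
      by apply: run_do; split=> /=; [frs | rewrite E13 E193 addn0].
    move=> s3 [f23 Ed3 E15]; have C3 := cst_odo B40 f23 C2.
    have [_ [_ [_ [_ [_ E193]]]]] := C3.
    apply: run_do; rewrite /Inv.
    have f3 : fr (regs_tuple k) zregs_point s s3.
      apply: fr_trans f2 _; apply: fr_sub f23 => // a.
      rewrite /regs_odo /regs_tuple /among !inE => /orP[H|H]; first by lia.
      by apply/orP; right; lia.
    split=> //=; first by frs.
    * rewrite E15 E193 addn0; congr nat_of_bool; apply/idP/eqP => [|->].
        by move/dvdn_leq => /(_ isT); lia.
      exact: dvdnn.
    * split=> [j jn|l lk]; last by rewrite Ed3.
      rewrite f23.1 ?Ex2 // /regs_odo negb_or; apply/andP; split=> //.
      by lia.
    * by rewrite (f23.2 4%N) // E42 E4 big_ord_recr addrA.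
  + have [_ [_ [E2 _]]] := cst_tuple f C.
    by rewrite /= E17 E2 eqxx.
  + split=> //=; first by frs.
    * by rewrite ltn_eqF.
    * split=> [j jn|l lk]; first by rewrite Ez.
      by rewrite -addnA Ez digit0.
    * by rewrite big_ord0 addr0.
- move=> s' [f _ _ [Ex EI] E4]; split=> // a.
  have [an|na] := ltnP a n; first exact: Ex.
  rewrite -(subnKC na) addnA; have [lk|kl] := ltnP (a - n) k.
    by rewrite EI // digit_radix.
  by rewrite f.1 ?outI // -addnA Ez.
- by lia.
Qed.

(** Moments occupy the Z-cells [40] to [40 + N] and the Newton sequence those from [41 + N] on, so
    the blocks are disjoint. *)
Definition newton_value (s : state R) N k : R[i] :=
  k%:R * zmem s (40 + k) -
  \sum_(j < k) zmem s (41 + N + j) * zmem s (40 + (k - j)).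

Lemma newton_step_run s k N : cst s -> nmem s 8 = k -> nmem s 5 = 40%N ->
  nmem s 6 = (41 + N)%N -> (0 < k <= N)%N ->
  zmem s 3 = k%:R -> zmem s 4 = zmem s (40 + k) ->
  run o newton_step s (fun s' => [/\
     fr (among [:: 10; 12; 14]%N)
        (fun a => among [:: 5; 6; 9]%N a || (a == 41 + N + k)%N) s s',
     zmem s' 5 = newton_value s N k &
     zmem s' (41 + N + k) = newton_value s N k]) (9 * k + 5).
Proof.
move=> C Ek E5 E6 /andP[k0 kN] Z3 Z4.
have -> : (9 * k + 5 = ((k * 7.+2).+2 + 2).+1)%N by lia.
apply: run_step; apply: run_seq.
pose A := among [:: 10; 12; 14]%N.
pose B : pred nat := fun a => among [:: 5; 6; 9]%N a || (a == 41 + N + k)%N.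
have cstA s1 : fr A B s s1 -> cst s1 by move=> f; apply: cst_fr f C _.
pose Inv i s1 := [/\ fr A (among [:: 5; 6; 9]%N) s s1, nmem s1 10 = i &
  zmem s1 5 = k%:R * zmem s (40 + k) -
    \sum_(j < i) zmem s (41 + N + j) * zmem s (40 + (k - j))].
have subB s1 : fr A (among [:: 5; 6; 9]%N) s s1 -> fr A B s s1.
  by apply: fr_sub => // a; rewrite /B => ->.
apply: (@run_weak _ _ _ _ (Inv k)) (leqnn _).
  apply: run_for => [|i s1 [f E10 Z5]|i s1 ik [f E10 Z5]].
  - split=> //=; first by frs.
    by rewrite big_ord0 subr0 Z3 Z4.
  - have [_ [_ [E2 _]]] := cstA _ (subB _ f).
    by rewrite (f.1 8%N).
  have [_ [_ [E2 _]]] := cstA _ (subB _ f).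
  do 6!apply: run_step; apply: run_do; split=> //=; split=> //=; first by frs.
  rewrite big_ord_recr /= opprD addrA -Z5 E10 (f.1 6%N) // (f.1 5%N) // (f.1 8%N) //.
  rewrite E5 E6 Ek (f.2 (41 + N + i)%N) //.
  have -> : ((40 + (k - i))%N == 6%N) = false by [].
  by rewrite (f.2 (40 + (k - i))%N).
move=> s1 [f E10 Z5].
have [E8 E61] : nmem s1 8 = k /\ nmem s1 6 = (41 + N)%N by rewrite !f.1.
apply: run_step; apply: run_do; split=> /=.
- have BB : B (41 + N + k)%N by rewrite /B eqxx orbT.
  rewrite /do_instr /= E61 E8.
  by apply: fr_zset BB _; apply: fr_nset; [by []|exact: subB].
- by rewrite E61 E8.
- by rewrite E61 E8 eqxx.
Qed.

Lemma find_order_run s N0 D1 K (eps : R) : cst s -> zmem s 1 = eps%:C ->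
  zmem s 8 = 1 ->
  (forall i, (i < K)%N -> 2 ^+ i * eps ^+ 2 < (m + n)%:R) ->
  (m + n)%:R <= 2 ^+ K * eps ^+ 2 ->
  run o (find_order N0 D1) s (fun s' =>
    fr (among [:: 7; 10; 18; 20]%N) (among [:: 6; 9]%N) s s' /\
    nmem s' 7 = (N0 + K * D1)%N) (3 * (n + m) + 3 * K + 8).
Proof.
move=> C Z1 Z8 HK KH.
pose A := among [:: 7; 10; 18; 20]%N; pose B := among [:: 6; 9]%N.
have cstA s1 : fr A B s s1 -> cst s1 by move=> f; apply: cst_fr f C _.
have [E0 [E1 [E2 [E3 [E4 E19]]]]] := C.
have -> : (3 * (n + m) + 3 * K + 8 = ((((n + m) * 1.+2).+2 + (K * 2.+1).+1)).+4.+1)%N.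
  by lia.
do 5!apply: run_step; set s1 := do_instr _ _ _.
have f1 : fr A B s s1 by rewrite /s1; frs.
have Z6 : zmem s1 6 = (eps ^+ 2)%:C by rewrite /s1 /= Z1 -rmorphM -expr2.
have [F7 F20 F18 F9] : [/\ nmem s1 7 = N0, nmem s1 20 = D1, nmem s1 18 = (n + m)%N &
    zmem s1 9 = 0] by rewrite /s1 /= E0 E1.
clearbody s1.
pose Inv i s2 := [/\ fr A B s s2, nmem s2 10 = i, zmem s2 9 = i%:R,
   zmem s2 6 = (eps ^+ 2)%:C &
   [/\ nmem s2 7 = N0, nmem s2 20 = D1 & nmem s2 18 = (n + m)%N]].
apply: run_seq; apply: (@run_weak _ _ _ _ (Inv (n + m)%N)) (leqnn _).
  apply: run_for => [|i s2 [f E10 Z9 Z62 [G7 G20 G18]]|i s2 ik [f E10 Z9 Z62 [G7 G20 G18]]].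
  - by split=> //=; frs.
  - by have [_ [_ [H2 _]]] := cstA _ f.
  have [_ [_ [H2 _]]] := cstA _ f.
  apply: run_do; split=> //=; split=> //=; first by frs.
  by rewrite Z9 (f.2 8%N) // Z8 natr1.
move=> s2 [f _ Z9 Z62 [G7 G20 _]].
pose Inv2 i s3 := [/\ fr A B s s3, zmem s3 9 = (n + m)%:R,
   zmem s3 6 = (2 ^+ i * eps ^+ 2)%:C, nmem s3 7 = (N0 + i * D1)%N & nmem s3 20 = D1].
apply: (@run_weak _ _ _ _ (Inv2 K)) (leqnn _) => [|s3 [f3 _ _ ? _]]; last by [].
have ReN k : complex.Re (k%:R : R[i]) = k%:R.
  by rewrite -(rmorph_nat (real_complex R)).
apply: run_while => [i s3 iK [f3 Z93 Z63 G73 G203]|s3 [f3 Z93 Z63 _ _]|].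
- split; first by rewrite /= Z93 Z63 /= ReN addnC HK.
  apply: run_step; apply: run_do; split=> //=; first by frs.
    by rewrite Z63 -rmorphD [2 ^+ _.+1]exprS; congr (_%:C); ring.
  by rewrite G73 G203 mulSn; lia.
- by rewrite /= Z93 Z63 /= ReN addnC -leNgt.
- by split=> //; rewrite ?expr0 ?mul1r // mul0n addn0.
Qed.

Definition coef (lambda : R[i]) k : R[i] := lambda ^+ k / k`!%:R * moment k.

(** This justifies storing the coefficient of order 0 as a literal 1 before the main loop. *)
Lemma moment0 : moment 0 = 1.
Proof.
rewrite /moment /radix big_ord0 big_ord1 /point_sum.
have E I : radix (siz 0 I) n = 1%N by rewrite /radix big1.
by rewrite E big_ord1 /weight_of big_ord0 mulr1 big1.
Qed.

Lemma newton_value_ext s s' N k :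
  (forall j, (j <= k)%N -> zmem s' (40 + j) = zmem s (40 + j)) ->
  (forall j, (j < k)%N -> zmem s' (41 + N + j) = zmem s (41 + N + j)) ->
  newton_value s' N k = newton_value s N k.
Proof.
move=> H1 H2; rewrite /newton_value H1 //; congr (_ - _); apply: eq_bigr => j _.
by rewrite H1 ?H2 ?leq_subr.
Qed.

Lemma tuple_time_mono Pb k N : (k <= N)%N -> (tuple_time Pb k <= tuple_time Pb N)%N.
Proof.
move=> kN; rewrite /tuple_time /point_time leq_add2r leq_mul ?leq_pexp2l //.
do ?apply: leq_add => //; rewrite ?leq_mul //.
by do ?apply: leq_add => //; rewrite ?leq_mul // ?leq_add // ?leq_mul.
Qed.

(** The Newton sequence is specified by its recursion among memory cells; substituting [coef] for
    the moment cells turns this into [newton_seq] at the end. *)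
Definition main_inv (lambda : R[i]) N i s : Prop :=
  [/\ cst s, [/\ nmem s 5 = 40%N, nmem s 6 = (41 + N)%N, nmem s 7 = N & nmem s 8 = i],
      forall a, nmem s (40 + a) = 0,
      [/\ zmem s 0 = lambda, zmem s 8 = 1, zmem s 2 = lambda ^+ i / i`!%:R &
          zmem s 3 = i%:R] &
      [/\ zmem s 7 = \sum_(k < i) zmem s (41 + N + k.+1) / k.+1%:R,
          zmem s (41 + N + 0) = 0,
          forall k, (k <= i)%N -> zmem s (40 + k) = coef lambda k &
          forall k, (0 < k <= i)%N -> zmem s (41 + N + k) = newton_value s N k]].

Lemma main_step_run lambda N i s Pb : (i < N)%N -> main_inv lambda N i s ->
  (forall k I, (k <= N)%N -> (forall l, (l < k)%N -> (I l < m)%N) ->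
     (radix (siz k I) n <= Pb)%N) ->
  run o main_body s (main_inv lambda N i.+1)
  (tuple_time Pb N + 9 * N + 15).
Proof.
move=> iN [C [E5 E6 E7 E8] Ez [Z0 Z8 Z2 Z3] [Z7 Zb0 Zc Zb]] HP.
pose k := i.+1; have k0 : (0 < k <= N)%N by [].
pose A : pred nat := fun a =>
  among [:: 8; 9; 10; 11; 12; 13; 14; 15; 16; 17]%N a || (40 <= a < 40 + n + k)%N.
pose B : pred nat := fun a => among [:: 2; 3; 4; 5; 6; 7; 9]%N a ||
  ((a == 40 + k)%N || (a == 41 + N + k)%N).
apply: (@run_weak _ _ _ _ (main_inv lambda N i.+1) _
   (5 + (tuple_time Pb k + (3 + ((9 * k + 5) + 2))))) => //; last first.
  have := tuple_time_mono Pb iN; rewrite /k; lia.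
have [_ [_ [E2 _]]] := C; rewrite /main_body.
do 5!apply: run_step; set s2 := do_instr _ _ _; rewrite ?add0n.
have f12 : fr (among [:: 8]%N) (among [:: 2; 3; 4]%N) s s2 by rewrite /s2; frs.
have E82 : nmem s2 8 = k by rewrite /s2 /= E8 E2 addn1.
have Z32 : zmem s2 3 = k%:R by rewrite /s2 /= Z3 Z8 natr1.
have Z22 : zmem s2 2 = lambda ^+ k / k`!%:R.
  rewrite /s2 /= Z2 Z3 Z8 Z0 natr1 exprSr factS natrM invfM.
  by rewrite -!mulrA; congr (_ * _); rewrite mulrCA [RHS]mulrA mulrC [in RHS]mulrC; ring.
have Z42 : zmem s2 4 = 0 by rewrite /s2 /=.
clearbody s2.
have C2 : cst s2 by apply: cst_fr f12 C _.
have Ez2 a : nmem s2 (40 + a) = 0 by rewrite f12.1.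
apply: run_seq; apply: run_weak (tuple_loop_run C2 E82 _ Ez2) _ (leqnn _).
  by move=> I; apply: HP.
move=> s3 [f23 Ez3 Z43]; rewrite Z42 add0r in Z43.
have C3 := cst_tuple f23 C2.
have E83 : nmem s3 8 = k by rewrite f23.1.
have E53 : nmem s3 5 = 40%N by rewrite f23.1 // f12.1.
have Z23 : zmem s3 2 = lambda ^+ k / k`!%:R by rewrite f23.2.
do 3!apply: run_step; set s4 := do_instr _ _ _; rewrite ?add0n.
pose B4 : pred nat := fun a => among [:: 4]%N a || (a == 40 + k)%N.
have f34 : fr (among [:: 12]%N) B4 s3 s4.
  rewrite /s4 /do_instr /= E53 E83.
  have H : B4 (40 + k)%N by rewrite /B4 eqxx orbT.
  by apply: fr_zset H _; frs.
have Z44 : zmem s4 4 = coef lambda k.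
  by rewrite /s4 /= E53 E83 /= Z43 Z23 mulrC.
have Zc4 : zmem s4 (40 + k) = coef lambda k.
  by rewrite /s4 /= E53 E83 eqxx Z43 Z23 mulrC.
clearbody s4.
have C4 : cst s4 by apply: cst_fr f34 C3 _.
have E84 : nmem s4 8 = k by rewrite f34.1.
have E54 : nmem s4 5 = 40%N by rewrite f34.1.
have E64 : nmem s4 6 = (41 + N)%N by rewrite f34.1 // f23.1 // f12.1.
have Z34 : zmem s4 3 = k%:R by rewrite f34.2 // f23.2.
apply: run_seq.
apply: run_weak (newton_step_run C4 E84 E54 E64 k0 Z34 _) _ (leqnn _).
  by rewrite Z44 Zc4.
move=> s5 [f45 Z55 Zb5].
apply: run_step; apply: run_do; set s6 := do_instr _ _ _.
have f56 : fr (among [::]) (among [:: 5; 7]%N) s5 s6 by rewrite /s6; frs.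
have f2 : fr A B s s2 by apply: fr_sub f12 => a; rewrite /A /B /among !inE; lia.
have f3 : fr A B s s3.
  apply: fr_trans f2 _; apply: fr_sub f23 => a.
    rewrite /A /regs_tuple /among !inE => /orP[H|->]; last by rewrite orbT.
    by apply/orP; left; lia.
  by rewrite /B /zregs_point /among !inE; lia.
have f4 : fr A B s s4.
  apply: fr_trans f3 _; apply: fr_sub f34 => a.
    by rewrite /A /among !inE; lia.
  by rewrite /B /B4 /among !inE => /orP[/eqP ->|->]; rewrite ?orbT.
have f5 : fr A B s s5.
  apply: fr_trans f4 _; apply: fr_sub f45 => a.
    by rewrite /A /among !inE; lia.
  by rewrite /B /among !inE => /orP[H|->]; [apply/orP; left; lia | rewrite ?orbT].
have f6 : fr A B s s6.
  apply: fr_trans f5 _; apply: fr_sub f56 => a; first by [].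
  by rewrite /B /among !inE; lia.
have Z76 : zmem s6 7 = zmem s5 7 + zmem s5 5 / zmem s5 3 by rewrite /s6.
clearbody s6.
have outc l : (l <= i)%N -> ~~ B (40 + l)%N.
  by move=> li; rewrite /B !negb_or; apply/and3P; split=> //; rewrite /k; lia.
have outb l : (l <= i)%N -> ~~ B (41 + N + l)%N.
  by move=> li; rewrite /B !negb_or; apply/and3P; split=> //; rewrite /k; lia.
have c6 l : (l <= k)%N -> zmem s6 (40 + l) = zmem s4 (40 + l).
  move=> lk; rewrite f56.2 // f45.2 // negb_or; apply/andP; split=> //.
  by move/andP: k0; lia.
have b6 l : (l < k)%N -> zmem s6 (41 + N + l) = zmem s4 (41 + N + l).
  move=> lk; rewrite f56.2 // f45.2 // negb_or; apply/andP; split=> //.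
  by lia.
have b6k : zmem s6 (41 + N + k) = newton_value s4 N k by rewrite f56.2.
have low a : (a < 8)%N -> ~~ A a.
  by move=> a8; rewrite /A /among !inE; lia.
split.
- apply: cst_fr f6 C _; apply/hasPn => a; rewrite !inE => H.
  by rewrite /A /among !inE; lia.
- by split; rewrite ?(f6.1 5%N) ?(f6.1 6%N) ?(f6.1 7%N) ?low // f56.1 // f45.1.
- move=> a; rewrite f56.1 // f45.1 // f34.1 //.
- split; rewrite ?(f6.2 0%N) ?(f6.2 8%N) //.
    by rewrite f56.2 // f45.2 // f34.2.
  by rewrite f56.2 // f45.2.
split.
- have Z7s5 : zmem s5 7 = zmem s 7 by rewrite f45.2 // f34.2 // f23.2 // f12.2.
  have Z3s5 : zmem s5 3 = k%:R by rewrite f45.2.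
  rewrite Z76 Z7s5 Z3s5 Z55 big_ord_recr /= -/k b6k Z7; congr (_ + _).
  by apply: eq_bigr => l _; rewrite (f6.2 (41 + N + l.+1)%N) ?outb.
- by rewrite f6.2 ?outb.
- move=> l; rewrite leq_eqVlt => /orP[/eqP ->|li]; first by rewrite c6.
  by rewrite f6.2 ?outc ?Zc.
- move=> l /andP[l0]; rewrite leq_eqVlt => /orP[/eqP ->|li].
    by rewrite b6k; apply/esym/newton_value_ext.
  rewrite f6.2 ?outb // Zb ?l0 //; apply/esym/newton_value_ext => j jl.
    by rewrite f6.2 ?outc //; apply: leq_trans jl _.
  by rewrite f6.2 ?outb //; apply: leq_trans (ltnW jl) _.
Qed.

Lemma main_loop_run lambda N s Pb : main_inv lambda N 0 s ->
  (forall k I, (k <= N)%N -> (forall l, (l < k)%N -> (I l < m)%N) ->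
     (radix (siz k I) n <= Pb)%N) ->
  run o main_loop s (main_inv lambda N N)
    (N * (tuple_time Pb N + 9 * N + 15).+1).+1.
Proof.
move=> H0 HP; apply: run_while => // [i s1 iN H|s1 [_ [_ _ E7 E8] _ _ _]].
  have [_ [_ _ E7 E8] _ _ _] := H.
  by split; [rewrite /= E7 E8 | exact: main_step_run].
by rewrite /= E7 E8 ltnn.
Qed.

Lemma taylor_algorithm_run lambda (eps : R) N0 D1 K Pb :
  (forall i, (i < K)%N -> 2 ^+ i * eps ^+ 2 < (m + n)%:R) ->
  (m + n)%:R <= 2 ^+ K * eps ^+ 2 ->
  let N := (N0 + K * D1)%N in
  (forall k I, (k <= N)%N -> (forall l, (l < k)%N -> (I l < m)%N) ->
     (radix (siz k I) n <= Pb)%N) ->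
  run o (taylor_algorithm N0 D1) (init_state n m lambda eps)
    (fun s => exists2 b, newton_seq N (coef lambda) b &
       zmem s 0 = cexp (\sum_(k < N) b k.+1 / k.+1%:R))
    (3 * (n + m) + 3 * K + N * (tuple_time Pb N + 9 * N + 16) + 23).
Proof.
move=> HK KH N HP; set s0 := init_state _ _ _ _.
apply: (@run_weak _ _ _ _ (fun s => exists2 b, newton_seq N (coef lambda) b &
       zmem s 0 = cexp (\sum_(k < N) b k.+1 / k.+1%:R)) _
   (4 + ((3 * (n + m) + 3 * K + 8) +
     (8 + ((N * (tuple_time Pb N + 9 * N + 15).+1).+1 + 1))))) => //; last by lia.
do 4!apply: run_step; set s1 := do_instr _ _ _; rewrite ?add0n.
have f01 : fr (among [:: 2; 3; 4]%N) (among [:: 8]%N) s0 s1 by rewrite /s1; frs.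
have C1 : cst s1 by [].
have Z81 : zmem s1 8 = 1 by [].
clearbody s1.
have Z11 : zmem s1 1 = eps%:C by rewrite f01.2.
apply: run_seq; apply: run_weak (find_order_run N0 D1 C1 Z11 Z81 HK KH) _ (leqnn _).
move=> s2 [f12 E7]; rewrite -/N in E7.
have C2 : cst s2 by apply: cst_fr f12 C1 _.
have [_ [_ [E22 _]]] := C2.
have Z82 : zmem s2 8 = 1 by rewrite f12.2.
have Z02 : zmem s2 0 = lambda by rewrite f12.2 // f01.2.
do 8!apply: run_step; set s3 := do_instr _ _ _; rewrite ?add0n.
have f23 : fr (among [:: 5; 6; 8]%N) (among [:: 2; 3; 7; 40]%N) s2 s3.
  by rewrite /s3; frs.
have [F5 F6 F8] : [/\ nmem s3 5 = 40%N, nmem s3 6 = (41 + N)%N & nmem s3 8 = 0%N].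
  by rewrite /s3 /= E7 E22; split=> //; lia.
have [G2 G3 G7 G40] : [/\ zmem s3 2 = 1, zmem s3 3 = 0, zmem s3 7 = 0 &
    zmem s3 40 = 1] by rewrite /s3 /= Z82.
clearbody s3.
have C3 : cst s3 by apply: cst_fr f23 C2 _.
have H3 : main_inv lambda N 0 s3.
  split=> //.
  - by split=> //; rewrite f23.1.
  - by move=> a; rewrite f23.1 // f12.1 // f01.1.
  - by split; rewrite ?expr0 ?fact0 ?divr1 // f23.2.
  - split; first by rewrite big_ord0.
    + by rewrite f23.2 // f12.2 // f01.2.
    + move=> k; rewrite leqn0 => /eqP ->.
      by rewrite addn0 G40 /coef moment0 expr0 fact0 divr1 mulr1.
    + by move=> k; rewrite lt0n leqn0 => /andP[/negbTE ->].
apply: run_seq; apply: run_weak (main_loop_run H3 HP) _ (leqnn _).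
move=> s4 [_ _ _ _ [Z7 Zb0 Zc Zb]]; apply: run_do => /=.
exists (fun k => zmem s4 (41 + N + k)); last by rewrite Z7.
split=> // k kN; rewrite Zb // /newton_value Zc; last by case/andP: kN.
congr (_ - _); apply: eq_bigr => j _; rewrite Zc //.
by case/andP: kN => _; apply: leq_trans; exact: leq_subr.
Qed.

End Verification.

(** * Moments *)

Section InputOracle.
Variables (R : realType) (n m : nat) (X : 'I_n -> finProbSpace R).
Local Notation P := (prodSpace X).
Variables (J : 'I_m -> {set 'I_n}) (phi : 'I_m -> P -> R[i]) (x0 : P).
Implicit Types (x y : P) (I v : nat -> nat) (j : 'I_n) (S T : {set 'I_n}).
Local Notation o := (input_oracle J phi).

(** The numbering is that of [enum], inverse to the [enum_rank] used by the oracle; [x0 j] is the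
    value out of range. *)
Definition elt j a : X j := nth (x0 j) (enum (X j)) a.

Lemma rank_elt j a : (a < #|X j|)%N -> enum_rank (elt j a) = a :> nat.
Proof.
by move=> aX; rewrite /elt -(enum_val_nth (x0 j) (Ordinal aX)) enum_valK.
Qed.

Lemma osizeE j : osize o j = #|X j|.
Proof. by rewrite /= valK. Qed.

Lemma carrier_gt0 j : (0 < #|X j|)%N.
Proof. by apply/card_gt0P; exists (x0 j). Qed.

Lemma oprobE j a : (a < #|X j|)%N -> oprob o j a = (mass (elt j a))%:C.
Proof.
move=> aX; rewrite /= valK; case: pickP => [e /eqP Ee|/(_ (elt j a))].
  suff -> : e = elt j a by [].
  by apply: enum_rank_inj; apply: val_inj; rewrite /= Ee rank_elt.
by rewrite rank_elt ?eqxx.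
Qed.

Lemma mass_card1 j (e : X j) : (#|X j| <= 1)%N -> mass e = 1.
Proof.
move=> X1; rewrite -(mass_sum1 (X j)) (bigD1 e) //= big1 ?addr0 // => a ae.
by case/eqP: ae; apply: (card_le1_eqP X1).
Qed.

Lemma ophiE (i : 'I_m) v x : (forall j, x j = elt j (v j)) ->
  (forall j, (v j < #|X j|)%N) -> ophi o i v = phi i x.
Proof.
move=> xv vX; rewrite /= valK; case: pickP => [y /forallP Hy|/(_ x)].
  congr (phi i _); apply/ffunP => j; apply: enum_rank_inj; apply: val_inj => /=.
  by rewrite xv rank_elt //; apply/eqP.
by move/negbT/forallPn => [j]; rewrite xv rank_elt ?eqxx.
Qed.

Lemma ophi_input_ext i v v' : (forall j, (j < n)%N -> v j = v' j) ->
  ophi o i v = ophi o i v'.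
Proof.
move=> E /=; case: insub => // i'.
rewrite (@eq_pick _ _ [pred x : P | [forall j, enum_rank (x j) == v' j :> nat]]) //.
by move=> x /=; apply: eq_forallb => j; rewrite E.
Qed.

Lemma odepE (i : 'I_m) j : odep o i j = (j \in J i).
Proof. by rewrite /= !valK. Qed.

(** Averaging over a coordinate that [G] ignores averages a constant against a probability
    measure. *)
Lemma avg_indep S T (G : P -> R[i]) x : T \subset ~: S ->
  (forall y t (a : X t), t \notin S -> G (upd y a) = G y) ->
  avg (T :|: S) G x = avg S G x.
Proof.
move=> TS HG; move: T TS x; apply: setS_ind => [|t T tT IH] TS x.
  by rewrite set0U.
have tS : t \notin S by have := subsetP TS t; rewrite !inE eqxx => ->.
have {}IH := IH (subset_trans (subsetU1 _ _) TS).
rewrite -setUA avgU1; last by rewrite inE negb_or tT.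
rewrite (eq_bigr (fun a : X t => (mass a)%:C * avg S G x)) => [|a _].
  by rewrite -big_distrl /= mass_sumC mul1r.
by rewrite IH -avg_upd //; congr (_ * _); apply: avg_ext => y; rewrite HG.
Qed.

Lemma avg_full S (G : P -> R[i]) x :
  (forall y t (a : X t), t \notin S -> G (upd y a) = G y) ->
  avg S G x = expectation G.
Proof.
move=> HG; rewrite -(avgT _ x) -(avg_indep x (subxx _) HG).
by rewrite setUC setUCr.
Qed.

Section Tuple.
Variables (k : nat) (I : nat -> nat).
Let S := siz o k I.
Let D : {set 'I_n} := [set j | has (fun l => odep o (I l) (val j)) (iota 0 k)].

Fact sizE j : S j = if j \in D then #|X j| else 1%N.
Proof. by rewrite inE /S /siz osizeE. Qed.

Fact digit_siz u j : (digit S u j < #|X j|)%N.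
Proof.
have : (digit S u j < S j)%N.
  by apply: digit_lt; rewrite sizE; case: ifP => // _; exact: carrier_gt0.
by rewrite sizE; case: ifP => // _; rewrite ltnS leqn0 => /eqP ->; exact: carrier_gt0.
Qed.

Definition place (p : nat) v x : P :=
  [ffun j : 'I_n => if ((j < p)%N && (j \in D)) then elt j (v (val j)) else x j].

(** Induction on the number [p] of coordinates counted. Coordinate [p] is the most significant
    digit: if some factor depends on it, the sum over its values is one step of [avgU1]; otherwise
    its radix is 1 and nothing changes. *)
Lemma sum_digits_avg p (G : P -> R[i]) x : (p <= n)%N ->
  \sum_(u < radix S p) (\prod_(j < p) if (1 < S j)%N then oprob o j (digit S u j) else 1)
     * G (place p (digit S u) x) = avg [set j in D | (j < p)%N] G x.
Proof.
elim: p x => [|p IH] x pn.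
  rewrite /radix big_ord0 big_ord1 big_ord0 mul1r.
  have -> : [set j in D | (j < 0)%N] = set0 by apply/setP => j; rewrite !inE andbF.
  by rewrite avg0; congr (G _); apply/ffunP => j; rewrite ffunE.
pose F v := (\prod_(j < p.+1) if (1 < S j)%N then oprob o j (v (val j)) else 1) *
  G (place p.+1 v x).
rewrite -/(F _) (eq_bigr (fun u : 'I__ => F (digit S u))) //.
rewrite (sum_digits (F := F)); first last.
- move=> l ip; have jn : (l < n)%N by apply: leq_trans ip pn.
  rewrite -[l]/(val (Ordinal jn)) sizE; case: ifP => // _; exact: carrier_gt0.
- move=> v v' E; rewrite /F; congr (_ * G _); first by apply: eq_bigr => j _; rewrite (E j).
  by apply/ffunP => j; rewrite !ffunE; case: ifP => // /andP[jp _]; rewrite E.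
pose j0 := Ordinal pn.
have Fa a u : F (fun l => if l == p then a else digit S u l) =
  (if (1 < S p)%N then oprob o p a else 1) *
  ((\prod_(j < p) if (1 < S j)%N then oprob o j (digit S u j) else 1) *
   G (place p.+1 (fun l => if l == p then a else digit S u l) x)).
  rewrite /F big_ord_recr /= eqxx mulrA [_ * (if _ then _ else _)]mulrC; congr (_ * _ * _).
  by apply: eq_bigr => j _; rewrite ltn_eqF.
under eq_bigr => a _ do (under eq_bigr => u _ do rewrite Fa; rewrite -big_distrr).
have [jD|jD] := boolP (j0 \in D).
  have Sp : S p = #|X j0| by rewrite -[p]/(val j0) sizE jD.
  have -> : [set j in D | (j < p.+1)%N] = j0 |: [set j in D | (j < p)%N].
    apply/setP => j; rewrite !inE ltnS leq_eqVlt -(inj_eq val_inj) /=.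
    case: eqP => [E|_] //=; rewrite andbT.
    have -> : j = j0 by exact: val_inj.
    by move: jD; rewrite inE => ->.
  rewrite avgU1; last by rewrite !inE ltnn andbF.
  rewrite (reindex (@enum_val _ (X j0))) /=; last first.
    by exists enum_rank => a _; rewrite ?enum_valK ?enum_rankK.
  rewrite Sp; apply: eq_bigr => a _.
  have Ea : enum_val a = elt j0 a by rewrite (enum_val_nth (x0 j0)).
  rewrite -IH ?(ltnW pn) //; congr (_ * _).
    (* A relevant space with a single element is not queried, and the factor 1 put in its place is
       its mass. *)
    case: ifPn => X1.
      by apply: etrans (oprobE (j := j0) (ltn_ord a)) _; rewrite Ea.
    by rewrite mass_card1 // leqNgt.
  apply: eq_bigr => u _; congr (_ * G _); apply/ffunP => j.
  rewrite [LHS]ffunE [RHS]ffunE; have [E|ne] := eqVneq (val j) p.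
    have -> : j = j0 by exact: val_inj.
    by rewrite ltnSn jD ltnn /= ?eqxx upd_same Ea.
  rewrite ltnS leq_eqVlt (negbTE ne) /=; case: ifP => // _.
  by rewrite upd_other // eq_sym -(inj_eq val_inj).
have Sp : S p = 1%N by rewrite -[p]/(val j0) sizE (negbTE jD).
rewrite Sp big_ord1 /= mul1r.
have -> : [set j in D | (j < p.+1)%N] = [set j in D | (j < p)%N].
  apply/setP => j; rewrite !inE ltnS leq_eqVlt; case: eqP => [E|_] //=.
  have -> : j = j0 by exact: val_inj.
  by move: jD; rewrite inE => /negbTE ->.
rewrite -IH ?(ltnW pn) //; apply: eq_bigr => u _; congr (_ * G _).
apply/ffunP => j; rewrite !ffunE ltnS leq_eqVlt.
have [E|ne] := eqVneq (val j) p; last by [].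
have -> : j = j0 by exact: val_inj.
by rewrite (negbTE jD) !andbF.
Qed.

End Tuple.

Hypothesis phi_loc : forall i (x y : P),
  (forall j, j \in J i -> x j = y j) -> phi i x = phi i y.

Definition phin x (i : nat) : R[i] := if insub i is Some i' then phi i' x else 0.

Lemma phinE x l (lm : (l < m)%N) : phin x l = phi (Ordinal lm) x.
Proof.
rewrite /phin; case: insubP => [i _ Ei|]; last by rewrite lm.
by congr (phi _ x); apply: val_inj.
Qed.

(** The product of factors ignores the coordinates outside [D], so averaging over [D] gives the full
    expectation. The base point [z] has element number 0 everywhere, matching the digit 0 that the
    counter keeps outside [D]. *)
Lemma point_sumE k I : (forall l, (l < k)%N -> (I l < m)%N) ->
  point_sum o n k I = expectation (fun x => \prod_(l < k) phin x (I l)).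
Proof.
move=> Im; set S := siz o k I.
pose D : {set 'I_n} := [set j | has (fun l => odep o (I l) (val j)) (iota 0 k)].
pose z : P := [ffun j => elt j 0].
pose G x := \prod_(l < k) phin x (I l).
rewrite -(@avg_full D G z); last first.
  move=> y t a tD; apply: eq_bigr => l _.
  rewrite !(phinE _ (Im l (ltn_ord l))); apply: phi_loc => j jJ.
  rewrite upd_other //; apply: contraNneq tD => ->; rewrite inE.
  apply/hasP; exists (val l); first by rewrite mem_iota /= add0n.
  by rewrite -[I _]/(val (Ordinal (Im l (ltn_ord l)))) odepE.
have -> : D = [set j in D | (j < n)%N].
  by apply/setP => j; rewrite [RHS]inE ltn_ord andbT.
rewrite -sum_digits_avg //; apply: eq_bigr => u _; rewrite /weight_of; congr (_ * _).
apply: eq_bigr => l _; rewrite (phinE _ (Im l (ltn_ord l))).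
apply: (ophiE (Ordinal (Im l (ltn_ord l)))) => j; last exact: digit_siz.
rewrite !ffunE ltn_ord /=; case: ifPn => // jD; congr elt.
have Sj : S j = 1%N by rewrite /S sizE -/D (negbTE jD).
have : (digit S u j < S j)%N by apply: digit_lt; rewrite Sj.
by rewrite Sj ltnS leqn0 => /eqP ->.
Qed.

(** Distributivity over all [k]-tuples of indices, enumerated by base [m] digits. *)
Lemma sum_digits_prod (h : nat -> R[i]) k :
  \sum_(t < radix (fun=> m) k) \prod_(l < k) h (digit (fun=> m) t l) =
  (\sum_(i < m) h i) ^+ k.
Proof.
have [->|m0] := posnP m.
  case: k => [|k]; first by rewrite /radix big_ord0 big_ord1 big_ord0 expr0.
  by rewrite radixS muln0 !big_ord0 expr0n.
elim: k => [|k IH]; first by rewrite /radix big_ord0 big_ord1 big_ord0 expr0.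
rewrite (sum_digits (F := fun v => \prod_(l < k.+1) h (v l))) //; last first.
  by move=> v v' E; apply: eq_bigr => l _; rewrite E.
rewrite exprS big_distrl /=; apply: eq_bigr => a _.
rewrite -IH big_distrr /=; apply: eq_bigr => u _.
rewrite big_ord_recr /= eqxx mulrC; congr (_ * _).
by apply: eq_bigr => l _; rewrite ltn_eqF.
Qed.

Lemma momentE k : (0 < m)%N ->
  moment o n m k = expectation (fun x => (\sum_(i < m) phi i x) ^+ k).
Proof.
move=> m0; rewrite /moment.
transitivity (\sum_(t < radix (fun=> m) k)
   avg setT (fun x => \prod_(l < k) phin x (digit (fun=> m) t l)) x0).
  by apply: eq_bigr => t _; rewrite avgT point_sumE // => l _; apply: digit_lt.
rewrite -avg_sum -(avgT _ x0); apply: avg_ext => x.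
rewrite (sum_digits_prod (phin x)); congr (_ ^+ k).
by apply: eq_bigr => i _; rewrite /phin valK.
Qed.

(** Each further factor makes at most [r] more coordinates relevant, and each of these multiplies
    the number of points by at most [q]. *)
Lemma radix_siz_le q r k I : (1 <= q)%N -> (forall j, (#|X j| <= q)%N) ->
  (forall i, (#|J i| <= r)%N) -> (forall l, (l < k)%N -> (I l < m)%N) ->
  (radix (siz o k I) n <= q ^ (r * k))%N.
Proof.
move=> q1 Xq Jr; elim: k => [|k IH] Im.
  by rewrite /radix muln0 expn0 big1.
have {}IH := IH (fun l lk => Im l (ltnW lk)).
have Ik := Im k (ltnSn k); pose i : 'I_m := Ordinal Ik.
apply: (@leq_trans (radix (siz o k I) n * q ^ #|J i|)%N); last first.
  by rewrite mulnS addnC expnD leq_mul // leq_pexp2l.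
have -> : (q ^ #|J i| = \prod_(j < n) (if j \in J i then q else 1))%N.
  by rewrite -big_mkcond /= prod_nat_const.
rewrite /radix -big_split /=; apply: leq_prod => j _.
rewrite sizS -[I k]/(val i) odepE osizeE; case: ifP => jJ; last by rewrite muln1.
rewrite (leq_trans (Xq j)) // leq_pmull // sizE; case: ifP => // _; exact: carrier_gt0.
Qed.

End InputOracle.

(** * Order of the Taylor polynomial and running time *)

Section Order.
Variable R : realType.
Implicit Types (delta eps : R).

Lemma exists_pow2_ge (y : R) : exists K, y <= 2 ^+ K.
Proof.
exists (Num.truncn y).+1; have [y0|y0] := leP 0 y; last first.
  by apply: le_trans (ltW y0) _; rewrite exprn_ge0.
have /andP[_ H] := truncn_itv y0; apply: le_trans (ltW H) _.
by rewrite -natrX ler_nat ltnW // ltn_expl.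
Qed.

(** By induction [(1 - delta) ^ k (1 + k delta) <= 1]; take [k delta >= 3]. *)
Lemma exists_rate delta : 0 < delta < 1 ->
  exists2 D1, (0 < D1)%N & (1 - delta) ^+ D1 <= 4^-1.
Proof.
move=> /andP[d0 d1].
have H k : (1 - delta) ^+ k * (1 + k%:R * delta) <= 1.
  elim: k => [|k IH]; first by rewrite expr0 mul0r addr0 mulr1.
  rewrite exprS -natr1; apply: le_trans IH.
  have p0 : 0 <= (1 - delta) ^+ k by rewrite exprn_ge0 //; lra.
  have k0 : (0 : R) <= k%:R by rewrite ler0n.
  rewrite [(1 - delta) * _]mulrC -mulrA ler_wpM2l //; nra.
exists (Num.truncn (3 / delta)).+1 => //.
have y0 : 0 <= 3 / delta by rewrite divr_ge0 // ltW.
have /andP[_ T] := truncn_itv y0.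
set k := (Num.truncn _).+1 in T *; have {}H := H k.
rewrite ltr_pdivrMr // in T.
rewrite -[leRHS]mul1r ler_pdivlMr //; apply: le_trans H.
by rewrite ler_wpM2l ?exprn_ge0 //; lra.
Qed.

(** The square of [eps] appears because the prefactor of the error is itself of size [(m + n) / eps]
    and the product must come out below [eps]. Minimality of [K] serves the running time. *)
Lemma exists_order (eps : R) h : 0 < eps < 1 -> exists2 K,
  forall i, (i < K)%N -> 2 ^+ i * eps ^+ 2 < h%:R & h%:R <= 2 ^+ K * eps ^+ 2.
Proof.
move=> /andP[e0 e1]; have e2 : 0 < eps ^+ 2 by rewrite exprn_gt0.
have ex : exists K, h%:R <= 2 ^+ K * eps ^+ 2.
  have [K HK] := exists_pow2_ge (h%:R / eps ^+ 2).
  by exists K; rewrite -ler_pdivrMr.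
have [K HK Kmin] := find_ex_minn ex; exists K => // i iK.
rewrite ltNge; apply/negP => /Kmin; lia.
Qed.

(* Each summand of the first factor is beaten by half of the gain
   [rho ^ (D1 * (K0 + K)) <= 4 ^- (K0 + K)]. *)
Lemma order_error (delta eps : R) r n m D1 K0 K N :
  N = (D1 * K0 + K * D1)%N -> 0 < delta < 1 -> 0 < eps < 1 ->
  (0 < n)%N -> (0 < m)%N -> (1 - delta) ^+ D1 <= 4^-1 ->
  (D1%:R + 6 * r%:R + 19) * (8 * expR delta^-1) <= 2 ^+ K0 ->
  (m + n)%:R <= 2 ^+ K * eps ^+ 2 ->
  (N%:R + 6 * (r * m)%:R + n%:R + 16 / eps + 2) * (1 - delta) ^+ N.+1 *
    (8 * expR delta^-1) <= eps.
Proof.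
move=> NE' /andP[d0 d1] /andP[e0 e1] n0 m0 HD HK0 HK.
set E := 8 * expR delta^-1 in HK0 *.
have E0 : 0 <= E by rewrite mulr_ge0 ?expR_ge0.
pose a : R := 2 ^+ K0; pose b : R := 2 ^+ K; pose h : R := (m + n)%:R.
have a1 : 1 <= a by rewrite exprn_ege1 // ler1n.
have b0 : 0 < b by rewrite exprn_gt0.
have h2 : 2 <= h by rewrite /h (ler_nat _ 2) (leq_add m0 n0).
have NE2 : N = (D1 * (K0 + K))%N by rewrite NE' mulnDr [(K * _)%N]mulnC.
have rhoN : (1 - delta) ^+ N.+1 <= (a * b) ^- 2.
  rewrite exprSr; apply: le_trans (_ : (1 - delta) ^+ N <= _).
    by rewrite ler_piMr ?exprn_ge0 //; lra.
  have -> : (a * b) ^- 2 = 4^-1 ^+ (K0 + K).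
    by rewrite /a /b -exprD -exprM mulnC exprM exprVn -natrX.
  by rewrite NE2 exprM lerXn2r ?nnegrE ?exprn_ge0 ?invr_ge0 //; lra.
have NE : N%:R <= D1%:R * (a * b).
  rewrite NE2 natrM ler_wpM2l // /a /b -exprD -natrX ler_nat.
  by rewrite ltnW // ltn_expl.
have mE : m%:R <= h by rewrite /h ler_nat leq_addr.
have nE : n%:R <= h by rewrite /h ler_nat leq_addl.
have r0 : (0 : R) <= r%:R by [].
have D0 : (0 : R) <= D1%:R by [].
have eV : 1 <= eps^-1 by rewrite invf_ge1 // ltW.
pose s := (6 * r%:R + 19) * (h / eps).
have restE : 6 * (r * m)%:R + n%:R + 16 / eps + 2 <= s.
  have he : h <= h / eps by rewrite ler_peMr //; lra.
  have he2 : 2 * (16 / eps) <= 16 * (h / eps).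
    by rewrite mulrA [2 * 16]mulrC -mulrA ler_wpM2l // ler_wpM2r ?invr_ge0 // ltW.
  have rm : r%:R * m%:R <= r%:R * (h / eps) by rewrite ler_wpM2l //; lra.
  rewrite natrM /s; lra.
have ab0 : 0 < a * b by rewrite mulr_gt0 //; lra.
apply: le_trans (_ : (D1%:R * (a * b) + s) * (a * b) ^- 2 * E <= _).
  rewrite ler_wpM2r // ler_pM //.
  - by rewrite !addr_ge0 ?mulr_ge0 ?invr_ge0 // ltW.
  - by rewrite exprn_ge0 // subr_ge0 ltW.
  - by move: NE restE; lra.
have ab_e : (a * b)^-1 <= a^-1 * eps.
  rewrite invfM ler_wpM2l ?invr_ge0 //; first by lra.
  rewrite -[leLHS]mul1r ler_pdivrMr //.
  have : h <= b * eps ^+ 2 := HK.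
  nra.
have an0 : a != 0 by rewrite gt_eqF //; lra.
have bn0 : b != 0 by rewrite gt_eqF.
have ab1 : 1 <= a * b by rewrite mulr_ege1 // exprn_ege1 // ler1n.
have s_e : s * (a * b) ^- 2 <= (6 * r%:R + 19) * (a^-1 * eps).
  rewrite /s -mulrA ler_wpM2l //; first by lra.
  (* After clearing denominators this is exactly [h <= b * eps ^ 2]. *)
  have u : h / eps * (a * b)^-1 <= a^-1 * eps.
    rewrite ler_pdivrMr //; have -> : a^-1 * eps * (a * b) = b * eps.
      by field; rewrite an0.
    by rewrite ler_pdivrMr // -mulrA -expr2.
  rewrite expr2 invfM mulrA -[leRHS]mulr1 ler_pM // ?invr_ge0 ?(ltW ab0) //.
    by rewrite !mulr_ge0 ?invr_ge0 // ?(ltW ab0) ?(ltW e0) //; lra.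
  by rewrite invf_le1.
have DE : D1%:R * (a * b) * (a * b) ^- 2 <= D1%:R * (a^-1 * eps).
  have -> : D1%:R * (a * b) * (a * b) ^- 2 = D1%:R * (a * b)^-1.
    by field; rewrite an0 bn0.
  by rewrite ler_wpM2l.
apply: le_trans (_ : (D1%:R + 6 * r%:R + 19) * (a^-1 * eps) * E <= _).
  by rewrite ler_wpM2r // mulrDl; lra.
have -> : (D1%:R + 6 * r%:R + 19) * (a^-1 * eps) * E =
  ((D1%:R + 6 * r%:R + 19) * E) / a * eps by ring.
rewrite -[leRHS]mul1r ler_wpM2r ?(ltW e0) // ler_pdivrMr ?mul1r //; lra.
Qed.

(** Minimality of [K] gives [2 ^ (K - 1) * eps ^ 2 < h], so [K ln 2 <= ln 2 + ln h - 2 ln eps];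
    since [h >= 2], the term [ln 2] is absorbed by [ln h]. *)
Lemma order_log_bound (eps : R) h D1 K0 K : 0 < eps < 1 -> (2 <= h)%N ->
  (forall i, (i < K)%N -> 2 ^+ i * eps ^+ 2 < h%:R) ->
  (D1 * K0 + K * D1)%:R <=
    D1%:R * (K0%:R + 2) / ln 2 * (ln h%:R - ln eps) :> R.
Proof.
move=> /andP[e0 e1] h2 HK.
have l2 : 0 < ln (2 : R) by rewrite ln_gt0 // ltr1n.
have h0 : 0 < h%:R :> R by rewrite ltr0n; lia.
have lh : ln 2 <= ln h%:R :> R by rewrite ler_ln ?posrE // ler_nat.
have le0 : ln eps < 0 by rewrite ln_lt0 // e0.
have KE : K%:R * ln 2 <= ln 2 + (ln h%:R - 2 * ln eps) :> R.
  case: K HK => [|K] HK; first by rewrite mul0r; lra.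
  have /ltW := HK K (ltnSn K).
  rewrite -ler_ln ?posrE ?mulr_gt0 ?exprn_gt0 // lnM ?posrE ?exprn_gt0 //.
  have -> : ln (2 ^+ K) = K%:R * ln 2 :> R by rewrite lnXn // mulr_natl.
  have -> : ln (eps ^+ 2) = 2 * ln eps by rewrite lnXn // mulr_natl.
  rewrite -[K.+1%:R]natr1; lra.
rewrite mulrAC ler_pdivlMr // natrD !natrM [K%:R * D1%:R]mulrC -mulrDr.
rewrite -!mulrA ler_wpM2l //.
have K0E : K0%:R * ln 2 <= K0%:R * (ln h%:R - ln eps) :> R.
  by rewrite ler_wpM2l //; lra.
lra.
Qed.

(** Everything is absorbed in powers of [B = q (m + n) >= 4]: [N] and [m ^ N] in [B ^ N], the number
    of points in [B ^ (r N)], numerical constants in [B ^ 3] and [B ^ 4]. The total exponent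
    [(r + 3) N + 8] is at most [(r + 11) N] as [N >= 1]. *)
Lemma taylor_time_bound n m q r N K : (1 <= n)%N -> (1 <= m)%N -> (2 <= q)%N ->
  (1 <= N)%N -> (K <= N)%N ->
  (3 * (n + m) + 3 * K + N * (tuple_time n m (q ^ (r * N)) N + 9 * N + 16) + 23
   <= (q * (m + n)) ^ ((r + 11) * N))%N.
Proof.
move=> n1 m1 q2 N1 KN; set B := (q * (m + n))%N.
have B4 : (4 <= B)%N by rewrite /B -[4%N]/(2 * 2)%N leq_mul //; lia.
have nB : (n <= B)%N by rewrite /B; nia.
have mB : (m <= B)%N by rewrite /B; nia.
have nmB : (n + m <= B)%N by rewrite /B; nia.
have qB : (q <= B)%N by rewrite /B; nia.
have B0 : (0 < B)%N by lia.
have NB : (N <= B ^ N)%N.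
  by apply: leq_trans (ltnW (ltn_expl N (_ : 1 < 2)%N)) _ => //; rewrite leq_exp2r //; lia.
have B64 : (64 <= B ^ 3)%N by apply: leq_trans (_ : 4 ^ 3 <= _)%N; rewrite // leq_exp2r.
have B256 : (256 <= B ^ 4)%N by apply: leq_trans (_ : 4 ^ 4 <= _)%N; rewrite // leq_exp2r.
set Pb := (q ^ (r * N))%N.
have Pb1 : (1 <= Pb)%N by rewrite expn_gt0; lia.
have PbB : (Pb <= B ^ (r * N))%N.
  by rewrite /Pb; case: (r * N)%N => // e; rewrite leq_exp2r.
have mNB : (m ^ N <= B ^ N)%N by rewrite leq_exp2r.
have mN1 : (1 <= m ^ N)%N by rewrite expn_gt0 m1.
have t1 : (point_time n Pb N + 9 * N + 5 <= Pb * (B ^ 4 * B * B ^ N))%N.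
  apply: leq_trans (_ : Pb * (256 * n * N) <= _)%N.
    rewrite /point_time.
    have : (N <= n * N)%N by rewrite leq_pmull.
    nia.
  by rewrite leq_mul2l; apply/orP; right; rewrite !leq_mul.
have t2 : (tuple_time n m Pb N <= B ^ (r * N + N + N + 5) + 2)%N.
  rewrite /tuple_time leq_add2r; apply: leq_trans (leq_mul mNB t1) _.
  apply: leq_trans (leq_mul (leqnn _) (leq_mul PbB (leqnn _))) _.
  by rewrite -expnSr -!expnD leq_pexp2l //; lia.
set A := (B ^ (r * N + N + N + 5))%N in t2.
have AN : (N <= A)%N by apply: leq_trans NB _; rewrite /A leq_pexp2l //; lia.
have AB : (B <= A)%N by rewrite -{1}[B]expn1 /A leq_pexp2l //; lia.
apply: leq_trans (_ : B ^ N * (64 * A) <= _)%N.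
  have : (N * (tuple_time n m Pb N + 9 * N + 16) <= N * (A + 9 * A + 5 * A))%N.
    by rewrite leq_mul2l; apply/orP; right; lia.
  have : (N * A <= B ^ N * A)%N by rewrite leq_mul2r NB orbT.
  have : (A <= B ^ N * A)%N by rewrite leq_pmull // expn_gt0 B0.
  nia.
apply: leq_trans (_ : B ^ N * (B ^ 3 * A) <= _)%N.
  by rewrite leq_mul2l leq_mul2r B64 !orbT.
by rewrite /A -!expnD leq_pexp2l // mulnDl; lia.
Qed.

End Order.

(** Masses summing to 1 exclude an empty factor; a point of the product is the reference point [x0]
    of the analysis. *)
Lemma prodSpace_inhabited (R : realType) (n : nat) (X : 'I_n -> finProbSpace R) :
  inhabited (prodSpace X).
Proof.
have H j : {a : X j | true}.
  case: (pickP (fun _ : X j => true)) => [a _|none]; first by exists a.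
  exfalso; have := mass_sum1 (X j); rewrite big_pred0 // => /eqP.
  by rewrite eq_sym oner_eq0.
by constructor; exact: [ffun j => sval (H j)].
Qed.

Theorem mainTheorem4 (R : realType) (delta : R) (r : nat) :
  0 < delta < 1 -> (2 <= r)%N ->
  exists (C : R) (algorithm : prog), 0 < C /\
    forall (n m q : nat) (X : 'I_n -> finProbSpace R)
           (phi : 'I_m -> prodSpace X -> R[i]) (J : 'I_m -> {set 'I_n})
           (c : nat) (lambda : R[i]) (eps : R),
      (1 <= n)%N -> (1 <= m)%N -> (2 <= q)%N -> (1 <= c)%N ->
      (forall j, (#|X j| <= q)%N) ->
      (forall i x y, differ_in_one x y -> `|phi i x - phi i y| <= 1) ->
      (forall i, (#|J i| <= r)%N) ->
      (forall i (x y : prodSpace X),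
         (forall j, j \in J i -> x j = y j) -> phi i x = phi i y) ->
      (forall j, (#|[set i | j \in J i]| <= c)%N) ->
      `|lambda| <= ((1 - delta) / (3 * c%:R * Num.sqrt (r%:R - 1)))%:C ->
      0 < eps < 1 ->
      exists (z : R[i]) (t : nat),
        [/\ computes_in (input_oracle J phi) algorithm
              (init_state n m lambda eps) z t,
            approximates z
              (expectation (fun x => cexp (lambda * \sum_(i < m) phi i x))) eps
          & t%:R <= (q * (m + n))%:R `^ (C * (ln (m + n)%:R - ln eps))].
Proof.
move=> d01 r2.
have [D1 D1_gt0 HD] := exists_rate d01.
have [K1 HK1] := exists_pow2_ge ((D1%:R + 6 * r%:R + 19) * (8 * expR delta^-1)).
(* The successor ensures [K0 > 0], hence [N >= 1]. *)
pose K0 := K1.+1.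
have HK0 : (D1%:R + 6 * r%:R + 19) * (8 * expR delta^-1) <= 2 ^+ K0 :> R.
  by apply: le_trans HK1 _; rewrite ler_weXn2l // ler1n.
have l2 : 0 < ln (2 : R) by rewrite ln_gt0 // ltr1n.
(* [r + 11] is the exponent of the running time per unit of [N]; the other factor is the constant of
   [order_log_bound]. *)
pose C : R := (r + 11)%:R * (D1%:R * (K0%:R + 2) / ln 2).
exists C, (taylor_algorithm (D1 * K0) D1); split.
  rewrite /C mulr_gt0 ?ltr0n ?addn_gt0 ?orbT // divr_gt0 // mulr_gt0 ?ltr0n //.
  by rewrite ltr_wpDl // ltr0n.
move=> n m q X phi J c lambda eps n1 m1 q2 c1 Xq lip Jr loc deg lam e01.
have [x0] := prodSpace_inhabited X.
have [K Kmin HK] := exists_order (m + n) e01.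
set N := (D1 * K0 + K * D1)%N.
have N1 : (1 <= N)%N by rewrite /N addn_gt0 muln_gt0 D1_gt0.
have KN : (K <= N)%N := leq_trans (leq_pmulr K D1_gt0) (leq_addl _ _).
have size_gt0 j : (j < n)%N -> (0 < osize (input_oracle J phi) j)%N.
  move=> jn; rewrite -[j]/(val (Ordinal jn)) osizeE.
  by apply/card_gt0P; exists (x0 (Ordinal jn)).
have ext := @ophi_input_ext R n m X J phi.
have radix_le k I : (k <= N)%N -> (forall l, (l < k)%N -> (I l < m)%N) ->
    (radix (siz (input_oracle J phi) k I) n <= q ^ (r * N))%N.
  move=> kN Im; apply: leq_trans (radix_siz_le phi x0 (ltnW q2) Xq Jr Im) _.
  by rewrite leq_pexp2l ?leq_mul // ltnW.
have [s [t [e [b Hb Ez] tT]]] :=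
  taylor_algorithm_run m1 size_gt0 ext lambda Kmin HK radix_le.
exists (zmem s 0), t; split; first by exists s.
- rewrite Ez; apply: (interpolation x0 m1 r2 c1 lip Jr loc deg d01 lam e01 N1).
    exact: order_error HK0 HK.
  apply: newton_seq_ext Hb => // k _.
  by rewrite /coef (momentE x0 loc).
- have h2 : (2 <= m + n)%N := leq_add m1 n1.
  have B1 : 1 <= (q * (m + n))%:R :> R.
    by rewrite ler1n muln_gt0 (ltnW q2) (ltnW h2).
  apply: le_trans (_ : (q * (m + n))%:R ^+ ((r + 11) * N) <= _).
    rewrite -natrX ler_nat; apply: leq_trans tT _.
    exact: taylor_time_bound.
  rewrite -powR_mulrn ?ler0n //; apply: ler_powR => //.
  rewrite natrM /C -[leRHS]mulrA ler_wpM2l ?ler0n //.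
  exact: order_log_bound.
Qed.
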